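(* Let $A(1,R)=\{z\in\mathbb{C} : 1<|z|<R\}$ with $R>1$, and let $F:\overline{A(1,R)}\to\mathbb{R}^3$ be a conformal minimal immersion representing a free boundary minimal annulus in the unit ball $\mathbb{B}^3$, i.e. $F(A(1,R))\subset\mathbb{B}^3$, $F(\partial A(1,R))\subset\partial\mathbb{B}^3$, and the surface meets $\partial\mathbb{B}^3$ orthogonally along its boundary. Let $\partial A_1=\{|z|=1\}$ and $\partial A_2=\{|z|=R\}$, and suppose that the boundary curves $F(\partial A_1)$ and $F(\partial A_2)$ are embedded. Then the Gauss map $g$ of the surface (the unit normal composed with stereographic projection, regarded as a complex-valued function on $A(1,R)$) is one to one, and it maps $A(1,R)$ onto the doubly-connected region bounded by $g(\partial A_1)$ and $g(\partial A_2)$.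
   Context: The Gauss map is the unit normal $N:A(1,R)\to\mathbb{S}^2$ of the immersion followed by stereographic projection $\mathbb{S}^2\to\mathbb{C}\cup\{\infty\}$; after rotating the surface one may assume it omits the value $\infty$, so that $g$ is a holomorphic function on $A(1,R)$ extending to the boundary. *)

(* Defs.v *)
(* C is identified with R * R (z = x + i y <-> (x, y)),
   R^3 with row vectors 'rV[R]_3. *)
From mathcomp Require Import all_boot all_order all_algebra.
From mathcomp Require Import all_classical all_reals all_analysis.
Import Order.TTheory GRing.Theory Num.Theory.
Import numFieldNormedType.Exports.
Set Implicit Arguments. Unset Strict Implicit. Unset Printing Implicit Defensive.
Local Open Scope ring_scope.
Local Open Scope classical_set_scope.

Section Defs.
Variable R : realType.
Local Notation vec3 := 'rV[R]_3.
Local Notation pt := (R * R)%type.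

Definition dot3 (u v : vec3) : R := \sum_(i < 3) u 0 i * v 0 i.
Definition enorm3 (u : vec3) : R := Num.sqrt (dot3 u u).
Definition cross3 (u v : vec3) : vec3 :=
  \row_(i < 3) match val i with
               | 0%N => u 0 1 * v 0 2%:R - u 0 2%:R * v 0 1
               | 1%N => u 0 2%:R * v 0 0 - u 0 0 * v 0 2%:R
               | _ => u 0 0 * v 0 1 - u 0 1 * v 0 0
               end.

Definition annulus (Rr : R) : set pt := [set p | 1 < p.1 ^+ 2 + p.2 ^+ 2 < Rr ^+ 2].
Definition closed_annulus (Rr : R) : set pt :=
  [set p | 1 <= p.1 ^+ 2 + p.2 ^+ 2 <= Rr ^+ 2].
Definition circle (r : R) : set pt := [set p | p.1 ^+ 2 + p.2 ^+ 2 = r ^+ 2].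

Fixpoint Ck (U : set pt) (n : nat) (f : pt -> vec3) : Prop :=
  match n with
  | 0%N => forall p, U p -> {for p, continuous f}
  | n'.+1 => (forall p, U p -> differentiable f p) /\
             forall v : pt, Ck U n' ('D_v f)
  end.
Definition smooth_on (U : set pt) (f : pt -> vec3) := forall n, Ck U n f.
Definition smooth_upto (S : set pt) (f : pt -> vec3) :=
  exists U : set pt, open U /\ S `<=` U /\ smooth_on U f.

Definition dx (F : pt -> vec3) (p : pt) : vec3 := 'D_((1 : R), (0 : R)) F p.
Definition dy (F : pt -> vec3) (p : pt) : vec3 := 'D_((0 : R), (1 : R)) F p.

Definition immersion_on (S : set pt) (F : pt -> vec3) :=
  forall p, S p -> cross3 (dx F p) (dy F p) != 0.
Definition conformal_on (S : set pt) (F : pt -> vec3) :=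
  forall p, S p -> dot3 (dx F p) (dx F p) = dot3 (dy F p) (dy F p) /\
                   dot3 (dx F p) (dy F p) = 0.

Definition unit_normal (F : pt -> vec3) (p : pt) : vec3 :=
  (enorm3 (cross3 (dx F p) (dy F p)))^-1 *: cross3 (dx F p) (dy F p).

Definition mean_curvature (F : pt -> vec3) (p : pt) : R :=
  let E := dot3 (dx F p) (dx F p) in
  let F1 := dot3 (dx F p) (dy F p) in
  let G := dot3 (dy F p) (dy F p) in
  let N := unit_normal F p in
  let e := dot3 (dx (dx F) p) N in
  let f := dot3 (dy (dx F) p) N in
  let g := dot3 (dy (dy F) p) N in
  (e * G - 2%:R * f * F1 + g * E) / (2%:R * (E * G - F1 ^+ 2)).
Definition minimal_on (S : set pt) (F : pt -> vec3) :=
  forall p, S p -> mean_curvature F p = 0.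

(* free boundary in the unit ball: interior in the open ball, boundary on the
   sphere, and the surface meets the sphere orthogonally (N(p) is tangent to
   the sphere at F(p), i.e. orthogonal to its normal F(p)) *)
Definition free_boundary_annulus (Rr : R) (F : pt -> vec3) :=
  (forall p, annulus Rr p -> dot3 (F p) (F p) < 1) /\
  (forall p, (circle 1 `|` circle Rr) p -> dot3 (F p) (F p) = 1) /\
  (forall p, (circle 1 `|` circle Rr) p -> dot3 (unit_normal F p) (F p) = 0).

Definition injective_on {T U : Type} (S : set T) (f : T -> U) :=
  forall p q, S p -> S q -> f p = f q -> p = q.

(* Gauss map: stereographic projection (from the north pole) of N, as a
   complex number x + i y represented by (x, y) *)
Definition gauss_map (F : pt -> vec3) (p : pt) : pt :=
  let N := unit_normal F p in
  (N 0 0 / (1 - N 0 2%:R), N 0 1 / (1 - N 0 2%:R)).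

Definition doubly_connected (D : set pt) :=
  connected D /\
  exists a b, (~` D) a /\ (~` D) b /\
    connected_component (~` D) a `&` connected_component (~` D) b = set0 /\
    ~` D `<=` connected_component (~` D) a `|` connected_component (~` D) b.

Definition region_bounded_by (D G1 G2 : set pt) :=
  open D /\ doubly_connected D /\ D `&` (G1 `|` G2) = set0 /\
  closure D = D `|` G1 `|` G2.

End Defs.

(* Main.v *)
Require Import Defs.
From HB Require Import structures.
From mathcomp Require Import all_boot all_order all_algebra.
From mathcomp Require Import all_classical all_reals all_analysis.
From mathcomp Require Import ring lra.
Import Order.TTheory GRing.Theory Num.Theory.
Import numFieldNormedType.Exports.
Set Implicit Arguments. Unset Strict Implicit. Unset Printing Implicit Defensive.
Local Open Scope ring_scope.
Local Open Scope classical_set_scope.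

(** In the strip coordinates [z = exp (s + i t)] the surface becomes a harmonic
   conformal map [X], [2 pi]-periodic in [t].  Its Hopf differential is holomorphic and
   real on both boundary lines, because [X_s] is radial there; hence it is a real
   constant [c], and a maximum principle for [1 / |X_s|^2] shows [c != 0].  Replacing [X]
   by [-X] if necessary, [c > 0], and then [N_s = - (c / W) X_s], [N_t = (c / W) X_t]
   where [W = |X_s|^2].

   Consequently each boundary curve is a locally convex curve of the sphere with
   conormal [N], and being simple it is globally convex: it lies in the hemisphere
   [x . N(t) <= 0] of each of its points.  Its polar cone
   [{v | v . X(s, t) <= 0 for all t}] meets the sphere in a cap bounded by the curve
   [N(s, .)].  The caps of the two boundary curves are disjoint, by the maximum principle
   applied to [X . v].

   The Gauss map is a local homeomorphism up to the boundary, and near a boundary circle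
   it sends exactly the points outside the annulus into the corresponding cap.  By
   connectedness its image and the two caps cover the plane, the image avoids the caps,
   and no value is taken twice. *)

(** * Calculus in one and two variables *)

(** The map is smooth on an open set [O] beyond the closed strip. This gives a meaning to points
    just outside the annulus and makes the inverse function theorem available on the boundary
    circles themselves. Holomorphy is used only in real form. Instead of the Hopf coefficient
    [X_zz . N] the proof studies its square [X_zz . X_zz], which needs no derivative of [N];
    Cauchy-Riemann equations and the maximum principle then give constancy. The main obstacle is the
    passage from local to global convexity of a boundary curve. If it failed, each point [c t] would
    lie on an earlier tangent great circle, say at [c (e t)]. Closing the arc from [c (e t)] to
    [c t] by the tangent string gives a length that is monotone in [t] and periodic, hence constant,
    and this freezes [e] although [e] must advance by a period. Values are taken in the plane, not
    on the sphere, so the two caps are not symmetric: the one containing the pole is unbounded. A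
    compact image cannot contain it, and the argument that excludes double values starts from this
    cap. *)

Section OneVariable.
Variable R : realType.
Implicit Types (f g : R -> R) (x a b : R).

Lemma is_derive1M f g x a b : is_derive x 1 f a -> is_derive x 1 g b ->
  is_derive x 1 (fun y => f y * g y) (a * g x + f x * b).
Proof.
move=> fa gb; have H := @is_deriveM _ _ f g x 1 a b fa gb.
by apply: is_derive_eq; rewrite addrC /GRing.scale /= (mulrC a).
Qed.

Lemma is_derive1D f g x a b : is_derive x 1 f a -> is_derive x 1 g b ->
  is_derive x 1 (fun y => f y + g y) (a + b).
Proof. by move=> fa gb; exact: (@is_deriveD _ _ _ f g x 1 a b fa gb). Qed.

Lemma is_derive1N f x a : is_derive x 1 f a ->
  is_derive x 1 (fun y => - f y) (- a).
Proof. by move=> fa; exact: (@is_deriveN _ _ _ f x 1 a fa). Qed.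

Lemma is_derive1B f g x a b : is_derive x 1 f a -> is_derive x 1 g b ->
  is_derive x 1 (fun y => f y - g y) (a - b).
Proof. by move=> fa gb; exact: (@is_deriveB _ _ _ f g x 1 a b fa gb). Qed.

Lemma is_derive1_unique f x a b : is_derive x 1 f a -> is_derive x 1 f b -> a = b.
Proof. by move=> fa fb; rewrite -(@derive_val _ _ _ _ _ _ _ fa) (@derive_val _ _ _ _ _ _ _ fb). Qed.

Lemma is_derive1_continuous f x a : is_derive x 1 f a -> {for x, continuous f}.
Proof. by move=> fa; apply/differentiable_continuous/derivable1_diffP. Qed.

Lemma is_derive1_ext f g x a : (forall y, f y = g y) ->
  is_derive x 1 f a -> is_derive x 1 g a.
Proof. by move=> /funext ->. Qed.

Lemma mean_value f (df : R -> R) a b : a < b ->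
  (forall x, a <= x <= b -> is_derive x 1 f (df x)) ->
  exists2 c, a < c < b & f b - f a = df c * (b - a).
Proof.
move=> ab H; have [||c cab ->] := @MVT R f df a b ab.
- by move=> x; rewrite in_itv /= => /andP[xa xb]; apply: H; rewrite !ltW.
- apply: continuous_in_subspaceT => x /[!inE] /=; rewrite in_itv /= => xab.
  by apply: is_derive1_continuous (H _ xab).
- by exists c => //; move: cab; rewrite in_itv.
Qed.

Lemma mean_value_between f (df : R -> R) a b :
  (forall x, Num.min a b <= x <= Num.max a b -> is_derive x 1 f (df x)) ->
  exists2 c, Num.min a b <= c <= Num.max a b & f b - f a = df c * (b - a).
Proof.
have [ab|ba|<-] := ltgtP a b => H.
- have [c /andP[ac cb] ->] := mean_value ab H.
  by exists c => //; rewrite !ltW.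
- have [c /andP[ac cb] E] := mean_value ba H.
  exists c => //; first by rewrite !ltW.
  by rewrite -(opprB (f a)) E -(opprB a) mulrN.
- by exists a; rewrite ?lexx // !subrr mulr0.
Qed.

Lemma local_max_derive_eq0 f x a : is_derive x 1 f a ->
  (\forall y \near x, f y <= f x) -> a = 0.
Proof.
move=> fa /nbhs_ballP[e /= e0 He]; apply/eqP; rewrite eq_le; apply/andP; split.
- rewrite leNgt; apply/negP => a0.
  have /cvgrPdist_lt/(_ a a0) : h^-1 *: (f (h *: 1 + x) - f x) @[h --> 0^'] --> a.
    by case: fa => fd <-.
  move=> /nbhs_ballP[d /= d0 Hd].
  pose h := Num.min e d / 2.
  have m0 : 0 < Num.min e d by rewrite lt_min e0 d0.
  have h0 : 0 < h by rewrite divr_gt0.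
  have hm : h < Num.min e d by rewrite /h ltr_pdivrMr // ltr_pMr // ltr1n.
  have /andP[he hd] : (h < e) && (h < d) by rewrite -lt_min.
  have := Hd h; rewrite /ball /= sub0r normrN gtr0_norm // => /(_ hd).
  rewrite lt0r_neq0 // => /(_ isT); rewrite /GRing.scale /= mulr1.
  have := He (h + x); rewrite /ball /= opprD addrCA subrr addr0 normrN gtr0_norm // => /(_ he).
  rewrite -subr_le0 => fh; have q : h^-1 * (f (h + x) - f x) <= 0 by rewrite pmulr_rle0 // invr_gt0.
  by rewrite ltr_norml => /andP[_]; lra.
- rewrite leNgt; apply/negP => a0.
  have /cvgrPdist_lt/(_ (-a)) : h^-1 *: (f (h *: 1 + x) - f x) @[h --> 0^'] --> a.
    by case: fa => fd <-.
  rewrite oppr_gt0 => /(_ a0) /nbhs_ballP[d /= d0 Hd].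
  pose h := Num.min e d / 2.
  have m0 : 0 < Num.min e d by rewrite lt_min e0 d0.
  have h0 : 0 < h by rewrite divr_gt0.
  have hm : h < Num.min e d by rewrite /h ltr_pdivrMr // ltr_pMr // ltr1n.
  have /andP[he hd] : (h < e) && (h < d) by rewrite -lt_min.
  have := Hd (- h); rewrite /ball /= sub0r opprK gtr0_norm // => /(_ hd).
  rewrite oppr_eq0 lt0r_neq0 // => /(_ isT); rewrite /GRing.scale /= mulr1.
  have := He (- h + x); rewrite /ball /= opprD opprK addrCA subrr addr0 gtr0_norm // => /(_ he).
  rewrite -subr_le0 invrN mulNr => fh.
  have q : h^-1 * (f (- h + x) - f x) <= 0 by rewrite pmulr_rle0 // invr_gt0.
  by rewrite ltr_norml => /andP[]; lra.
Qed.

(** Differentiability is assumed at [x] alone, so [f] need not be monotone nearby. Comparison with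
    the value at [x] is what survives. *)
Lemma derive_gt0_near f x a : is_derive x 1 f a -> 0 < a ->
  exists2 e, 0 < e & forall h, 0 < h < e -> f (x - h) < f x < f (x + h).
Proof.
move=> fa a0.
have /cvgrPdist_lt/(_ a a0) : h^-1 *: (f (h *: 1 + x) - f x) @[h --> 0^'] --> a.
  by case: fa => fd <-.
move=> /nbhs_ballP[d /= d0 Hd]; exists d => // h /andP[h0 hd].
have h1 : `|0 - h| < d by rewrite sub0r normrN gtr0_norm.
have h2 : `|0 + h| < d by rewrite add0r gtr0_norm.
have /(_ (lt0r_neq0 h0)) := Hd h h1.
have := Hd (- h); rewrite /ball /= opprK => /(_ h2).
rewrite oppr_eq0 => /(_ (lt0r_neq0 h0)).
rewrite /GRing.scale /= !mulr1 !ltr_norml => /andP[_ A] /andP[_ B].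
have {}A : 0 < (- h)^-1 * (f (- h + x) - f x) by lra.
have {}B : 0 < h^-1 * (f (h + x) - f x) by lra.
rewrite addrC (addrC x).
move: A B; rewrite invrN mulNr oppr_gt0 pmulr_rlt0 ?invr_gt0 // subr_lt0 => ->.
by rewrite pmulr_rgt0 ?invr_gt0 // subr_gt0.
Qed.

(** A positive second derivative makes [df] positive just to the right of the critical point, and
    the mean value theorem then lifts [f] above its maximum. *)
Lemma local_max_derive2_le0 f (df : R -> R) x b :
  (\forall y \near x, is_derive (y : R) (1 : R) f (df y)) -> is_derive x 1 df b ->
  (\forall y \near x, f y <= f x) -> b <= 0.
Proof.
move=> fd dfb fm; rewrite leNgt; apply/negP => b0.
have df0 : df x = 0 by apply: local_max_derive_eq0 fm; exact: (nbhs_singleton fd).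
have [e e0 He] := derive_gt0_near dfb b0.
have /nbhs_ballP[d /= d0 Hd] : \forall y \near x,
  is_derive (y : R) (1 : R) f (df y) /\ f y <= f x by exact: filterI.
pose h := Num.min e d / 2.
have m0 : 0 < Num.min e d by rewrite lt_min e0 d0.
have h0 : 0 < h by rewrite divr_gt0.
have hm : h < Num.min e d by rewrite /h ltr_pdivrMr // ltr_pMr // ltr1n.
have /andP[he hd] : (h < e) && (h < d) by rewrite -lt_min.
have bd y : x <= y <= x + h -> ball x d y.
  by move=> /andP[xy yx]; rewrite /ball /= distrC ger0_norm ?subr_ge0 //; lra.
have xh : x < x + h by rewrite ltrDl.
have [y xy|c /andP[c1 c2] E] := @mean_value f df x (x + h) xh.
  by case: (Hd _ (bd _ xy)).
have bh : ball x d (x + h) by apply: bd; rewrite lerDl lexx ltW.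
have [_] := Hd _ bh.
rewrite -subr_le0 E (addrAC x) subrr add0r pmulr_lle0 //.
have xc : 0 < c - x < e by rewrite subr_gt0 c1 /=; lra.
have := He _ xc; rewrite df0 !(addrC x) subrK => /andP[_].
by move=> /lt_geF ->.
Qed.

Lemma is_derive1_le_right f x a : is_derive x 1 f a ->
  (exists2 e, 0 < e & forall h, 0 < h < e -> f (x + h) <= f x) -> a <= 0.
Proof.
move=> fa [e e0 H]; rewrite leNgt; apply/negP => a0.
have [d d0 Hd] := derive_gt0_near fa a0.
pose h := Num.min e d / 2.
have m0 : 0 < Num.min e d by rewrite lt_min e0 d0.
have h0 : 0 < h by rewrite divr_gt0.
have hm : h < Num.min e d by rewrite /h ltr_pdivrMr // ltr_pMr // ltr1n.
have /andP[he hd] : (h < e) && (h < d) by rewrite -lt_min.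
have := H h; rewrite h0 he => /(_ isT).
by have := Hd h; rewrite h0 hd => /(_ isT) /andP[_ /lt_geF ->].
Qed.

Lemma is_derive1_le_left f x a : is_derive x 1 f a ->
  (exists2 e, 0 < e & forall h, 0 < h < e -> f (x - h) <= f x) -> 0 <= a.
Proof.
move=> fa [e e0 H]; rewrite -oppr_le0 -mulN1r mulrC.
have D : is_derive (- x) 1 (f \o -%R) (a * -1).
  by apply: is_derive1_comp; rewrite opprK.
apply: (is_derive1_le_right D); exists e => // h /H.
by rewrite /= opprD opprK.
Qed.

Lemma continuous1_dist_lt f x (e : R) : {for x, continuous f} -> 0 < e ->
  \forall y \near x, `|f y - f x| < e.
Proof. by move=> /cvgrPdist_lt H /H; apply: filterS => y; rewrite distrC. Qed.

End OneVariable.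

(** Partial derivatives are one-variable derivatives along coordinate lines, so the lemmas above
    apply directly. Locking keeps simplification from exposing the underlying limit. *)
HB.lock Definition ds (R : realType) (f : R * R -> R) (p : R * R) : R :=
  'D_1 (fun x => f (x, p.2)) p.1.
HB.lock Definition dt (R : realType) (f : R * R -> R) (p : R * R) : R :=
  'D_1 (fun y => f (p.1, y)) p.2.

Section TwoVariables.
Variable R : realType.
Local Notation pt := (R * R)%type.
Implicit Types (O : set pt) (f g h : pt -> R) (p : pt) (n : nat).

Lemma is_ds f p (k : R) : is_derive p.1 1 (fun x => f (x, p.2)) k -> ds f p = k.
Proof. by move=> D; rewrite unlock; exact: (@derive_val _ _ _ _ _ _ _ D). Qed.

Lemma is_dt f p (k : R) : is_derive p.2 1 (fun y => f (p.1, y)) k -> dt f p = k.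
Proof. by move=> D; rewrite unlock; exact: (@derive_val _ _ _ _ _ _ _ D). Qed.

(* [f] is of class C^n on [O]. *)
Fixpoint sm O n f : Prop :=
  (forall p, O p -> {for p, continuous f}) /\
  match n with
  | 0 => True
  | m.+1 => exists fs ft : pt -> R,
     [/\ forall p, O p -> is_derive p.1 1 (fun x => f (x, p.2)) (fs p),
         forall p, O p -> is_derive p.2 1 (fun y => f (p.1, y)) (ft p),
         sm O m fs & sm O m ft]
  end.

Lemma open_fst O p : open O -> O p -> \forall x \near p.1, O (x, p.2).
Proof.
move=> oO Op; have : nbhs p O by apply: open_nbhs_nbhs.
case: p {Op} => a b [[A B] /= [nA nB] AB].
by apply: filterS nA => x Ax; apply: AB; split => //=; exact: nbhs_singleton.
Qed.

Lemma open_snd O p : open O -> O p -> \forall y \near p.2, O (p.1, y).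
Proof.
move=> oO Op; have : nbhs p O by apply: open_nbhs_nbhs.
case: p {Op} => a b [[A B] /= [nA nB] AB].
by apply: filterS nB => x Ax; apply: AB; split => //=; exact: nbhs_singleton.
Qed.

Lemma sm_continuous O n f p : sm O n f -> O p -> {for p, continuous f}.
Proof. by case: n => [|n] [H _]; exact: H. Qed.

Lemma near_ext_continuous O f g p : open O -> (forall q, O q -> f q = g q) ->
  O p -> {for p, continuous f} -> {for p, continuous g}.
Proof.
move=> oO fg Op cf; rewrite /prop_for /continuous_at -fg //.
apply: cvg_trans cf; apply: near_eq_cvg.
by have := open_nbhs_nbhs (conj oO Op); apply: filterS => q /fg.
Qed.

Lemma sm_ext O n f g : open O -> (forall p, O p -> f p = g p) ->
  sm O n f -> sm O n g.
Proof.
move=> oO fg; have C : (forall p, O p -> {for p, continuous f}) ->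
   forall p, O p -> {for p, continuous g}.
  by move=> H p Op; apply: near_ext_continuous fg Op (H _ Op).
case: n => [|n] /= [cf H]; split=> //; try exact: C.
have [fs [ft [Hs Ht s1 s2]]] := H; exists fs, ft; split=> // p Op.
- apply: near_eq_is_derive (Hs _ Op); near=> x; apply: fg.
  by near: x; exact: open_fst.
- apply: near_eq_is_derive (Ht _ Op); near=> x; apply: fg.
  by near: x; exact: open_snd.
Unshelve. all: by end_near. Qed.

Lemma sm_is_ds O n f p : sm O n.+1 f -> O p ->
  is_derive p.1 1 (fun x => f (x, p.2)) (ds f p).
Proof. by move=> [_ [fs [ft [Hs _ _ _]]]] /Hs D; rewrite (is_ds D). Qed.

Lemma sm_is_dt O n f p : sm O n.+1 f -> O p ->
  is_derive p.2 1 (fun y => f (p.1, y)) (dt f p).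
Proof. by move=> [_ [fs [ft [_ Ht _ _]]]] /Ht D; rewrite (is_dt D). Qed.

Lemma sm_ds O n f : open O -> sm O n.+1 f -> sm O n (ds f).
Proof.
move=> oO [_ [fs [ft [Hs _ s1 _]]]]; apply: sm_ext s1 => // p /Hs H.
by rewrite (is_ds H).
Qed.

Lemma sm_dt O n f : open O -> sm O n.+1 f -> sm O n (dt f).
Proof.
move=> oO [_ [fs [ft [_ Ht _ s1]]]]; apply: sm_ext s1 => // p /Ht H.
by rewrite (is_dt H).
Qed.

Lemma ds_ext O f g p : open O -> (forall q, O q -> f q = g q) -> O p ->
  ds f p = ds g p.
Proof.
move=> oO fg Op; rewrite unlock; apply: near_eq_derive; near=> x; apply: fg.
by near: x; exact: open_fst.
Unshelve. all: by end_near. Qed.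

Lemma dt_ext O f g p : open O -> (forall q, O q -> f q = g q) -> O p ->
  dt f p = dt g p.
Proof.
move=> oO fg Op; rewrite unlock; apply: near_eq_derive; near=> x; apply: fg.
by near: x; exact: open_snd.
Unshelve. all: by end_near. Qed.

Lemma smS O n f : sm O n.+1 f -> sm O n f.
Proof.
elim: n f => [|n IH] f; first by case.
move=> [cf [fs [ft [Hs Ht s1 s2]]]]; split=> //.
by exists fs, ft; split=> //; exact: IH.
Qed.

Lemma sm_cst O n (k : R) : sm O n (fun=> k).
Proof.
elim: n k => [|n IH] k; (split; first by move=> p _; exact: cvg_cst) => //.
by exists (fun=> 0), (fun=> 0); split => // p _; exact: is_derive_cst.
Qed.

Lemma sm_add O n f g : sm O n f -> sm O n g -> sm O n (fun p => f p + g p).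
Proof.
elim: n f g => [|n IH] f g [cf Hf] [cg Hg]; split=> //.
- by move=> p Op; apply: continuousD; [exact: cf|exact: cg].
- by move=> p Op; apply: continuousD; [exact: cf|exact: cg].
have [fs [ft [Hs Ht s1 s2]]] := Hf; have [gs [gt [Gs Gt s3 s4]]] := Hg.
exists (fun p => fs p + gs p), (fun p => ft p + gt p).
by split; try exact: IH; move=> p Op; apply: is_derive1D; auto.
Qed.

Lemma sm_mul O n f g : sm O n f -> sm O n g -> sm O n (fun p => f p * g p).
Proof.
elim: n f g => [|n IH] f g sf sg; have [cf Hf] := sf; have [cg Hg] := sg; split=> //.
- by move=> p Op; apply: continuousM; [exact: cf|exact: cg].
- by move=> p Op; apply: continuousM; [exact: cf|exact: cg].
have [fs [ft [Hs Ht s1 s2]]] := Hf; have [gs [gt [Gs Gt s3 s4]]] := Hg.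
have sf' := smS sf; have sg' := smS sg.
exists (fun p => fs p * g p + f p * gs p), (fun p => ft p * g p + f p * gt p).
split; try by apply: sm_add; exact: IH.
- by move=> p Op; have := is_derive1M (Hs p Op) (Gs p Op); rewrite -surjective_pairing.
- by move=> p Op; have := is_derive1M (Ht p Op) (Gt p Op); rewrite -surjective_pairing.
Qed.

Lemma sm_opp O n f : sm O n f -> sm O n (fun p => - f p).
Proof.
move=> sf; have := sm_mul (sm_cst O n (-1)) sf.
by congr (sm _ _ _); apply/funext => p; rewrite mulN1r.
Qed.

Lemma sm_sub O n f g : sm O n f -> sm O n g -> sm O n (fun p => f p - g p).
Proof. by move=> sf sg; apply: sm_add => //; exact: sm_opp. Qed.

(** Chain rule by induction on the order. The second premise lets [k'] be expressed through [k]
    itself, as happens for the inverse and the square root. *)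
Lemma sm_comp1 O (k k' : R -> R) f :
  (forall p, O p -> is_derive (f p) 1 k (k' (f p))) ->
  (forall n, sm O n f -> sm O n (fun p => k (f p)) -> sm O n (fun p => k' (f p))) ->
  forall n, sm O n f -> sm O n (fun p => k (f p)).
Proof.
move=> kk' H; elim => [|n IH] sf.
  split=> // p Op; apply: continuous_comp; first exact: sm_continuous sf Op.
  exact: is_derive1_continuous (kk' _ Op).
have sf' := smS sf.
split; first by move=> p Op; apply: continuous_comp;
  [exact: sm_continuous sf Op|exact: is_derive1_continuous (kk' _ Op)].
have [_ [fs [ft [Hs Ht s1 s2]]]] := sf.
exists (fun p => k' (f p) * fs p), (fun p => k' (f p) * ft p); split.
- move=> p Op; apply: (@is_derive1_comp R k (fun x => f (x, p.2))) => //=.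
    by rewrite -surjective_pairing; exact: kk'.
  exact: Hs.
- move=> p Op; apply: (@is_derive1_comp R k (fun y => f (p.1, y))) => //=.
    by rewrite -surjective_pairing; exact: kk'.
  exact: Ht.
- by apply: sm_mul => //; apply: H => //; exact: IH.
- by apply: sm_mul => //; apply: H => //; exact: IH.
Qed.

Lemma sm_inv O n f : (forall p, O p -> f p != 0) -> sm O n f ->
  sm O n (fun p => (f p)^-1).
Proof.
move=> f0; apply: (@sm_comp1 O _ (fun x => - (x^-1 * x^-1))).
  move=> p /f0 fp; have := is_deriveV fp (is_derive_id (f p) (1 : R)).
  by move=> H; apply: is_derive_eq; rewrite /GRing.scale /= mulr1 expr2 invfM.
by move=> m sf sk; apply: sm_opp; exact: sm_mul.
Qed.

Lemma sm_sqrt O n f : (forall p, O p -> 0 < f p) -> sm O n f ->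
  sm O n (fun p => Num.sqrt (f p)).
Proof.
move=> f0; apply: (@sm_comp1 O _ (fun x => (2 * Num.sqrt x)^-1)).
  by move=> p /f0 fp; exact: is_derive1_sqrt.
move=> m sf sk; apply: (@sm_inv O m (fun p => 2 * Num.sqrt (f p))).
  by move=> p /f0 fp; rewrite mulf_neq0 // gt_eqF // sqrtr_gt0.
by apply: sm_mul => //; exact: sm_cst.
Qed.

Lemma dsD O n f g p : sm O n.+1 f -> sm O n.+1 g -> O p ->
  ds (fun q => f q + g q) p = ds f p + ds g p.
Proof.
move=> sf sg Op; apply: is_ds.
by apply: is_derive1D; apply: sm_is_ds Op; eassumption.
Qed.

Lemma dtD O n f g p : sm O n.+1 f -> sm O n.+1 g -> O p ->
  dt (fun q => f q + g q) p = dt f p + dt g p.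
Proof.
move=> sf sg Op; apply: is_dt.
by apply: is_derive1D; apply: sm_is_dt Op; eassumption.
Qed.

Lemma dsM O n f g p : sm O n.+1 f -> sm O n.+1 g -> O p ->
  ds (fun q => f q * g q) p = ds f p * g p + f p * ds g p.
Proof.
move=> sf sg Op; apply: is_ds.
have := is_derive1M (sm_is_ds sf Op) (sm_is_ds sg Op).
by rewrite -surjective_pairing.
Qed.

Lemma dtM O n f g p : sm O n.+1 f -> sm O n.+1 g -> O p ->
  dt (fun q => f q * g q) p = dt f p * g p + f p * dt g p.
Proof.
move=> sf sg Op; apply: is_dt.
have := is_derive1M (sm_is_dt sf Op) (sm_is_dt sg Op).
by rewrite -surjective_pairing.
Qed.

Lemma dsV O n f p : sm O n.+1 f -> O p -> f p != 0 ->
  ds (fun q => (f q)^-1) p = - (f p) ^- 2 * ds f p.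
Proof.
move=> sf Op f0; have := @is_deriveV R (fun x => f (x, p.2)) p.1 _ 1.
rewrite -surjective_pairing => /(_ _ f0 (sm_is_ds sf Op)) H; exact: is_ds H.
Qed.

Lemma dtV O n f p : sm O n.+1 f -> O p -> f p != 0 ->
  dt (fun q => (f q)^-1) p = - (f p) ^- 2 * dt f p.
Proof.
move=> sf Op f0; have := @is_deriveV R (fun y => f (p.1, y)) p.2 _ 1.
rewrite -surjective_pairing => /(_ _ f0 (sm_is_dt sf Op)) H; exact: is_dt H.
Qed.

Lemma box_nbhs p (A : set pt) : nbhs p A ->
  exists2 e : R, 0 < e & forall x y, `|x - p.1| < e -> `|y - p.2| < e -> A (x, y).
Proof.
move=> /nbhs_ballP[e /= e0 H]; exists e => // x y xe ye; apply: H.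
by split; rewrite /ball /= distrC.
Qed.

Lemma continuous_dist_lt f p e : {for p, continuous f} -> 0 < e ->
  nbhs p [set q | `|f p - f q| < e].
Proof. by move=> /cvgrPdist_lt H /H. Qed.

(* Second difference quotient, evaluated by the mean value theorem in both
   orders. *)
Lemma schwarz O f p : open O -> sm O 2 f -> O p -> dt (ds f) p = ds (dt f) p.
Proof.
move=> oO sf Op; apply/eqP; rewrite -subr_eq0 -normr_le0.
suff H (e : R) : 0 < e -> `|dt (ds f) p - ds (dt f) p| <= e.
  by apply/ler_addgt0Pr => e e0; rewrite add0r; exact: H.
move=> e0; have e2 : 0 < e / 2 by rewrite divr_gt0.
have sfs := sm_ds oO sf; have sft := sm_dt oO sf.
have c1 := sm_continuous (sm_dt oO sfs) Op; have c2 := sm_continuous (sm_ds oO sft) Op.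
have /box_nbhs[d d0 Hd] : nbhs p [set q | [/\ O q,
   `|dt (ds f) p - dt (ds f) q| < e / 2 & `|ds (dt f) p - ds (dt f) q| < e / 2]].
  have n1 : nbhs p O by exact: open_nbhs_nbhs.
  have n2 := continuous_dist_lt c1 e2; have n3 := continuous_dist_lt c2 e2.
  apply: (filterS _ (filterI n1 (filterI n2 n3))) => q [q1 [q2 q3]].
  exact: And3 q1 q2 q3.
case: p Op Hd {c1 c2} => a b /= Op Hd.
pose k := d / 2; have k0 : 0 < k by rewrite divr_gt0.
have kd : k < d by rewrite ltr_pdivrMr // ltr_pMr // ltr1n.
have near_a x : a <= x <= a + k -> `|x - a| < d.
  by move=> /andP[x1 x2]; rewrite ger0_norm ?subr_ge0 //; lra.
have near_b x : b <= x <= b + k -> `|x - b| < d.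
  by move=> /andP[x1 x2]; rewrite ger0_norm ?subr_ge0 //; lra.
have OO x y : a <= x <= a + k -> b <= y <= b + k -> O (x, y).
  by move=> /near_a xa /near_b yb; have [] := Hd _ _ xa yb.
have ak : a < a + k by rewrite ltrDl.
have bk : b < b + k by rewrite ltrDl.
have b1 : b <= b + k <= b + k by rewrite lexx ltW.
have b0 : b <= b <= b + k by rewrite lexx ltW.
have a1 : a <= a + k <= a + k by rewrite lexx ltW.
have a0 : a <= a <= a + k by rewrite lexx ltW.
have [x xa|c /andP[ac ca] E1] := @mean_value R (fun x => f (x, b + k) - f (x, b))
    (fun x => ds f (x, b + k) - ds f (x, b)) a (a + k) ak.
  by apply: is_derive1B; [have := sm_is_ds sf (OO x (b + k) xa b1)
    |have := sm_is_ds sf (OO x b xa b0)].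
have cc : a <= c <= a + k by rewrite !ltW.
have [y yb|c' /andP[bc' cb'] E2] := @mean_value R (fun y => ds f (c, y))
    (fun y => dt (ds f) (c, y)) b (b + k) bk.
  by have := sm_is_dt sfs (OO c y cc yb).
have [x xa|u /andP[au ua] E3] := @mean_value R (fun y => f (a + k, y) - f (a, y))
    (fun y => dt f (a + k, y) - dt f (a, y)) b (b + k) bk.
  by apply: is_derive1B; [have := sm_is_dt sf (OO (a + k) x a1 xa)
    |have := sm_is_dt sf (OO a x a0 xa)].
have uu : b <= u <= b + k by rewrite !ltW.
have [y yb|u' /andP[bu' ub'] E4] := @mean_value R (fun x => dt f (x, u))
    (fun x => ds (dt f) (x, u)) a (a + k) ak.
  by have := sm_is_ds sft (OO y u yb uu).
have E : dt (ds f) (c, c') = ds (dt f) (u', u).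
  have k1 : k != 0 by rewrite gt_eqF.
  apply: (mulIf k1); apply: (mulIf k1).
  rewrite E2 E4 !(addrAC _ k) !subrr !add0r in E1 E3.
  have swap (w x y z : R) : w - x - (y - z) = w - y - (x - z) by ring.
  exact: etrans (esym E1) (etrans (swap _ _ _ _) E3).
have [||_ h1 _] := Hd c c'; [exact: near_a|by apply: near_b; rewrite !ltW|].
have [||_ _ h2] := Hd u' u; [by apply: near_a; rewrite !ltW|exact: near_b|].
rewrite -(subrKA (dt (ds f) (c, c'))) {2}E (le_trans (ler_normD _ _)) //.
rewrite (splitr e); apply: lerD; apply: ltW; first exact: h1.
by rewrite distrC; exact: h2.
Qed.

End TwoVariables.

(** * Vectors of R^3 *)

(** Locked copies of [dot3] and [cross3], so that simplification stops at the products and does not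
    expose sums and matches. *)
HB.lock Definition dot (R : realType) (u v : 'rV[R]_3) : R := dot3 u v.
HB.lock Definition crs (R : realType) (u v : 'rV[R]_3) : 'rV[R]_3 := cross3 u v.

Section Vectors.
Variable R : realType.
Implicit Types (a b u v w : 'rV[R]_3).

Lemma dot3E u v : dot u v = u 0 0 * v 0 0 + u 0 1 * v 0 1 + u 0 2%:R * v 0 2%:R.
Proof.
rewrite unlock /dot3 !big_ord_recl big_ord0 addr0 addrA.
by congr (_ + _ + _); congr (u _ _ * v _ _); exact: val_inj.
Qed.

Lemma dot3C u v : dot u v = dot v u.
Proof. by rewrite !dot3E; ring. Qed.

Lemma dot3Dl u v w : dot (u + v) w = dot u w + dot v w.
Proof. by rewrite !dot3E !mxE; ring. Qed.

Lemma dot3Zl k u v : dot (k *: u) v = k * dot u v.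
Proof. by rewrite !dot3E !mxE; ring. Qed.

Lemma dot3Zr k u v : dot u (k *: v) = k * dot u v.
Proof. by rewrite !dot3E !mxE; ring. Qed.

Lemma dot3Nl u v : dot (- u) v = - dot u v.
Proof. by rewrite !dot3E !mxE; ring. Qed.

Lemma dot3BZ (k : R) u v : dot (u - k *: v) (u - k *: v) =
  dot u u - 2 * k * dot u v + k ^+ 2 * dot v v.
Proof. by rewrite !dot3E !mxE; ring. Qed.

Lemma dot3_ge0 u : 0 <= dot u u.
Proof. by rewrite dot3E; nra. Qed.

Lemma rV3P u v : u 0 0 = v 0 0 -> u 0 1 = v 0 1 -> u 0 2%:R = v 0 2%:R -> u = v.
Proof.
move=> h0 h1 h2; apply/rowP => -[[|[|[|//]]] Hi].
- by move: h0; congr (u _ _ = v _ _); exact: val_inj.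
- by move: h1; congr (u _ _ = v _ _); exact: val_inj.
- by move: h2; congr (u _ _ = v _ _); exact: val_inj.
Qed.

Lemma dot3_eq0 u : dot u u = 0 -> u = 0.
Proof.
rewrite dot3E => h; apply: rV3P; rewrite mxE; nra.
Qed.

Lemma dot3_unit_le v i : dot v v = 1 -> `|v 0 i| <= 1.
Proof.
move=> h; have : v 0 i ^+ 2 <= 1.
  rewrite -h unlock /dot3 (bigD1 i) //= expr2 lerDl sumr_ge0 // => j _.
  by rewrite -expr2 sqr_ge0.
by move=> h2; rewrite ler_norml; apply/andP; split; nra.
Qed.

Lemma cross3E u v : [/\ crs u v 0 0 = u 0 1 * v 0 2%:R - u 0 2%:R * v 0 1,
  crs u v 0 1 = u 0 2%:R * v 0 0 - u 0 0 * v 0 2%:R &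
  crs u v 0 2%:R = u 0 0 * v 0 1 - u 0 1 * v 0 0].
Proof. by rewrite unlock !mxE. Qed.

(* [(u.v)|n|^2 = (u.n)(v.n) + (u x n).(v x n)] for [n = a x b], where
   [u x n = (u.b) a - (u.a) b]. *)
Lemma cross_frame a b u v : let n := crs a b in
  dot u v * dot n n = dot u n * dot v n
    + dot a a * (dot u b * dot v b) + dot b b * (dot u a * dot v a)
    - dot a b * (dot u b * dot v a + dot u a * dot v b).
Proof.
move=> n; have [n0 n1 n2] := cross3E a b.
by rewrite !dot3E /n n0 n1 n2; ring.
Qed.

(** Lagrange's identity. In conformal coordinates it says that the cross product of the two partial
    derivatives has length [W]. *)
Lemma cross_norm a b : let n := crs a b in
  dot n n = dot a a * dot b b - dot a b ^+ 2.
Proof.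
move=> n; have [n0 n1 n2] := cross3E a b.
by rewrite !dot3E /n n0 n1 n2; ring.
Qed.

Lemma dot_crossl a b : dot a (crs a b) = 0.
Proof. have [n0 n1 n2] := cross3E a b; by rewrite dot3E n0 n1 n2; ring. Qed.

Lemma dot_crossr a b : dot b (crs a b) = 0.
Proof. have [n0 n1 n2] := cross3E a b; by rewrite dot3E n0 n1 n2; ring. Qed.

Lemma continuous_dot3 (T : topologicalType) (A B : T -> 'rV[R]_3) (x : T) :
  (forall i, {for x, continuous (fun y => A y 0 i)}) ->
  (forall i, {for x, continuous (fun y => B y 0 i)}) ->
  {for x, continuous (fun y => dot (A y) (B y))}.
Proof.
move=> cA cB.
have E : (fun y => dot (A y) (B y)) = (fun y => A y 0 0 * B y 0 0 + A y 0 1 * B y 0 1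
    + A y 0 2%:R * B y 0 2%:R) by apply/funext => y; rewrite dot3E.
rewrite E; apply: continuousD; first (apply: continuousD).
- by apply: continuousM; [exact: cA|exact: cB].
- by apply: continuousM; [exact: cA|exact: cB].
- by apply: continuousM; [exact: cA|exact: cB].
Qed.

Lemma is_derive_dot3 (A B : R -> 'rV[R]_3) (x : R) (a b : 'rV[R]_3) :
  (forall i, is_derive x 1 (fun y => A y 0 i) (a 0 i)) ->
  (forall i, is_derive x 1 (fun y => B y 0 i) (b 0 i)) ->
  is_derive x 1 (fun y => dot (A y) (B y)) (dot a (B x) + dot (A x) b).
Proof.
move=> Aa Bb.
have D i := is_derive1M (Aa i) (Bb i).
have D3 := is_derive1D (is_derive1D (D 0) (D 1)) (D 2%:R).
have E : (a 0 0 * B x 0 0 + A x 0 0 * b 0 0 + (a 0 1 * B x 0 1 + A x 0 1 * b 0 1)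
    + (a 0 2%:R * B x 0 2%:R + A x 0 2%:R * b 0 2%:R)) = dot a (B x) + dot (A x) b.
  by rewrite !dot3E; ring.
rewrite -E; apply: is_derive1_ext D3 => y; exact: (esym (dot3E _ _)).
Qed.

End Vectors.

(** * Local homeomorphisms onto the complement of two caps *)

Section LocalHomeoCapped.
Variables (T U : topologicalType) (g : T -> U) (A d1 d2 : set T) (K1 K2 : set U).
Hypothesis hT : hausdorff_space T.
Hypothesis hU : hausdorff_space U.
Let K := A `|` (d1 `|` d2).
Hypothesis cK : compact K.
Hypothesis cg : forall p, K p -> {for p, continuous g}.
Hypothesis LI : forall p, K p -> exists2 O, nbhs p O &
  forall q q', O q -> O q' -> g q = g q' -> q = q'.
Hypothesis LS : forall p O, K p -> nbhs p O -> nbhs (g p) (g @` O).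
(** Near a boundary circle the cap alone decides membership in [A], on both sides of the circle:
    points just outside [A] land in the cap. *)
Hypothesis B1 : forall p, d1 p -> exists2 O, nbhs p O & forall q, O q -> (A q <-> ~ K1 (g q)).
Hypothesis B2 : forall p, d2 p -> exists2 O, nbhs p O & forall q, O q -> (A q <-> ~ K2 (g q)).
Hypothesis c1 : closed K1.
Hypothesis c2 : closed K2.
Hypothesis K12 : forall w, K1 w -> K2 w -> False.
Hypothesis i1 : forall w, K1 w -> ~ (g @` d1) w -> nbhs w K1.
Hypothesis i2 : forall w, K2 w -> ~ (g @` d2) w -> nbhs w K2.
Hypothesis gd1 : forall p, d1 p -> K1 (g p).
Hypothesis gd2 : forall p, d2 p -> K2 (g p).
Hypothesis inj1 : forall p q, d1 p -> d1 q -> g p = g q -> p = q.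
Hypothesis inj2 : forall p q, d2 p -> d2 q -> g p = g q -> p = q.
Hypothesis oA : open A.
Hypothesis d1A : d1 `<=` closure A.
Hypothesis d2A : d2 `<=` closure A.
Variables (p1 p2 : T).
Hypotheses (dp1 : d1 p1) (dp2 : d2 p2).

Lemma capped_continuous (B : set T) : B `<=` K -> {within B, continuous g}.
Proof. by move=> BK; apply: continuous_in_subspaceT => p /[!inE] /BK; exact: cg. Qed.

Lemma capped_open_image : open (g @` A).
Proof.
rewrite openE => _ [p Ap <-]; apply: LS; first by left.
exact: open_nbhs_nbhs.
Qed.

(** [C] is closed by compactness. It is open because a value near that of a boundary point comes
    from a point that lies in [A] or is sent into the cap. The plane being connected, [C] is
    everything. *)
Lemma capped_cover : connected [set: U] -> forall w, (g @` A) w \/ K1 w \/ K2 w.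
Proof.
move=> cU w; pose C := g @` K `|` (K1 `|` K2).
have clC : closed C.
  apply: closedU; last exact: closedU.
  by apply: compact_closed => //; apply: continuous_compact => //; exact: capped_continuous.
have nearb p : K p -> nbhs (g p) C.
  move=> [Ap|[dp|dp]].
  - apply: filterS (LS _ (open_nbhs_nbhs (conj oA Ap))); last by left.
    by move=> _ [q Aq <-]; left; exists q => //; left.
  - have [ O nO HO] := B1 dp; have := LS (or_intror (or_introl dp)) nO.
    apply: filterS => _ [q Oq <-]; have [k|k] := pselect (K1 (g q)); first by right; left.
    by left; exists q => //; left; apply/(HO _ Oq).
  - have [ O nO HO] := B2 dp; have := LS (or_intror (or_intror dp)) nO.
    apply: filterS => _ [q Oq <-]; have [k|k] := pselect (K2 (g q)); first by right; right.
    by left; exists q => //; left; apply/(HO _ Oq).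
have opC : open C.
  rewrite openE => x [[p Kp <-]|[kx|kx]]; first exact: nearb.
  - have [[p dp <-]|nd] := pselect ((g @` d1) x); first by apply: nearb; right; left.
    by apply: filterS (i1 kx nd) => y ky; right; left.
  - have [[p dp <-]|nd] := pselect ((g @` d2) x); first by apply: nearb; right; right.
    by apply: filterS (i2 kx nd) => y ky; right; right.
have CT : C = [set: U].
  apply: cU.
  - by exists (g p1); right; left; exact: gd1.
  - by exists C => //; rewrite setTI.
  - by exists C => //; rewrite setTI.
have : C w by rewrite CT.
case=> [[p Kp <-]|]; last by right.
by case: Kp => [Ap|[/gd1|/gd2]]; [left; exists p|right; left|right; right].
Qed.

(** Points of [A] sent into [H] cannot accumulate on [d], since near [d] the set [A] avoids [H].
    They therefore form a compact set, and its image is closed. *)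
Lemma capped_hit_closed (d : set T) (H : set U) :
  (forall p, d p -> exists2 O, nbhs p O & forall q, O q -> A q -> ~ H (g q)) ->
  closed H -> (forall q, K q -> H (g q) -> ~ d q -> A q) ->
  closed (H `&` g @` A) .
Proof.
move=> Bd cH dA; pose D := [set p | K p /\ H (g p) /\ ~ d p].
have -> : H `&` g @` A = g @` D.
  apply/seteqP; split => [w [Hw [p Ap gp]]|_ [p [Kp [Hp ndp]] <-]].
    rewrite -gp in Hw *; exists p => //; split; first by left.
    split=> // dp; have [ O nO HO] := Bd _ dp.
    by apply: (HO p) => //; exact: nbhs_singleton.
  by split=> //; exists p => //; exact: dA.
apply: compact_closed => //; apply: continuous_compact.
  by apply: capped_continuous => p [].
apply: (subclosed_compact _ cK) => [p clp|p []//].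
have Kp : K p.
  by apply: (compact_closed hT cK) => B /clp[q [[Kq _] Bq]]; exists q.
have Hp : H (g p).
  apply: cH => B nB; have /clp[q [[_ [Hq _]] Bq]] := cg Kp nB.
  by exists (g q).
split=> //; split=> // dp.
have [ O nO HO] := Bd _ dp; have [q [[Kq [Hq ndq]] Oq]] := clp _ nO.
by apply: (HO q) => //; exact: dA.
Qed.

Lemma capped_hit1 : closed (K1 `&` g @` A).
Proof.
apply: (@capped_hit_closed d1) => // [p /B1[ O nO HO]|q].
  by exists O => // q Oq Aq; apply/(HO _ Oq).
by move=> [//|[//|/gd2 k]] k1; have := K12 k1 k.
Qed.

Lemma capped_hit2 : closed (K2 `&` g @` A).
Proof.
apply: (@capped_hit_closed d2) => // [p /B2[ O nO HO]|q].
  by exists O => // q Oq Aq; apply/(HO _ Oq).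
by move=> [//|[/gd1 k|//]] k1; have := K12 k k1.
Qed.

(** A limit of pairs of distinct points with equal values could only degenerate onto the diagonal,
    which local injectivity forbids. So the pairs form a compact set. *)
Lemma capped_double_closed :
  closed [set w | exists p q, [/\ K p, K q, p <> q, g p = w & g q = w]].
Proof.
pose E := [set x : T * T | [/\ K x.1, K x.2, x.1 <> x.2 & g x.1 = g x.2]].
have -> : [set w | exists p q, [/\ K p, K q, p <> q, g p = w & g q = w]] =
    (g \o fst) @` E.
  apply/seteqP; split => [w [p [q [Kp Kq pq gp gq]]]|_ [[p q] [/= Kp Kq pq gpq] <-]].
    by exists (p, q) => //; split=> //=; rewrite gp.
  by exists p, q.
apply: compact_closed => //; apply: continuous_compact.
  apply: continuous_in_subspaceT => -[p q] /[!inE] -[/= Kp _ _ _].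
  by apply: continuous_comp; [exact: cvg_fst|exact: cg].
apply: (subclosed_compact _ (compact_setX cK cK)) => [[p q] clpq|x []//].
have prodn (P Q : set T) : nbhs p P -> nbhs q Q -> nbhs (p, q) (P `*` Q).
  by move=> nP nQ; exists (P, Q).
have Kc := compact_closed hT cK.
have Kp : K p.
  apply: Kc => B nB; have [[x y] [[/= Kx _ _ _] [Bx _]]] := clpq _ (prodn _ _ nB filterT).
  by exists x.
have Kq : K q.
  apply: Kc => B nB; have [[x y] [[/= _ Ky _ _] [_ By]]] := clpq _ (prodn _ _ filterT nB).
  by exists y.
have gpq : g p = g q.
  apply: hU => P Q nP nQ.
  have [[x y] [[/= _ _ _ gxy] [/= Px Qy]]] := clpq _ (prodn _ _ (cg Kp nP) (cg Kq nQ)).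
  by exists (g x); split => //; rewrite gxy.
split=> //= pq; move: prodn; rewrite -pq => prodn; have [ O nO HO] := LI Kp.
rewrite -pq in clpq.
have [[x y] [[/= _ _ xy gxy] [/= Ox Oy]]] := clpq _ (prodn _ _ nO nO).
exact: xy (HO _ _ Ox Oy gxy).
Qed.

Hypothesis conA : connected A.
Hypothesis conK1 : connected K1.
Hypothesis conK2 : connected K2.
(** [K1] will be the unbounded cap, which a compact image cannot contain. *)
Hypothesis unb : ~ (K1 `<=` g @` K).

(** [K1] meets the open image of [A] in a set that is also closed. As [K1] is connected, one common
    point would put all of [K1] in the image, against [unb]. *)
Lemma capped_miss1 w : (g @` A) w -> K1 w -> False.
Proof.
move=> Vw kw; apply: unb.
have : K1 `&` g @` A = K1.
  apply: conK1; first by exists w.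
  - by exists (g @` A) => //; exact: capped_open_image.
  - by exists (K1 `&` g @` A); [exact: capped_hit1|rewrite setIA setIid].
by move=> <- x [_ [p Ap <-]]; exists p => //; left.
Qed.

(** A set between the connected [A] and its closure is connected. *)
Lemma capped_image_closure (B : set T) : A `<=` B -> B `<=` K -> connected (g @` B).
Proof.
move=> AB BK; apply: connected_continuous_connected; last exact: capped_continuous.
have Bcl : B `<=` closure A.
  by move=> p /BK[/subset_closure//|[/d1A|/d2A]].
move=> C [x Cx] [ O oO CO] [F clF CF].
have meet p O' : B p -> open O' -> O' p -> exists2 q, A q & O' q.
  move=> Bp oO' O'p; have [q [Aq O'q]] := Bcl _ Bp _ (open_nbhs_nbhs (conj oO' O'p)).
  by exists q.
have AC : A `&` C = A.
  apply: conA.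
  - move: Cx; rewrite CO => -[Bx Ox]; have [q Aq Oq] := meet _ _ Bx oO Ox.
    by exists q; split=> //; split=> //; exact: AB.
  - by exists O => //; rewrite CO setIA (setIidl AB).
  - by exists F => //; rewrite CF setIA (setIidl AB).
apply/seteqP; split=> [p|p Bp]; first by rewrite CO => -[].
rewrite CF; split=> //; apply: contrapT => nFp.
have [q Aq nFq] := meet _ _ Bp (closed_openC clF) nFp; apply: nFq.
by move: Aq; rewrite -AC CF => -[_ []].
Qed.

(** The bad set [C0] collects the double values and the values of [A] in [K2]. It is closed, and
    open relative to the connected set [W], so it is empty or all of [W]; values near the image of
    [d1] exclude the second case. Treating both kinds of bad value together is what makes openness
    work on the image of [d2]. *)
Lemma capped_no_double w : (g @` A) w \/ K2 w ->
  ~ ((exists p q, [/\ K p, K q, p <> q, g p = w & g q = w]) \/ (K2 w /\ (g @` A) w)).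
Proof.
pose E := [set w | exists p q, [/\ K p, K q, p <> q, g p = w & g q = w]].
pose C0 := E `|` (K2 `&` g @` A); pose W := g @` A `|` K2.
have clC0 : closed C0 by apply: closedU; [exact: capped_double_closed|exact: capped_hit2].
have WK1 x : W x -> ~ K1 x.
  by move=> [Vx|kx] k1; [exact: capped_miss1 Vx k1|exact: K12 k1 kx].
have Adisj1 p : d1 p -> ~ A p.
  move=> dp Ap; have [ O nO HO] := B1 dp.
  by have /(HO _ (nbhs_singleton nO)) := Ap; apply; exact: gd1.
have Adisj2 p : d2 p -> ~ A p.
  move=> dp Ap; have [ O nO HO] := B2 dp.
  by have /(HO _ (nbhs_singleton nO)) := Ap; apply; exact: gd2.
have AK p : A p -> K p by left.
have d2K p : d2 p -> K p by right; right.
have sep (p q : T) : p <> q -> exists O O', [/\ nbhs p O, nbhs q O' &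
    forall x y, O x -> O' y -> x <> y].
  move=> pq; apply: contrapT => H; apply: pq; apply: hT => P Q nP nQ.
  apply: contrapT => PQ; apply: H; exists P, Q; split=> // x y Px Qy xy.
  by apply: PQ; exists x; split=> //; rewrite xy.
have two p q O : A q -> K p -> p <> q -> g p = g q -> nbhs p O ->
    nbhs (g q) [set x | exists p' q', [/\ O p', A q', p' <> q', g p' = x & g q' = x]].
  move=> Aq Kp pq gpq nO; have [P [Q [nP nQ PQ]]] := sep _ _ pq.
  have n1 : nbhs (g q) (g @` (P `&` O)) by rewrite -gpq; apply: LS => //; exact: filterI.
  have n2 : nbhs (g q) (g @` (Q `&` A)).
    by apply: LS; [exact: AK|apply: filterI => //; exact: open_nbhs_nbhs].
  apply: (filterS _ (filterI n1 n2)) => x [[p' [Pp' Op'] gp'] [q' [Qq' Aq'] gq']].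
  by exists p', q'; split=> //; exact: PQ.
have openB : open (W `&` C0).
  rewrite openE => x [Wx C0x].
  (* If the value is also taken at a point [p] of [d2], nearby values are taken in [A] and again
     near [p]. The second preimage is in [A], which gives a double value, or outside, which gives a
     value in [K2]. *)
  have mixed q : A q -> g q = x -> K2 x -> nbhs x (W `&` C0).
    move=> Aq gq k2.
    have nV : nbhs x (g @` A).
      by apply: open_nbhs_nbhs; split; [exact: capped_open_image|exists q].
    have [[p dp gp]|nd] := pselect ((g @` d2) x); last first.
      apply: (filterS _ (filterI nV (i2 k2 nd))) => y [Vy ky].
      by split; [left|right].
    have [ O nO HO] := B2 dp.
    have pq : p <> q by move=> pq; apply: (Adisj2 _ dp); rewrite pq.
    have gpq : g p = g q by rewrite gp gq.
    have := two _ _ _ Aq (d2K _ dp) pq gpq nO; rewrite gq.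
    apply: filterS => y [p' [q' [Op' Aq' pq' gp' gq']]].
    have Vy : (g @` A) y by exists q'.
    split; first by left.
    have [k|k] := pselect (K2 (g p')); first by right; split=> //; rewrite -gp'.
    left; exists p', q'; split=> //; last exact: AK.
    by apply: AK; apply/(HO _ Op').
  case: C0x => [[p [q [Kp Kq pq gp gq]]]|[k2 [q Aq gq]]]; last exact: mixed Aq gq k2.
  have notd1 r : K r -> g r = x -> A r \/ d2 r.
    move=> [Ar|[dr|dr]] gr; [by left| |by right].
    by have := WK1 _ Wx; rewrite -gr => /(_ (gd1 dr)).
  have [Ap|dp] := notd1 _ Kp gp; have [Aq|dq] := notd1 _ Kq gq.
  - have gpq : g p = g q by rewrite gp gq.
    have := two _ _ _ Aq Kp pq gpq (open_nbhs_nbhs (conj oA Ap)); rewrite gq.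
    apply: filterS => y [p' [q' [Ap' Aq' pq' gp' gq']]].
    split; first by left; exists q'.
    by left; exists p', q'; split=> //; exact: AK.
  - by apply: mixed Ap gp _; rewrite -gq; exact: gd2.
  - by apply: mixed Aq gq _; rewrite -gp; exact: gd2.
  - by case: pq; apply: inj2 => //; rewrite gp gq.
have conW : connected W.
  have -> : W = g @` (A `|` d2) `|` K2.
    apply/seteqP; split=> [x [[p Ap <-]|]|x [[p [Ap|dp] <-]|]]; try by right.
    - by left; exists p => //; left.
    - by left; exists p.
    - by right; exact: gd2.
  apply: connectedU => //.
    by exists (g p2); split; [exists p2 => //; right|exact: gd2].
  apply: capped_image_closure; first by left.
  by move=> p [Ap|dp]; [exact: AK|exact: d2K].
move=> Ww Bw; have BW : W `&` C0 = W.
  apply: conW; first by exists w.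
  - by exists (W `&` C0) => //; rewrite setIA setIid.
  - by exists C0.
(* [C0] misses the values on [d1]. Being closed, it misses nearby values from [A], so it cannot fill
   [W]. *)
have g1C0 : ~ C0 (g p1).
  have K1p := gd1 dp1.
  have notA r : K r -> g r = g p1 -> d1 r.
    move=> [Ar|[//|dr]] gr; last by have := gd2 dr; rewrite gr => /(K12 K1p).
    by have /capped_miss1 : (g @` A) (g p1) by [exists r]; move/(_ K1p).
  move=> [[p [q [Kp Kq pq gp gq]]]|[k2 _]]; last exact: K12 K1p k2.
  by apply: pq; apply: inj1; [exact: notA|exact: notA|rewrite gp gq].
have n1 : nbhs (g p1) (~` C0).
  by apply: open_nbhs_nbhs; split=> //; exact: closed_openC.
have [q [Aq nC]] := d1A dp1 (cg (or_intror (or_introl dp1)) n1).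
by apply: nC; have : W (g q) by [left; exists q]; rewrite -BW => -[].
Qed.

Lemma capped_injective p q : A p -> A q -> g p = g q -> p = q.
Proof.
move=> Ap Aq gpq; apply: contrapT => pq.
apply: (@capped_no_double (g p)); first by left; exists p.
by left; exists p, q; split=> //; left.
Qed.

Lemma capped_miss2 w : (g @` A) w -> K2 w -> False.
Proof. by move=> Vw kw; apply: (@capped_no_double w); [left|right]. Qed.

Lemma capped_closure : closure (g @` A) = g @` A `|` g @` d1 `|` g @` d2.
Proof.
apply/seteqP; split => [w clw|].
  have clK : closed (g @` K).
    by apply: compact_closed => //; apply: continuous_compact => //; exact: capped_continuous.
  have [p [Ap|[dp|dp]] <-] : (g @` K) w.
    apply: clK => B /clw [x [[p Ap <-] Bx]]; exists (g p); split=> //.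
    by exists p => //; left.
  - by left; left; exists p.
  - by left; right; exists p.
  - by right; exists p.
have bd p : closure A p -> K p -> closure (g @` A) (g p).
  move=> clp Kp B nB; have [q [Aq Bq]] := clp _ (cg Kp nB).
  by exists (g q); split=> //; exists q.
move=> _ [[[p Ap <-]|[p dp <-]]|[p dp <-]].
- by apply: subset_closure; exists p.
- by apply: bd; [exact: d1A|right; left].
- by apply: bd; [exact: d2A|right; right].
Qed.

Lemma capped_complement_components (cU : connected [set: U]) :
  exists a b, (~` (g @` A)) a /\ (~` (g @` A)) b /\
    connected_component (~` (g @` A)) a `&` connected_component (~` (g @` A)) b = set0 /\
    ~` (g @` A) `<=` connected_component (~` (g @` A)) a
                  `|` connected_component (~` (g @` A)) b.
Proof.
pose V := g @` A.
have K1V : K1 `<=` ~` V by move=> w kw Vw; exact: capped_miss1 Vw kw.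
have K2V : K2 `<=` ~` V by move=> w kw Vw; exact: capped_miss2 Vw kw.
have ka := gd1 dp1; have kb := gd2 dp2.
exists (g p1), (g p2); split; first exact: K1V.
split; first exact: K2V.
have m1 := connected_component_max ka K1V conK1.
have m2 := connected_component_max kb K2V conK2.
split; last first.
  by move=> w nVw; have [//|[/m1|/m2]] := capped_cover cU w; [left|right].
apply: contrapT => /eqP /set0P [z [za zb]].
have e : connected_component (~` V) (g p1) = connected_component (~` V) (g p2).
  by rewrite (same_connected_component za) (same_connected_component zb).
pose C := connected_component (~` V) (g p1).
have C12 w : C w -> K1 w \/ K2 w.
  by move=> /connected_component_sub nV; have [//|] := capped_cover cU w.
(* The complement is the union of two disjoint closed caps, so each of them is open and closed
   inside a component. *)
have CK1 : C `&` K1 = C.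
  apply: (@component_connected _ (~` V) (g p1)).
  - by exists (g p1); split=> //; exact: m1.
  - exists (~` K2); first exact: closed_openC.
    apply/seteqP; split=> w [Cw kw]; split=> //.
      by move=> k2; exact: K12 kw k2.
    by have [|/kw] := C12 _ Cw.
  - by exists K1.
have : C (g p2) by rewrite /C e; exact: m2.
by rewrite -CK1 => -[_ k]; exact: K12 k kb.
Qed.

End LocalHomeoCapped.

(** Paths are allowed in place of segments because the caps will be contracted along stereographic
    images of segments in space. *)
Lemma starlike_connected (T : topologicalType) (R : realType) (S : set T) (c : T) :
  S c -> (forall x, S x -> exists f : R -> T, [/\ {within `[0, 1], continuous f},
     f 0 = c, f 1 = x & forall t, 0 <= t <= 1 -> S (f t)]) -> connected S.
Proof.
move=> Sc H; pose I := {x | S x}.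
pose f (i : I) := sval (cid (H _ (svalP i))).
have fP (i : I) := svalP (cid (H _ (svalP i))).
have -> : S = \bigcup_(i in [set: I]) (f i @` `[0, 1]).
  apply/seteqP; split => [x Sx|x [i _ [t t01 <-]]].
    pose i : I := exist _ x Sx; have [_ _ fx _] := fP i.
    exists i => //; exists 1; last exact: fx.
    by rewrite /= in_itv /= ler01 lexx.
  by have [_ _ _ Sf] := fP i; apply: Sf; move: t01; rewrite /= in_itv.
apply: bigcup_connected.
- exists c => i _; have [_ f0 _ _] := fP i; exists 0 => //.
  by rewrite /= in_itv /= ler01 lexx.
- move=> i _; have [cf _ _ _] := fP i.
  by apply: connected_continuous_connected => //; exact: segment_connected.
Qed.

(** * Locally convex closed curves on the sphere *)

(** Supplies the arc length function of a curve. A bounded interval is enough, since only parameters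
    within two periods of 0 are inspected. *)
Lemma continuous_primitive (R : realType) (f : R -> R) (a : R) :
  continuous f -> exists S : R -> R, forall x, - a < x < a -> is_derive x 1 S (f x).
Proof.
move=> cf; pose mu : {measure set _ -> \bar R} := @lebesgue_measure R.
exists (fun x => \int[mu]_(t in `[(- a), x]) (f t))%R => x /andP[ax xa].
have fi : mu.-integrable `[(- a), a] (EFin \o f).
  apply: continuous_compact_integrable; first exact: segment_compact.
  by apply: continuous_subspaceT => y; exact: cf.
have [d e] := @continuous_FTC1_closed R f (- a) x a xa fi ax (cf x).
apply: (DeriveDef d); apply: etrans e; exact: esym (derive1E _ _).
Qed.

(** Differentiates an implicitly defined [e] by Caratheodory's criterion. Where [a] vanishes the
    slope function falls back on the difference quotient, so that the required identity holds
    everywhere; near [t] this case does not occur. *)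
Lemma implicit_is_derive (R : realType) (a b e : R -> R) (t : R) :
  (forall y, a y * (e y - e t) = - b y * (y - t)) ->
  {for t, continuous a} -> {for t, continuous b} -> a t != 0 ->
  is_derive t 1 e (- b t / a t).
Proof.
move=> H ca cb at0; apply/is_derive1_caratheodory.
exists (fun y => if a y == 0 then (e y - e t) / (y - t) else - b y / a y); split.
- move=> z; case: eqP => [az|/eqP az].
    have [->|zt] := eqVneq z t; first by rewrite !subrr mulr0.
    by rewrite divfK // subr_eq0.
  apply: (mulfI az); rewrite H mulrA (mulrCA (a z)) mulfV // mulr1 //.
- rewrite /prop_for /continuous_at (negbTE at0).
  have c : {for t, continuous (fun y => - b y / a y)}.
    apply: continuousM; last exact: continuousV.
    exact: continuousN.
  apply: cvg_trans c; apply: near_eq_cvg.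
  have : nbhs t (a @^-1` [set x | x != 0]).
    by apply: ca; apply: open_nbhs_nbhs; split; [exact: open_neq|].
  by apply: filterS => y /= /negbTE ->.
- by rewrite (negbTE at0).
Qed.

Section ConvexCurve.
Variables (R : realType) (c tau N : R -> 'rV[R]_3) (w m : R -> R) (P : R).
Hypothesis P_gt0 : 0 < P.
Hypothesis dc : forall (t : R) i, is_derive t 1 (fun x => c x 0 i) (tau t 0 i).
Hypothesis dN : forall (t : R) i, is_derive t 1 (fun x => N x 0 i) ((m t *: tau t) 0 i).
Hypothesis ctau : forall i, continuous (fun t : R => tau t 0 i).
Hypothesis cm : continuous m.
Hypothesis m_gt0 : forall t, 0 < m t.
Hypothesis tautau : forall t, dot (tau t) (tau t) = w t.
Hypothesis w_gt0 : forall t, 0 < w t.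
Hypothesis cc : forall t, dot (c t) (c t) = 1.
Hypothesis NN : forall t, dot (N t) (N t) = 1.
Hypothesis cN : forall t, dot (c t) (N t) = 0.
Hypothesis tauN : forall t, dot (tau t) (N t) = 0.
Hypothesis frame : forall t u v, dot u v = dot u (c t) * dot v (c t)
  + dot u (tau t) * dot v (tau t) / w t + dot u (N t) * dot v (N t).
Hypothesis cP : forall t, c (t + P) = c t.
Hypothesis tauP : forall t, tau (t + P) = tau t.
Hypothesis NP : forall t, N (t + P) = N t.
Hypothesis simple : forall s t : R, s < t < s + P -> c s <> c t.

(** [phi t0 t] is the signed height of [c t] over the great circle tangent to the curve at [c t0],
    negative on the inner side. Its derivative in [t] is [psi], and its derivative in [t0] is
    [m t0 * chi t0 t]. *)
Let phi (t0 t : R) := dot (c t) (N t0).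
Let psi (t0 t : R) := dot (tau t) (N t0).
Let chi (t0 t : R) := dot (c t) (tau t0).

Let is_cst (v : 'rV[R]_3) (x : R) i : is_derive x 1 (fun=> v 0 i) ((0 : 'rV[R]_3) 0 i).
Proof. by rewrite mxE; exact: is_derive_cst. Qed.

Let dot30l (v : 'rV[R]_3) : dot 0 v = 0.
Proof. by rewrite dot3E !mxE; ring. Qed.

Let dphi_t (t0 t : R) : is_derive t 1 (phi t0) (psi t0 t).
Proof.
have := is_derive_dot3 (dc t) (is_cst (N t0) t).
by rewrite (dot3C (c t)) dot30l addr0.
Qed.

Let dphi_t0 (t0 t : R) : is_derive t0 1 (phi^~ t) (m t0 * chi t0 t).
Proof.
have := is_derive_dot3 (is_cst (c t) t0) (dN t0).
by rewrite dot30l add0r dot3Zr.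
Qed.

Let dpsi_t0 (t0 t : R) : is_derive t0 1 (psi^~ t) (m t0 * dot (tau t) (tau t0)).
Proof.
have := is_derive_dot3 (is_cst (tau t) t0) (dN t0).
by rewrite dot30l add0r dot3Zr.
Qed.

Let cc_cont i : continuous (fun t => c t 0 i).
Proof. by move=> t; exact: is_derive1_continuous (dc t i). Qed.

(** On the diagonal [phi] and [psi] vanish, while the derivative of [psi] in [t0] is positive
    nearby. Two uses of the mean value theorem turn this into the sign of [phi], with one radius for
    all pairs near [s]. *)
Lemma curve_locally_convex (s : R) : exists2 e : R, 0 < e & forall t0 t : R,
  `|t0 - s| < e -> `|t - s| < e -> t0 != t -> phi t0 t < 0.
Proof.
pose k (q : R * R) := dot (tau q.2) (tau q.1).
have ck : {for (s, s), continuous k}.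
  apply: continuous_dot3 => i.
    by apply: (@continuous_comp _ _ _ snd (fun t => tau t 0 i)); [exact: cvg_snd|exact: ctau].
  by apply: (@continuous_comp _ _ _ fst (fun t => tau t 0 i)); [exact: cvg_fst|exact: ctau].
have kss : k (s, s) = w s by rewrite /k tautau.
have /box_nbhs[e e0 He] := continuous_dist_lt ck (w_gt0 s).
have kpos x y : `|x - s| < e -> `|y - s| < e -> 0 < dot (tau y) (tau x).
  move=> xe ye; have := He x y xe ye; rewrite /= kss ltr_norml /k /= => /andP[_]; lra.
have btw x y z : `|x - s| < e -> `|y - s| < e -> x <= z <= y -> `|z - s| < e.
  rewrite !ltr_norml => /andP[x1 x2] /andP[y1 y2] /andP[z1 z2].
  by apply/andP; split; lra.
have psi_sgn x y : `|x - s| < e -> `|y - s| < e ->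
   (x < y -> 0 < psi y x) /\ (y < x -> psi y x < 0).
  move=> xe ye; split=> xy.
    have [z /andP[z1 z2] E] := mean_value xy (fun z _ => dpsi_t0 z x).
    move: E; rewrite {2}/psi tauN subr0 => ->.
    rewrite mulr_gt0 ?subr_gt0 // mulr_gt0 //; apply: kpos => //.
    by apply: (btw x y) => //; rewrite !ltW.
  have [z /andP[z1 z2] E] := mean_value xy (fun z _ => dpsi_t0 z x).
  move: E; rewrite {1}/psi tauN sub0r => /eqP; rewrite eqr_oppLR => /eqP ->.
  rewrite oppr_lt0 mulr_gt0 ?subr_gt0 // mulr_gt0 //; apply: kpos => //.
  by apply: (btw y x) => //; rewrite !ltW.
exists e => // t0 t t0e te; rewrite neq_lt => /orP[tt|tt].
- have [z /andP[z1 z2] E] := mean_value tt (fun z _ => dphi_t t0 z).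
  move: E; rewrite {2}/phi cN subr0 => ->.
  have ze : `|z - s| < e by apply: (btw t0 t) => //; rewrite !ltW.
  by rewrite pmulr_llt0 ?subr_gt0 //; have [_] := psi_sgn _ _ ze t0e; exact.
- have [z /andP[z1 z2] E] := mean_value tt (fun z _ => dphi_t t0 z).
  move: E; rewrite {1}/phi cN sub0r => /eqP; rewrite eqr_oppLR => /eqP ->.
  have ze : `|z - s| < e by apply: (btw t t0) => //; rewrite !ltW.
  rewrite oppr_lt0 mulr_gt0 ?subr_gt0 //.
  by have [+ _] := psi_sgn _ _ ze t0e; exact.
Qed.

Let phiP (t0 t : R) : phi t0 (t + P) = phi t0 t. Proof. by rewrite /phi cP. Qed.
Let phiP0 (t0 t : R) : phi (t0 + P) t = phi t0 t. Proof. by rewrite /phi NP. Qed.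

(** The radius is uniform in [t0] because the coordinates of the unit vector [N t0] are at most 1 in
    absolute value. *)
Let phi_near (t e : R) : 0 < e -> exists2 d : R, 0 < d & forall t' t0 : R, `|t' - t| < d ->
  `|phi t0 t' - phi t0 t| < e.
Proof.
move=> e0; have e3 : 0 < e / 3 by rewrite divr_gt0.
have n i : exists2 d : R, 0 < d & forall t', `|t' - t| < d -> `|c t' 0 i - c t 0 i| < e / 3.
  have /nbhs_ballP[d d0 Hd] := @continuous1_dist_lt R (fun t => c t 0 i) t _ (@cc_cont i t) e3.
  by exists d => // t' tt; apply: Hd; rewrite /ball /= distrC.
have [d0 d00 H0] := n 0; have [d1 d10 H1] := n 1; have [d2 d20 H2] := n 2%:R.
exists (Num.min d0 (Num.min d1 d2)); first by rewrite !lt_min d00 d10.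
move=> t' t0; rewrite !lt_min => /and3P[h0 h1 h2].
have -> : phi t0 t' - phi t0 t = (c t' 0 0 - c t 0 0) * N t0 0 0 +
  (c t' 0 1 - c t 0 1) * N t0 0 1 + (c t' 0 2%:R - c t 0 2%:R) * N t0 0 2%:R.
  by rewrite /phi !dot3E; ring.
have B i : `|c t' 0 i - c t 0 i| < e / 3 -> `|(c t' 0 i - c t 0 i) * N t0 0 i| < e / 3.
  by move=> Hi; rewrite normrM (le_lt_trans _ Hi) // ler_piMr //; exact: dot3_unit_le.
have gen (x y z : R) : `|x| < e / 3 -> `|y| < e / 3 -> `|z| < e / 3 -> `|x + y + z| < e.
  by move=> hx hy hz; have := ler_normD (x + y) z; have := ler_normD x y; lra.
by apply: gen; apply: B; [exact: H0|exact: H1|exact: H2].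
Qed.

Let cphi0 (t : R) : continuous (phi^~ t).
Proof. by move=> x; exact: is_derive1_continuous (dphi_t0 x t). Qed.

Let compact_neg (t a b : R) : (forall t0, a <= t0 <= b -> phi t0 t < 0) ->
  exists2 d : R, 0 < d & forall t' t0, `|t' - t| < d -> a <= t0 <= b -> phi t0 t' < 0.
Proof.
have [ab|ba] := leP a b; last first.
  by move=> _; exists 1 => // t' t0 _ /andP[x1 x2]; have := le_trans x1 x2; rewrite leNgt ba.
move=> H.
have [|x xab Hx] := @EVT_max R (phi^~ t) a b ab.
  by apply: continuous_subspaceT => x; exact: cphi0.
have x1 : a <= x <= b by move: xab; rewrite in_itv.
have [d d0 Hd] := @phi_near t (- phi x t) ltac:(by rewrite oppr_gt0; exact: H).
exists d => // t' t0 td t0ab.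
have := Hd t' t0 td; rewrite ltr_norml => /andP[_].
have := Hx t0; rewrite in_itv /= => /(_ t0ab); lra.
Qed.

Let persist (t a : R) : a < t -> (forall t0, a <= t0 < t -> phi t0 t < 0) ->
  exists2 d : R, 0 < d & forall t' t0, `|t' - t| < d -> a <= t0 < t' -> phi t0 t' < 0.
Proof.
move=> at_ H; have [e e0 He] := curve_locally_convex t.
have [t0 /andP[x1 x2]|d d0 Hd] := @compact_neg t a (t - e / 2).
  by apply: H; rewrite x1 /= (le_lt_trans x2) // ltrBlDr ltrDl divr_gt0.
exists (Num.min d e); first by rewrite lt_min d0.
move=> t' t0; rewrite lt_min => /andP[td te] /andP[at0 t0t'].
have [h|h] := leP t0 (t - e / 2); first by apply: Hd => //; rewrite at0.
apply: He => //; last by rewrite lt_eqF.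
by move: te; rewrite !ltr_norml => /andP[x1 x2]; apply/andP; split; lra.
Qed.

Let is_zero (t0 t : R) := t - P < t0 < t /\ phi t0 t = 0.
(** The last parameter, in the period before [t], whose tangent great circle passes through
    [c t]. *)
Let last_zero (e t : R) := is_zero e t /\ forall t0, e < t0 < t -> phi t0 t < 0.

(** By periodicity local convexity applies at both ends of the period before [t]. The zeros are thus
    confined to a compact interval, and a last one exists as soon as there is any. *)
Let neg_near_end (t : R) : exists2 e : R, 0 < e & (forall t0, t - e < t0 < t -> phi t0 t < 0) /\
  (forall t0, t - P < t0 < t - P + e -> phi t0 t < 0).
Proof.
have [e1 e10 H1] := curve_locally_convex t.
have [e2 e20 H2] := curve_locally_convex (t - P).
exists (Num.min e1 e2); first by rewrite lt_min e10.
split=> t0 /andP[x1 x2].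
- have : Num.min e1 e2 <= e1 by rewrite ge_min lexx.
  move=> h; apply: H1; last by rewrite lt_eqF.
    by rewrite ltr_norml; apply/andP; split; lra.
  by rewrite subrr normr0.
- have : Num.min e1 e2 <= e2 by rewrite ge_min lexx orbT.
  move=> h; rewrite -(subrK P t) phiP; apply: H2; last by rewrite gt_eqF.
    by rewrite ltr_norml; apply/andP; split; lra.
  by rewrite subrr normr0.
Qed.

Let ivt (t a b : R) : a <= b -> 0 <= phi a t -> phi b t <= 0 ->
  exists2 z, a <= z <= b & phi z t = 0.
Proof.
move=> ab pa pb; have [||z] := @IVT R (phi^~ t) a b 0 ab.
- by apply: continuous_subspaceT => x; exact: cphi0.
- by rewrite ge_min pb orbT le_max pa.
- by rewrite in_itv /= => zab pz; exists z.
Qed.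

Let zero_after (t y : R) : y < t -> 0 <= phi y t ->
  exists2 z : R, y <= z < t & phi z t = 0.
Proof.
move=> yt py; have [e e0 [He1 _]] := neg_near_end t.
pose b := Num.max y (t - e / 2).
have bt : b < t by rewrite /b gt_max yt /= ltrBlDr ltrDl divr_gt0.
have yb : y <= b by rewrite /b le_max lexx.
have eb : t - e / 2 <= b by rewrite /b le_max lexx orbT.
have pb : phi b t < 0 by apply: He1; rewrite bt andbT (lt_le_trans _ eb) //; lra.
have [z /andP[z1 z2] z3] := ivt yb py (ltW pb).
by exists z => //; rewrite z1 (le_lt_trans z2).
Qed.

Let last_zeroP (t : R) : (exists t0, is_zero t0 t) -> exists e, last_zero e t.
Proof.
move=> [t0 [/andP[z1 z2] z3]]; have [e e0 [He1 He2]] := neg_near_end t.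
have in_cpt x : is_zero x t -> t - P + e <= x <= t - e.
  move=> [/andP[x1 x2] x3]; apply/andP; split; rewrite leNgt; apply/negP => h.
    by have := He2 x; rewrite x1 h x3 ltxx => /(_ isT).
  by have := He1 x; rewrite x2 h x3 ltxx => /(_ isT).
pose Z := `[t - P + e, t - e]%classic `&` [set x | phi x t = 0].
have cZ : compact Z.
  apply: compact_closedI; first exact: segment_compact.
  apply: (@closed_comp _ _ (phi^~ t) [set 0]); last exact: closed_eq.
  by move=> x _; exact: cphi0.
have zZ x : is_zero x t -> Z x.
  by move=> zx; split; [rewrite /= in_itv /=; exact: in_cpt|case: zx].
have Zz x : Z x -> is_zero x t.
  rewrite /Z /= in_itv /= => -[/andP[x1 x2] x3]; split=> //; apply/andP; split; lra.
have [||x xZ Hx] := @compact_EVT_max R R id Z _ cZ.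
  by exists t0; apply: zZ; split=> //; rewrite z1.
  by apply: continuous_subspaceT => y; exact: cvg_id.
have {}xZ : Z x by rewrite inE in xZ.
exists x; split; first exact: Zz.
have [/andP[x1 x2] x3] := Zz _ xZ.
move=> y /andP[xy yt]; rewrite ltNge; apply/negP => py.
have [z /andP[z4 z5] z6] := zero_after yt py.
have : Z z by apply: zZ; split=> //; apply/andP; split; lra.
move/mem_set/Hx; lra.
Qed.

(* The second alternative of the frame identity, [c t = - c e], would make
   [phi] positive just after [e] by local convexity. *)
Let last_zero_chi (e t : R) : last_zero e t -> chi e t < 0.
Proof.
move=> [[/andP[e1 e2] e3] e4].
have chile : chi e t <= 0.
  have := @is_derive1_le_right R (phi^~ t) e _ (dphi_t0 e t).
  rewrite pmulr_rle0 //; apply; exists (t - e); first by rewrite subr_gt0.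
  by move=> h /andP[h1 h2]; rewrite e3 ltW // e4 //; apply/andP; split; lra.
rewrite lt_neqAle chile andbT; apply/eqP => chi0.
have := frame e (c t) (c t); rewrite cc -/(chi e t) chi0 -/(phi e t) e3 !mul0r !addr0 => zz.
pose z := dot (c t) (c e).
have [z1|zN1] : z = 1 \/ z = -1.
  have /eqP : (z - 1) * (z + 1) = 0 by rewrite -/z in zz; nra.
  by rewrite mulf_eq0 subr_eq0 addr_eq0 => /orP[]/eqP; [left|right].
- apply: (@simple e t); first by rewrite e2 /=; lra.
  apply/eqP; rewrite -subr_eq0; apply/eqP/dot3_eq0.
  rewrite dot3Dl dot3Nl !(dot3C _ (c e - c t)) !dot3Dl !dot3Nl !cc.
  by rewrite (dot3C (c e)) -/z z1; ring.
- have ct : c t = - c e.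
    apply/eqP; rewrite -subr_eq0 opprK; apply/eqP/dot3_eq0.
    rewrite dot3Dl !(dot3C _ (c t + c e)) !dot3Dl !cc (dot3C (c e)) -/z zN1; ring.
  have [d d0 Hd] := curve_locally_convex e.
  pose h := Num.min d (t - e) / 2.
  have m0 : 0 < Num.min d (t - e) by rewrite lt_min d0 subr_gt0.
  have m1 : Num.min d (t - e) <= d by rewrite ge_min lexx.
  have m2 : Num.min d (t - e) <= t - e by rewrite ge_min lexx orbT.
  have h0 : 0 < h by rewrite /h; lra.
  have : phi (e + h) t < 0 by apply: e4; rewrite /h; apply/andP; split; lra.
  rewrite /phi ct dot3Nl; have : phi (e + h) e < 0.
    apply: Hd; last by rewrite gt_eqF // ltrDl.
      by rewrite addrAC subrr add0r gtr0_norm // /h; lra.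
    by rewrite subrr normr0.
  by rewrite /phi; lra.
Qed.

(** By [last_zero_chi] the height crosses zero at [e] with nonzero speed in [t0], so the sign change
    survives a small change of [t]. *)
Let zero_near (e t : R) : last_zero e t -> forall r : R, 0 < r -> exists2 d : R, 0 < d &
  forall t', `|t' - t| < d -> exists2 z, e - r <= z <= e + r & is_zero z t'.
Proof.
move=> le; have ch := last_zero_chi le; case: le => [[/andP[e1 e2] e3] e4] r r0.
have dneg : is_derive e 1 (fun x => - phi x t) (- (m e * chi e t)).
  exact: is_derive1N (dphi_t0 e t).
have pos : 0 < - (m e * chi e t) by rewrite oppr_gt0 pmulr_rlt0.
have [q q0 Hq] := derive_gt0_near dneg pos.
have [k [k0 k1 k2 k3 k4]] : exists k, [/\ 0 < k, k <= q, k <= r, k <= t - e & k <= e - t + P].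
  exists (Num.min (Num.min q r) (Num.min (t - e) (e - t + P))).
  rewrite !lt_min !ge_min q0 r0 !lexx !orbT /=; split=> //.
  by apply/andP; split; lra.
have := Hq (k / 2); rewrite e3 oppr0 => /(_ _)/andP[|h1 h2]; first by apply/andP; split; lra.
have g1 : 0 < phi (e - k / 2) t by lra.
have g2 : 0 < - phi (e + k / 2) t by lra.
have [d1 d10 Hd1] := phi_near t g1; have [d2 d20 Hd2] := phi_near t g2.
have k20 : 0 < k / 2 by lra.
exists (Num.min (Num.min d1 d2) (k / 2)); first by rewrite !lt_min d10 d20.
move=> t'; rewrite !lt_min => /andP[/andP[h3 h4] h5].
have := Hd1 t' (e - k / 2) h3; have := Hd2 t' (e + k / 2) h4.
rewrite !ltr_norml => /andP[f1 f2] /andP[f3 f4].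
move: h5; rewrite ltr_norml => /andP[h5 h6].
have [|||z /andP[z1 z2] z3] := @ivt t' (e - k / 2) (e + k / 2); try lra.
exists z; first by apply/andP; split; lra.
by split=> //; apply/andP; split; lra.
Qed.

(** The parameters [t] that admit a zero form an open and closed subset of the line: openness is
    [zero_near], and strict negativity over a whole period persists. *)
Let all_zero (t1 : R) : (exists t0, is_zero t0 t1) -> forall t : R, exists e, last_zero e t.
Proof.
move=> H1 t; apply: last_zeroP.
pose Z := [set t | exists t0, is_zero t0 t].
suff ZT : Z = setT by have : Z t by rewrite ZT.
have cR : connected [set: R] by apply/connected_intervalP => x y _ _ z _.
have oZ : open Z.
  rewrite openE => s /last_zeroP[e le].
  have [d d0 Hd] := zero_near le ltr01.
  apply/nbhs_ballP; exists d => // y; rewrite /ball /= distrC => /Hd[z _ zz].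
  by exists z.
apply: cR; first by exists t1.
- by exists Z => //; rewrite setTI.
exists Z; last by rewrite setTI.
suff clo (s : R) : ~ Z s -> nbhs s (~` Z) by rewrite -openC openE => s; exact: clo.
move=> nz; apply/nbhs_ballP.
have neg (t0 : R) : s - P < t0 < s -> phi t0 s < 0.
  move=> /andP[x1 x2]; rewrite ltNge; apply/negP => p0.
  have [z /andP[z4 z5] z6] := zero_after x2 p0.
  by apply: nz; exists z; split=> //; apply/andP; split; lra.
have a1 : s - P / 2 < s by have := P_gt0; lra.
have [t0 /andP[x1 x2]|d1 d10 Hd1] := @persist s (s - P / 2) a1; first by apply: neg; lra.
(* The period before a nearby parameter is cut in three: [persist] handles the end next to it,
   [compact_neg] the middle, and local convexity at [s - P] the far end. *)
have [e2 e20 He] := curve_locally_convex (s - P).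
have [t0 /andP[x1 x2]|d2 d20 Hd2] := @compact_neg s (s - P + Num.min e2 P / 2) (s - P / 2).
  have ? : 0 < Num.min e2 P by rewrite lt_min e20.
  by apply: neg; apply/andP; split; lra.
exists (Num.min (Num.min d1 d2) e2); first by rewrite /= !lt_min d10 d20.
move=> /= y; rewrite /ball /= distrC !lt_min => /andP[/andP[y1 y2] y3] [t0 [/andP[z1 z2] z3]].
have [h|h] := leP (s - P / 2) t0.
  by have := Hd1 y t0 y1; rewrite h z2 z3 ltxx => /(_ isT).
have [h'|h'] := leP (s - P + Num.min e2 P / 2) t0.
  by have := Hd2 y t0 y2; rewrite h' ltW // z3 ltxx => /(_ isT).
have mle : Num.min e2 P <= e2 by rewrite ge_min lexx.
have : phi t0 (y - P) < 0; last by rewrite -phiP subrK z3 ltxx.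
move: y3; rewrite ltr_norml => /andP[y4 y5].
apply: He; last by rewrite gt_eqF.
- by rewrite ltr_norml; apply/andP; split; lra.
- by rewrite ltr_norml; apply/andP; split; lra.
Qed.

(* [M] below is (length of the tangent string from [c e] back to [c t]) plus
   (arc length from [c e] to [c t]); it is nondecreasing by the Cauchy-Schwarz
   inequality and takes the same value after one period. *)
Lemma curve_no_zero (t0 t : R) : ~ is_zero t0 t.
Proof.
move=> z0; have /all_zero all0 : exists x, is_zero x t by exists t0.
have [e eP] := choice all0.
have e_uniq x y s : last_zero x s -> last_zero y s -> x = y.
  move=> [[/andP[x1 x2] x3] x4] [[/andP[y1 y2] y3] y4].
  have [xy|yx|//] := ltgtP x y.
    by have := x4 y; rewrite xy y2 y3 ltxx => /(_ isT).
  by have := y4 x; rewrite yx x2 x3 ltxx => /(_ isT).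
have eshift s : e (s + P) = e s + P.
  apply: (e_uniq _ _ (s + P)); first exact: eP.
  have [[/andP[x1 x2] x3] x4] := eP s; split.
    split; first by apply/andP; split; lra.
    by rewrite phiP0 phiP.
  move=> u /andP[u1 u2]; rewrite phiP -(subrK P u) phiP0.
  by apply: x4; apply/andP; split; lra.
have e_bd s : s - P < e s < s by have [[]] := eP s.
have e_zero s : phi (e s) s = 0 by have [[]] := eP s.
have e_chi s : chi (e s) s < 0 := last_zero_chi (eP s).
(* [zero_near] keeps [e] from dropping, and [persist] keeps it from jumping up. *)
have e_cont : continuous e.
  move=> s; apply/cvgrPdist_le => r r0; have [x1 x2] := andP (e_bd s).
  have [[_ _] x4] := eP s.
  pose k := Num.min r ((s - e s) / 2).
  have k0 : 0 < k by rewrite lt_min r0 /=; lra.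
  have k1 : k <= r by rewrite ge_min lexx.
  have k2 : k <= (s - e s) / 2 by rewrite ge_min lexx orbT.
  have [d1 d10 Hd1] := zero_near (eP s) k0.
  have [|u /andP[u1 u2]|d2 d20 Hd2] := @persist s (e s + k); first lra.
    by apply: x4; rewrite u2 andbT; lra.
  apply/nbhs_ballP; exists (Num.min d1 d2); first by rewrite /= lt_min d10.
  move=> y; rewrite /ball /= distrC lt_min => /andP[y1 y2].
  have [z /andP[z1 z2] [/andP[z3 z4] z5]] := Hd1 y y1.
  have [[/andP[y3 y4] y5] y6] := eP y.
  have zy : z <= e y.
    rewrite leNgt; apply/negP => h; have := y6 z.
    by rewrite h z4 z5 ltxx => /(_ isT).
  have ye : e y <= e s + k.
    rewrite leNgt; apply/negP => h; have := Hd2 y (e y) y2.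
    by rewrite ltW // y4 y5 ltxx => /(_ isT).
  by rewrite ler_norml; apply/andP; split; lra.
(* Implicit differentiation of [phi (e s) s = 0]. The intermediate points [xi] come from the mean
   value theorem in each variable separately, and they converge because [e] is continuous. *)
have e_der (s : R) : is_derive s 1 e (- psi (e s) s / (m (e s) * chi (e s) s)).
  have H (y : R) : exists xi : R * R, [/\ Num.min (e s) (e y) <= xi.1 <= Num.max (e s) (e y),
      Num.min s y <= xi.2 <= Num.max s y &
      (m xi.1 * chi xi.1 y) * (e y - e s) = - psi (e s) xi.2 * (y - s)].
    have [x1 h1 E1] := @mean_value_between R (phi^~ y) (fun x => m x * chi x y) (e s) (e y)
       (fun x _ => dphi_t0 x y).
    have [x2 h2 E2] := @mean_value_between R (phi (e s)) (psi (e s)) s y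
       (fun x _ => dphi_t (e s) x).
    exists (x1, x2); split=> //=.
    by rewrite mulNr -E1 -E2 !e_zero; ring.
  have [xi xiP] := choice H.
  have xi1 : (xi s).1 = e s.
    have [+ _ _] := xiP s; rewrite minxx maxxx => h; apply/eqP; rewrite eq_le.
    by rewrite andbC.
  have xi2 : (xi s).2 = s.
    have [_ + _] := xiP s; rewrite minxx maxxx => h; apply/eqP; rewrite eq_le.
    by rewrite andbC.
  have dist (x y z r : R) : Num.min x y <= z <= Num.max x y -> `|y - x| < r -> `|z - x| < r.
    rewrite !ltr_norml => /andP[z1 z2] /andP[y1 y2].
    by case: (leP x y) z1 z2 => h z1 z2; apply/andP; split; lra.
  have c1 : {for s, continuous (fun y => (xi y).1)}.
    apply/cvgrPdist_lt => r r0; have /cvgrPdist_lt/(_ r r0) := e_cont s.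
    apply: filterS => y; rewrite xi1 distrC => h.
    by rewrite distrC; apply: dist h; have [] := xiP y.
  have c2 : {for s, continuous (fun y => (xi y).2)}.
    apply/cvgrPdist_lt => r r0; apply/nbhs_ballP; exists r => // y.
    rewrite /ball /= xi2 distrC => h.
    by rewrite distrC; apply: dist h; have [] := xiP y.
  pose a y := m (xi y).1 * chi (xi y).1 y; pose b y := psi (e s) (xi y).2.
  have ca : {for s, continuous a}.
    apply: continuousM; first by apply: continuous_comp => //; exact: cm.
    apply: continuous_dot3 => i; first exact: cc_cont.
    by apply: (@continuous_comp _ _ _ (fun y => (xi y).1) (fun t => tau t 0 i)) => //; exact: ctau.
  have cb : {for s, continuous b}.
    apply: continuous_comp => //.
    by apply: continuous_dot3 => i; [exact: ctau|exact: cvg_cst].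
  have := @implicit_is_derive R a b e s; rewrite /a /b xi1 xi2; apply => //.
  - by move=> y; have [] := xiP y.
  - by apply: mulf_neq0; [rewrite gt_eqF|rewrite lt_eqF // e_chi].
have csw : continuous (fun x => Num.sqrt (w x)).
  move=> x; apply: continuous_comp; last exact: sqrt_continuous.
  rewrite /prop_for /continuous_at (_ : w = fun t => dot (tau t) (tau t)); last first.
    by apply/funext => y; rewrite tautau.
  by apply: continuous_dot3 => i; exact: ctau.
have [S dS] := continuous_primitive (2 * P) csw.
pose z (s : R) := dot (c (e s)) (c s).
(* [c s] lies on the great circle tangent at [c (e s)], so its component along [tau (e s)] is
   determined up to sign by the angle [acos (z s)]; [last_zero_chi] selects the sign. *)
have zlt (s : R) : -1 < z s < 1 /\ chi (e s) s = - (Num.sqrt (w (e s)) * Num.sqrt (1 - z s ^+ 2)).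
  have := frame (e s) (c s) (c s).
  rewrite -/(phi (e s) s) e_zero mul0r addr0 -/(chi (e s) s) cc (dot3C (c s)) -/(z s) => F.
  have W := w_gt0 (e s); have X := e_chi s.
  have F' : (1 - z s ^+ 2) * w (e s) = chi (e s) s ^+ 2.
    by rewrite {1}F; field; rewrite gt_eqF.
  have z2 : 0 < 1 - z s ^+ 2.
    by rewrite -(pmulr_lgt0 _ W) F' exprn_even_gt0 //= lt_eqF.
  split; first by apply/andP; split; nra.
  rewrite -sqrtrM ?ltW // mulrC F' sqrtr_sqr ltr0_norm // opprK //.
pose de (s : R) := - psi (e s) s / (m (e s) * chi (e s) s).
have dz (s : R) : is_derive s 1 z (de s * chi (e s) s + dot (c (e s)) (tau s)).
  have D i : is_derive s 1 (fun y => c (e y) 0 i) ((de s *: tau (e s)) 0 i).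
    have := @is_derive1_comp R (fun x => c x 0 i) e s _ _ (dc (e s) i) (e_der s).
    by rewrite mxE mulrC.
  have := is_derive_dot3 D (dc s).
  by rewrite dot3Zl (dot3C (tau (e s))).
pose M (s : R) := acos (z s) - S (e s) + S s.
pose dM (s : R) := Num.sqrt (w s) - dot (c (e s)) (tau s) / Num.sqrt (1 - z s ^+ 2).
have is_dM (s : R) : 0 <= s <= P -> is_derive s 1 M (dM s).
  move=> /andP[s0 sP]; have /andP[es1 es2] := e_bd s.
  have [zs chie] := zlt s.
  have r1 : - (2 * P) < e s < 2 * P by apply/andP; split; lra.
  have r2 : - (2 * P) < s < 2 * P by apply/andP; split; lra.
  have D1 := @is_derive1_comp R (@acos R) z s _ _ (is_derive1_acos zs) (dz s).
  have D2 := @is_derive1_comp R S e s _ _ (dS _ r1) (e_der s).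
  have := is_derive1D (is_derive1B D1 D2) (dS _ r2).
  have z2 : 0 < Num.sqrt (1 - z s ^+ 2) by rewrite sqrtr_gt0; move/andP: zs => [? ?]; nra.
  (* Once [chi] is replaced, the contributions of [de] to the string length and to the arc length at
     [e s] cancel. *)
  rewrite -/(de s) chie; set A := Num.sqrt (w (e s)).
  set B := Num.sqrt _ in z2 *; set C := Num.sqrt (w s); set D := dot _ _.
  set E := (X in is_derive _ _ _ X); have -> : E = dM s; last exact.
  rewrite /E /dM -/B -/C -/D; field.
  by rewrite gt_eqF.
have cs (s : R) : dot (c (e s)) (tau s) ^+ 2 <= w s * (1 - z s ^+ 2).
  have := frame s (c (e s)) (c (e s)); rewrite cc -/(z s) => F.
  have W := w_gt0 s.
  have -> : w s * (1 - z s ^+ 2) = dot (c (e s)) (tau s) ^+ 2 + w s * dot (c (e s)) (N s) ^+ 2.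
    by rewrite {1}F; field; rewrite gt_eqF.
  by rewrite lerDl mulr_ge0 ?sqr_ge0 // ltW.
have dM_ge0 (s : R) : 0 <= dM s.
  have [/andP[zs1 zs2] _] := zlt s.
  have z2 : 0 < 1 - z s ^+ 2 by nra.
  rewrite /dM subr_ge0 ler_pdivrMr ?sqrtr_gt0 //.
  rewrite -sqrtrM; last exact: ltW.
  by rewrite (le_trans (ler_norm _)) // -sqrtr_sqr ler_wsqrtr.
have MP : M P = M 0.
  have /andP[e01 e02] := e_bd 0.
  rewrite /M /z -(add0r P) eshift !cP.
  suff H : S (0 + P) - S 0 = S (e 0 + P) - S (e 0) by lra.
  pose D x := S (x + P) - S x.
  have [x /andP[x1 x2]|x _] := @mean_value R D (fun=> 0) (e 0) 0 e02; last by rewrite /D; lra.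
  have -> : 0 = Num.sqrt (w (x + P)) * 1 - Num.sqrt (w x).
    by rewrite mulr1 -!tautau tauP subrr.
  apply: is_derive1B; last by apply: dS; apply/andP; split; lra.
  apply: (@is_derive1_comp R S (fun y => y + P)).
    by apply: dS; apply/andP; split; lra.
  have := is_derive1D (is_derive_id x (1 : R)) (is_derive_cst P x (1 : R)).
  by rewrite addr0.
have Mmono (x y : R) : 0 <= x -> x <= y -> y <= P -> M x <= M y.
  move=> x0; rewrite le_eqVlt => /orP[/eqP -> //|xy] yP.
  have [u /andP[u1 u2]|u _ E] := @mean_value R M dM x y xy.
    by apply: is_dM; apply/andP; split; lra.
  by rewrite -subr_ge0 E mulr_ge0 // subr_ge0 ltW.
(* [M] is monotone with equal end values, hence constant, and the Cauchy-Schwarz bound [cs] becomes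
   an equality. *)
have dM0 (s : R) : 0 < s < P -> dM s = 0.
  move=> /andP[s0 sP]; have D : is_derive s 1 M (dM s) by apply: is_dM; rewrite !ltW.
  apply: (local_max_derive_eq0 D).
  pose k := Num.min s (P - s).
  have k1 : k <= s by rewrite ge_min lexx.
  have k2 : k <= P - s by rewrite ge_min lexx orbT.
  apply/nbhs_ballP; exists k; first by rewrite /= lt_min s0 subr_gt0.
  move=> y; rewrite /ball /= ltr_norml => /andP[y1 y2].
  have : M y <= M P by apply: Mmono; lra.
  have : M 0 <= M s by apply: Mmono; lra.
  by rewrite MP; lra.
(* Equality puts [c (e s)] in the span of [c s] and [tau s]. Pairing with [N (e s)], which is
   orthogonal to both [c (e s)] and [c s], yields [psi (e s) s = 0]. *)
have de0 (s : R) : 0 < s < P -> de s = 0.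
  move=> /dM0; rewrite /dM => /eqP; rewrite subr_eq0 => /eqP E.
  have [/andP[zs1 zs2] _] := zlt s; have W := w_gt0 s.
  have z2 : 0 < 1 - z s ^+ 2 by nra.
  have sz : 0 < Num.sqrt (1 - z s ^+ 2) by rewrite sqrtr_gt0.
  have K : dot (c (e s)) (tau s) = Num.sqrt (w s) * Num.sqrt (1 - z s ^+ 2).
    by rewrite E divfK // gt_eqF.
  have Kpos : 0 < dot (c (e s)) (tau s) by rewrite K mulr_gt0 // sqrtr_gt0.
  have F1 := frame s (c (e s)) (c (e s)).
  have F2 := frame s (c (e s)) (N (e s)).
  rewrite cc -/(z s) K in F1.
  have cN0 : dot (c (e s)) (N s) = 0.
    have sw : Num.sqrt (w s) ^+ 2 = w s by rewrite sqr_sqrtr // ltW.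
    have sz2 : Num.sqrt (1 - z s ^+ 2) ^+ 2 = 1 - z s ^+ 2 by rewrite sqr_sqrtr // ltW.
    apply/eqP; rewrite -sqrf_eq0 expr2; apply/eqP.
    have : Num.sqrt (w s) * Num.sqrt (1 - z s ^+ 2) *
        (Num.sqrt (w s) * Num.sqrt (1 - z s ^+ 2)) / w s = 1 - z s ^+ 2.
      by rewrite mulrACA -!expr2 sw sz2; field; rewrite gt_eqF.
    by move=> h; rewrite h in F1; rewrite expr2 in F1; lra.
  rewrite cN cN0 mul0r addr0 -/(z s) in F2.
  have pe : dot (N (e s)) (c s) = 0 by rewrite dot3C; exact: e_zero.
  rewrite pe mulr0 add0r (dot3C (N _)) -/(psi (e s) s) in F2.
  have ps : psi (e s) s = 0.
    apply/eqP; have /eqP := esym F2.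
    by rewrite !mulf_eq0 invr_eq0 (gt_eqF Kpos) (gt_eqF W) orbF.
  by rewrite /de ps oppr0 mul0r.
(* A stationary [e] contradicts [eshift], by which [e] advances by [P] over one period. *)
have [u u01 E] := @mean_value R e de 0 P P_gt0 (fun s _ => e_der s).
move: E; rewrite de0 // mul0r -{1}(add0r P) eshift; lra.
Qed.

Theorem curve_globally_convex (t0 t : R) : t0 < t < t0 + P -> dot (c t) (N t0) < 0.
Proof.
move=> /andP[h1 h2]; rewrite ltNge; apply/negP => p0.
have [z /andP[z4 z5] z6] := zero_after h1 p0.
by apply: (@curve_no_zero z t); split=> //; apply/andP; split; lra.
Qed.

End ConvexCurve.

(** * Vector fields on a strip *)

HB.lock Definition vs (R : realType) (A : R * R -> 'rV[R]_3) (p : R * R) : 'rV[R]_3 :=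
  \row_i ds (fun q => A q 0 i) p.
HB.lock Definition vt (R : realType) (A : R * R -> 'rV[R]_3) (p : R * R) : 'rV[R]_3 :=
  \row_i dt (fun q => A q 0 i) p.

Section VectorFields.
Variable R : realType.
Local Notation pt := (R * R)%type.
Local Notation vec := 'rV[R]_3.
Implicit Types (O : set pt) (A B : pt -> vec) (f g : pt -> R) (p : pt) (n : nat).

Lemma vsE A p i : vs A p 0 i = ds (fun q => A q 0 i) p.
Proof. by rewrite unlock mxE. Qed.

Lemma vtE A p i : vt A p 0 i = dt (fun q => A q 0 i) p.
Proof. by rewrite unlock mxE. Qed.

Definition smv O n A := forall i, sm O n (fun q => A q 0 i).

Lemma smv_vs O n A : open O -> smv O n.+1 A -> smv O n (vs A).
Proof.
move=> oO sA i; have -> : (fun q => vs A q 0 i) = ds (fun q => A q 0 i).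
  by apply/funext => q; rewrite vsE.
exact: sm_ds.
Qed.

Lemma smv_vt O n A : open O -> smv O n.+1 A -> smv O n (vt A).
Proof.
move=> oO sA i; have -> : (fun q => vt A q 0 i) = dt (fun q => A q 0 i).
  by apply/funext => q; rewrite vtE.
exact: sm_dt.
Qed.

Lemma sm_dot O n A B : smv O n A -> smv O n B -> sm O n (fun q => dot (A q) (B q)).
Proof.
move=> sA sB; have -> : (fun q => dot (A q) (B q)) = (fun q => A q 0 0 * B q 0 0
    + A q 0 1 * B q 0 1 + A q 0 2%:R * B q 0 2%:R) by apply/funext => q; exact: dot3E.
by apply: sm_add; [apply: sm_add|]; apply: sm_mul.
Qed.

Lemma ds_dot O n A B p : smv O n.+1 A -> smv O n.+1 B -> O p ->
  ds (fun q => dot (A q) (B q)) p = dot (vs A p) (B p) + dot (A p) (vs B p).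
Proof.
move=> sA sB Op.
have DA i : is_derive p.1 1 (fun x => A (x, p.2) 0 i) (vs A p 0 i).
  by rewrite vsE; exact: (sm_is_ds (sA i) Op).
have DB i : is_derive p.1 1 (fun x => B (x, p.2) 0 i) (vs B p 0 i).
  by rewrite vsE; exact: (sm_is_ds (sB i) Op).
have := is_derive_dot3 DA DB; rewrite -surjective_pairing => D.
exact: is_derive1_unique (sm_is_ds (sm_dot sA sB) Op) D.
Qed.

Lemma dt_dot O n A B p : smv O n.+1 A -> smv O n.+1 B -> O p ->
  dt (fun q => dot (A q) (B q)) p = dot (vt A p) (B p) + dot (A p) (vt B p).
Proof.
move=> sA sB Op.
have DA i : is_derive p.2 1 (fun x => A (p.1, x) 0 i) (vt A p 0 i).
  by rewrite vtE; exact: (sm_is_dt (sA i) Op).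
have DB i : is_derive p.2 1 (fun x => B (p.1, x) 0 i) (vt B p 0 i).
  by rewrite vtE; exact: (sm_is_dt (sB i) Op).
have := is_derive_dot3 DA DB; rewrite -surjective_pairing => D.
exact: is_derive1_unique (sm_is_dt (sm_dot sA sB) Op) D.
Qed.

Lemma smv_cross O n A B : smv O n A -> smv O n B -> smv O n (fun q => crs (A q) (B q)).
Proof.
move=> sA sB -[[|[|[|//]]] Hi].
- rewrite (_ : (fun _ => _) = fun q => A q 0 1 * B q 0 2%:R - A q 0 2%:R * B q 0 1); last first.
    by apply/funext => q; rewrite unlock mxE.
  by apply: sm_sub; apply: sm_mul.
- rewrite (_ : (fun _ => _) = fun q => A q 0 2%:R * B q 0 0 - A q 0 0 * B q 0 2%:R); last first.
    by apply/funext => q; rewrite unlock mxE.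
  by apply: sm_sub; apply: sm_mul.
- rewrite (_ : (fun _ => _) = fun q => A q 0 0 * B q 0 1 - A q 0 1 * B q 0 0); last first.
    by apply/funext => q; rewrite unlock mxE.
  by apply: sm_sub; apply: sm_mul.
Qed.

Lemma smv_scale O n f A : sm O n f -> smv O n A -> smv O n (fun q => f q *: A q).
Proof.
move=> sf sA i; have -> : (fun q => (f q *: A q) 0 i) = (fun q => f q * A q 0 i).
  by apply/funext => q; rewrite mxE.
exact: sm_mul.
Qed.

Lemma vs_ext O A B p : open O -> (forall q, O q -> A q = B q) -> O p -> vs A p = vs B p.
Proof.
move=> oO AB Op; apply/rowP => i; rewrite !vsE; apply: (ds_ext oO) => // q Oq.
by rewrite AB.
Qed.

Lemma vt_ext O A B p : open O -> (forall q, O q -> A q = B q) -> O p -> vt A p = vt B p.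
Proof.
move=> oO AB Op; apply/rowP => i; rewrite !vtE; apply: (dt_ext oO) => // q Oq.
by rewrite AB.
Qed.

Lemma vschwarz O A p : open O -> smv O 2 A -> O p -> vt (vs A) p = vs (vt A) p.
Proof.
move=> oO sA Op; apply/rowP => i; rewrite vtE vsE.
have -> : (fun q => vs A q 0 i) = ds (fun q => A q 0 i) by apply/funext => q; rewrite vsE.
have -> : (fun q => vt A q 0 i) = dt (fun q => A q 0 i) by apply/funext => q; rewrite vtE.
exact: schwarz (sA i) Op.
Qed.

Lemma vsN O n A p : smv O n.+1 A -> O p -> vs (fun q => - A q) p = - vs A p.
Proof.
move=> sA Op; apply/rowP => i; rewrite [RHS]mxE !vsE.
have D := is_derive1N (sm_is_ds (sA i) Op).
have sN : sm O n.+1 (fun q => (- A q) 0 i).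
  rewrite (_ : (fun _ => _) = fun q => - A q 0 i); first exact: sm_opp.
  by apply/funext => q; rewrite mxE.
apply: is_derive1_unique (sm_is_ds sN Op) _.
by apply: is_derive1_ext D => y; rewrite mxE.
Qed.

Lemma ds_periodic f (P : R) : (forall s t, f (s, t + P) = f (s, t)) ->
  forall s t, ds f (s, t + P) = ds f (s, t).
Proof.
move=> fP s t; rewrite unlock /=.
by have -> : (fun x : R => f (x, t + P)) = (fun x => f (x, t)) by apply/funext => x; exact: fP.
Qed.

Lemma dt_periodic f (P : R) : (forall s t, f (s, t + P) = f (s, t)) ->
  forall s t, dt f (s, t + P) = dt f (s, t).
Proof.
move=> fP s t; rewrite unlock /derive /=; congr (lim _).
have -> : (fun h : R => h^-1 *: (f (s, h *: 1 + (t + P)) - f (s, t + P))) =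
  (fun h : R => h^-1 *: (f (s, h *: 1 + t) - f (s, t))) => //.
by apply/funext => h; rewrite addrA !fP.
Qed.

Lemma vs_periodic A (P : R) : (forall s t, A (s, t + P) = A (s, t)) ->
  forall s t, vs A (s, t + P) = vs A (s, t).
Proof.
move=> AP s t; apply/rowP => i; rewrite !vsE.
by rewrite (@ds_periodic (fun q => A q 0 i)) // => x y; rewrite AP.
Qed.

Lemma vt_periodic A (P : R) : (forall s t, A (s, t + P) = A (s, t)) ->
  forall s t, vt A (s, t + P) = vt A (s, t).
Proof.
move=> AP s t; apply/rowP => i; rewrite !vtE.
by rewrite (@dt_periodic (fun q => A q 0 i)) // => x y; rewrite AP.
Qed.

Lemma ds_zero_on O f p : open O -> (forall q, O q -> f q = 0) -> O p -> ds f p = 0.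
Proof.
move=> oO f0 Op; rewrite (ds_ext oO f0 Op).
by apply: is_ds; exact: is_derive_cst.
Qed.

Lemma dt_zero_on O f p : open O -> (forall q, O q -> f q = 0) -> O p -> dt f p = 0.
Proof.
move=> oO f0 Op; rewrite (dt_ext oO f0 Op).
by apply: is_dt; exact: is_derive_cst.
Qed.

End VectorFields.

(** * Functions on a strip: constancy, sign, periodicity and the maximum principle *)

Section StripFunctions.
Variables (R : realType) (L P : R) (O : set (R * R)).
Hypotheses (L_gt0 : 0 < L) (P_gt0 : 0 < P) (oO : open O).
Hypothesis SO : forall p : R * R, 0 <= p.1 <= L -> O p.
Local Notation I := [set p : R * R | 0 < p.1 < L].

Lemma strip_open : open (I : set (R * R)).
Proof.
have -> : (I : set (R * R)) = fst @^-1` `]0, L[%classic.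
  by apply/seteqP; split => p; rewrite /= in_itv.
by apply: open_comp; [move=> p _; exact: cvg_fst|exact: interval_open].
Qed.

Lemma strip_sub p : I p -> O p.
Proof. by move=> /andP[h1 h2]; apply: SO; rewrite !ltW. Qed.

Lemma strip_closure (f : R * R -> R) : (forall p, O p -> {for p, continuous f}) ->
  (forall p, I p -> f p = 0) -> forall p, 0 <= p.1 <= L -> f p = 0.
Proof.
move=> cf f0 p pS; apply/eqP; case: (eqVneq (f p) 0) => // fp0; exfalso.
have n0 : 0 < `|f p| by rewrite normr_gt0.
have /box_nbhs[e e0 He] := continuous_dist_lt (cf _ (SO pS)) n0.
have [x xI xe] : exists2 x, 0 < x < L & `|x - p.1| < e.
  case: p pS {fp0 n0 He} => s t /= /andP[s0 sL].
  (* Moving by the fraction [th] of the way to the midline [L / 2] enters the open strip even from a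
     boundary line, and the second bound keeps the displacement below [e]. *)
  pose th := Num.min 2^-1 (e / (2 * L)).
  have th0 : 0 < th by rewrite lt_min invr_gt0 ltr0n /= divr_gt0 // mulr_gt0.
  have th1 : th <= 2^-1 by rewrite ge_min lexx.
  have th2 : th * L <= e / 2.
    have : th <= e / (2 * L) by rewrite ge_min lexx orbT.
    by rewrite ler_pdivlMr ?mulr_gt0 //; lra.
  clearbody th; have L0 := L_gt0.
  exists (s + th * (L / 2 - s)); first by apply/andP; split; nra.
  by rewrite (addrC s) addrK ltr_norml; apply/andP; split; nra.
have := He x p.2 xe; rewrite subrr normr0 => /(_ e0) /=.
by rewrite (f0 (x, p.2)) // subr0 ltxx.
Qed.

Lemma strip_const (f : R * R -> R) : sm O 1 f ->
  (forall p, I p -> ds f p = 0) -> (forall p, I p -> dt f p = 0) ->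
  exists k, forall p, 0 <= p.1 <= L -> f p = k.
Proof.
move=> sf fs ft; pose c := (L / 2, 0 : R); exists (f c).
have Ic t : I (L / 2, t) by have := L_gt0; rewrite /= => L0; apply/andP; split; lra.
suff H p : I p -> f p = f c.
  move=> p pS; apply/eqP; rewrite -subr_eq0; apply/eqP.
  apply: (strip_closure (f := fun p => f p - f c)) => // [q Oq|q Iq].
    by apply: continuousB; [exact: sm_continuous sf Oq|exact: cvg_cst].
  by rewrite H // subrr.
case: p => s t /= Ip.
have xI x : Num.min (L / 2) s <= x <= Num.max (L / 2) s -> 0 < x < L.
  have /andP[h1 h2] := Ip; have /andP[h3 h4] := Ic t; move=> /andP[h5 h6].
  by rewrite (lt_le_trans _ h5) ?lt_min ?h1 ?h3 // (le_lt_trans h6) // gt_max h4 h2.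
have -> : f (s, t) = f (L / 2, t).
  apply/eqP; rewrite -subr_eq0; apply/eqP.
  have [x xb|x xb ->] := @mean_value_between R (fun x => f (x, t)) (fun x => ds f (x, t)) (L / 2) s.
    by have := @sm_is_ds R O 0 f (x, t) sf; apply; apply: strip_sub; exact: xI.
  by rewrite fs ?mul0r //=; exact: xI.
apply/eqP; rewrite -subr_eq0; apply/eqP.
have [x xb|x xb ->] := @mean_value_between R (fun x => f (L / 2, x)) (fun x => dt f (L / 2, x)) 0 t.
  by have := @sm_is_dt R O 0 f (L / 2, x) sf; apply; apply: strip_sub.
by rewrite ft ?mul0r.
Qed.

(** The strip is convex, so the intermediate value theorem along a segment applies. *)
Lemma strip_sign (f : R * R -> R) : (forall p, O p -> {for p, continuous f}) ->
  (forall p, 0 <= p.1 <= L -> f p != 0) ->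
  forall p q, 0 <= p.1 <= L -> 0 <= q.1 <= L -> 0 < f p -> 0 < f q.
Proof.
move=> cf f0.
have line (h : R -> R * R) : continuous h -> (forall x, 0 <= x <= 1 -> 0 <= (h x).1 <= L) ->
    0 < f (h 0) -> 0 < f (h 1).
  move=> ch hS p0; rewrite ltNge; apply/negP => p1.
  have [|||z] := @IVT R (f \o h) 0 1 0; first exact: ler01.
  - apply: continuous_in_subspaceT => x /[!inE] /=; rewrite in_itv /= => x01.
    by apply: continuous_comp; [exact: ch|apply: cf; apply: SO; exact: hS].
  - by rewrite /= ge_min p1 orbT le_max (ltW p0).
  - by rewrite in_itv /= => z01 fz; have := f0 _ (hS _ z01); rewrite fz eqxx.
move=> [s t] [s' t'] /= pS qS fp.
have := line (fun x => (s + x * (s' - s), t + x * (t' - t))).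
rewrite !mul0r !mul1r !addr0 (addrC s (s' - s)) (addrC t (t' - t)) !subrK; apply => //.
  have lin (a b : R) : continuous (fun y : R => a + y * b).
    move=> y; have := is_derive1D (is_derive_cst a y (1 : R))
      (is_derive1M (is_derive_id y (1 : R)) (is_derive_cst b y (1 : R))).
    by move=> /is_derive1_continuous.
  by move=> x; exact: cvg_pair (lin s (s' - s) x) (lin t (t' - t) x).
move=> x /andP[x0 x1] /=; move: pS qS => /andP[? ?] /andP[? ?].
by apply/andP; split; nra.
Qed.

Lemma period_reduce (t : R) : exists k : int, 0 <= t + k%:~R * P <= P.
Proof.
exists (- Num.floor (t / P)).
have /andP[h1 h2] := mem_rg1_floor (t / P).
have E : (Num.floor (t / P))%:~R * P <= t by rewrite -ler_pdivlMr.
have E' : t < ((Num.floor (t / P))%:~R + 1) * P by rewrite -ltr_pdivrMr.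
by rewrite mulrNz mulNr; apply/andP; split; lra.
Qed.

Lemma periodic_int (T : Type) (f : R * R -> T) : (forall s t, f (s, t + P) = f (s, t)) ->
  forall (k : int) s t, f (s, t + k%:~R * P) = f (s, t).
Proof.
move=> fP; have N (n : nat) s t : f (s, t + n%:R * P) = f (s, t).
  elim: n => [|n IH]; first by rewrite mul0r addr0.
  by rewrite -natr1 mulrDl mul1r addrA fP.
case=> n s t; first exact: N.
by rewrite -(N n.+1 s (t + _)) NegzE mulrNz mulNr -addrA (addrC (- _)) subrr addr0.
Qed.

(** Periodicity supplies compactness. Adding [eps * p.1 ^+ 2] makes the Laplacian strictly positive,
    which rules out an interior maximum, where both second derivatives are nonpositive. *)
Lemma strip_max_principle (v : R * R -> R) : sm O 2 v ->
  (forall s t, v (s, t + P) = v (s, t)) ->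
  (forall p, I p -> 0 <= ds (ds v) p + dt (dt v) p) ->
  exists p0, (p0.1 = 0 \/ p0.1 = L) /\ forall p, 0 <= p.1 <= L -> v p <= v p0.
Proof.
move=> sv vP lap.
pose K := (`[0, L] `*` `[0, P])%classic : set (R * R).
pose B := ([set 0; L] `*` `[0, P])%classic : set (R * R).
have cK : compact K by apply: compact_setX; exact: segment_compact.
have cB : compact B.
  apply: compact_setX; last exact: segment_compact.
  by apply: compactU; exact: compact_set1.
have L0 : 0 <= L by exact: ltW.
have BS p : B p -> 0 <= p.1 <= L.
  by move=> [[]/= -> _]; rewrite ?lexx ?L0.
have KS p : K p -> 0 <= p.1 <= L by move=> [/=]; rewrite in_itv.
have P0 : 0 <= P by exact: ltW.
have cv (u : R * R -> R) A : (forall p, O p -> {for p, continuous u}) ->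
    (forall p, A p -> 0 <= p.1 <= L) -> {within A, continuous u}.
  by move=> cu AS; apply: continuous_in_subspaceT => p /[!inE] /AS /SO; exact: cu.
have cvv p : O p -> {for p, continuous v} by exact: sm_continuous sv.
have [||p0 /[!inE] Bp0 Hp0] := @compact_EVT_max _ R v B _ cB.
- by exists (0, 0); split=> /=; [left|rewrite in_itv /= lexx].
- exact: cv.
exists p0; split; first by case: Bp0 => -[] /= ->; [left|right].
move=> p1 p1S; rewrite leNgt; apply/negP => vp.
(* Over the strip [p.1 ^+ 2 <= L ^+ 2], so the correction consumes only half of the assumed excess
   of [v p1] over the boundary maximum. *)
pose eps := (v p1 - v p0) / (2 * (L ^+ 2)).
have L2 : 0 < L ^+ 2 by rewrite exprn_gt0.
have eps0 : 0 < eps by rewrite divr_gt0 ?subr_gt0 // mulr_gt0.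
have epsL : eps * L ^+ 2 = (v p1 - v p0) / 2.
  by rewrite /eps; field; rewrite gt_eqF.
pose u p := v p + eps * (p.1 * p.1).
have sq : sm O 2 (fun p : R * R => p.1).
  split; first by move=> p _; exact: cvg_fst.
  exists (fun=> 1), (fun=> 0); split.
  - by move=> p _ /=; exact: is_derive_id.
  - by move=> p _ /=; exact: is_derive_cst.
  - exact: sm_cst.
  - exact: sm_cst.
have su : sm O 2 u by apply: sm_add => //; apply: sm_mul; [exact: sm_cst|exact: sm_mul].
have uP s t : u (s, t + P) = u (s, t) by rewrite /u vP.
have cu p : O p -> {for p, continuous u} by exact: sm_continuous su.
have [||p2 /[!inE] Kp2 Hp2] := @compact_EVT_max _ R u K _ cK.
- by exists (0, 0); split=> /=; rewrite in_itv /= ?lexx.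
- exact: cv.
have red p : 0 <= p.1 <= L -> exists2 q, K q & u q = u p /\ q.1 = p.1 /\ v q = v p.
  case: p => s t /= sS; have [k kP] := period_reduce t.
  exists (s, t + k%:~R * P); first by split; rewrite /= in_itv.
  by split; [exact: periodic_int|split=> //; exact: periodic_int].
have umax p : 0 <= p.1 <= L -> u p <= u p2.
  by move=> pS; have [q Kq [<- _]] := red _ pS; apply: Hp2; exact: mem_set.
have vB p : B p -> v p <= v p0 by move=> Bp; apply: Hp0; exact: mem_set.
have usq p : 0 <= p.1 <= L -> u p <= v p + (v p1 - v p0) / 2.
  move=> /andP[h1 h2]; rewrite /u -epsL; have : p.1 * p.1 <= L ^+ 2 by nra.
  by move=> h; have := ler_wpM2l (ltW eps0) h; lra.
have ivp : v p1 <= u p1 by rewrite /u lerDl mulr_ge0 ?(ltW eps0) // -expr2 sqr_ge0.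
have p2I : I p2.
  have /andP[h1 h2] := KS _ Kp2; have [_ h3] := Kp2.
  have bd : ~ B p2.
    move=> Bp2; have := vB _ Bp2; have := usq _ (BS _ Bp2); have := umax _ p1S.
    by clear -ivp vp; lra.
  by apply/andP; split; rewrite lt_neqAle ?h1 ?h2 andbT; apply/eqP => h; apply: bd;
    split=> //; [left|right].
have Op2 := strip_sub p2I.
have sus := sm_ds oO su; have sut := sm_dt oO su.
have n1 : ds (ds u) p2 <= 0.
  apply: (@local_max_derive2_le0 R (fun x => u (x, p2.2)) (fun x => ds u (x, p2.2)) p2.1).
  - have := open_fst oO Op2; apply: filterS => x Ox.
    exact: (@sm_is_ds R O 1 u (x, p2.2) su Ox).
  - exact: sm_is_ds sus Op2.
  - have := open_fst strip_open p2I; apply: filterS => x /= /andP[h1 h2].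
    by rewrite -surjective_pairing; apply: umax; rewrite /= !ltW.
have n2 : dt (dt u) p2 <= 0.
  apply: (@local_max_derive2_le0 R (fun x => u (p2.1, x)) (fun x => dt u (p2.1, x)) p2.2).
  - have := open_snd oO Op2; apply: filterS => x Ox.
    exact: (@sm_is_dt R O 1 u (p2.1, x) su Ox).
  - exact: sm_is_dt sut Op2.
  - apply/nbhs_ballP; exists 1 => //= x _; rewrite -surjective_pairing; apply: umax.
    by move: p2I => /= /andP[h1 h2]; rewrite !ltW.
have d1 p : O p -> ds u p = ds v p + 2 * eps * p.1.
  move=> Op.
  have D1 : is_derive p.1 1 (fun x : R => x) (1 : R) by exact: is_derive_id.
  have D2 := is_derive1M (is_derive_cst eps p.1 (1 : R)) (is_derive1M D1 D1).
  have D3 := is_derive1D (sm_is_ds sv Op) D2.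
  by rewrite (is_derive1_unique (sm_is_ds su Op) D3) /=; ring.
have d2 : ds (ds u) p2 = ds (ds v) p2 + 2 * eps.
  rewrite (ds_ext oO d1 Op2).
  have D1 : is_derive p2.1 1 (fun x : R => x) (1 : R) by exact: is_derive_id.
  have D2 := is_derive1M (is_derive_cst (2 * eps) p2.1 (1 : R)) D1.
  have D3 := is_derive1D (sm_is_ds (sm_ds oO sv) Op2) D2.
  have sx : sm O 1 (fun q => ds v q + 2 * eps * q.1).
    apply: sm_add; first exact: sm_ds.
    by apply: sm_mul; [exact: sm_cst|exact: smS].
  by rewrite (is_derive1_unique (sm_is_ds sx Op2) D3) /=; ring.
have d3 : dt (dt u) p2 = dt (dt v) p2.
  apply: (dt_ext oO) Op2 => q Oq.
  have D2 := is_derive1D (sm_is_dt sv Oq) (is_derive_cst (eps * (q.1 * q.1)) q.2 (1 : R)).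
  by rewrite (is_derive1_unique (sm_is_dt su Oq) D2) addr0.
have key (x y e : R) : 0 < e -> x + 2 * e <= 0 -> y <= 0 -> 0 <= x + y -> False by lra.
by rewrite d2 in n1; rewrite d3 in n2; exact: key eps0 n1 n2 (lap _ p2I).
Qed.

End StripFunctions.

(** * Inverse function theorem in the plane *)

Section LocalHomeo.
Variable R : realType.
Local Notation pt := (R * R)%type.

Lemma nbhs_box (p : pt) (A : set pt) (e : R) : 0 < e ->
  (forall x y, `|x - p.1| < e -> `|y - p.2| < e -> A (x, y)) -> nbhs p A.
Proof.
move=> e0 H; apply/nbhs_ballP; exists e => // -[x y] [/= h1 h2].
by apply: H; rewrite distrC.
Qed.

Section Normalized.
Variables (O : set pt) (h1 h2 : pt -> R) (p : pt) (e : R).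
Hypotheses (sh1 : sm O 1 h1) (sh2 : sm O 1 h2) (e_gt0 : 0 < e).
Hypothesis boxO : forall x y, `|x - p.1| < e -> `|y - p.2| < e -> O (x, y).
Hypothesis near_id : forall x y, `|x - p.1| < e -> `|y - p.2| < e ->
  [/\ `|ds h1 (x, y) - 1| <= 1 / 4, `|dt h1 (x, y)| <= 1 / 4,
      `|ds h2 (x, y)| <= 1 / 4 & `|dt h2 (x, y) - 1| <= 1 / 4].

Let btw (a b c z : R) : `|a - c| < e -> `|b - c| < e ->
  Num.min a b <= z <= Num.max a b -> `|z - c| < e.
Proof.
rewrite !ltr_norml => /andP[a1 a2] /andP[b1 b2] /andP[].
by case: (leP a b) => _ z1 z2; apply/andP; split; lra.
Qed.

Let increment h : sm O 1 h -> forall x y x' y', `|x - p.1| < e -> `|y - p.2| < e ->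
  `|x' - p.1| < e -> `|y' - p.2| < e -> exists a b c d,
  [/\ `|a - p.1| < e, `|b - p.2| < e, `|c - p.1| < e, `|d - p.2| < e &
   h (x', y') - h (x, y) = ds h (a, b) * (x' - x) + dt h (c, d) * (y' - y)].
Proof.
move=> sh x y x' y' hx hy hx' hy'.
have [z zb|z zb E1] := @mean_value_between R (fun z => h (z, y')) (fun z => ds h (z, y')) x x'.
  by have := @sm_is_ds R O 0 h (z, y') sh; apply; apply: boxO => //; exact: btw zb.
have [u ub|u ub E2] := @mean_value_between R (fun z => h (x, z)) (fun z => dt h (x, z)) y y'.
  by have := @sm_is_dt R O 0 h (x, u) sh; apply; apply: boxO => //; exact: btw ub.
exists z, y', x, u; split=> //; [exact: btw zb|exact: btw ub|].
by rewrite -E1 -E2; move: (h (x', y')) (h (x, y')) (h (x, y)) => A B C; ring.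
Qed.

(** For the coordinate with the larger increment the diagonal term contributes at least 3/4 of it
    and the other at most 1/4, so at least half remains: hence the factor 2. The disjunctions stand
    for the sup norm. *)
Lemma box_expansion x y x' y' : `|x - p.1| < e -> `|y - p.2| < e ->
  `|x' - p.1| < e -> `|y' - p.2| < e ->
  (`|x' - x| <= 2 * `|h1 (x', y') - h1 (x, y)| \/ `|x' - x| <= 2 * `|h2 (x', y') - h2 (x, y)|)
  /\ (`|y' - y| <= 2 * `|h1 (x', y') - h1 (x, y)| \/ `|y' - y| <= 2 * `|h2 (x', y') - h2 (x, y)|).
Proof.
move=> hx hy hx' hy'.
have [a [b [c [d [ha hb hc hd E1]]]]] := increment sh1 hx hy hx' hy'.
have [a' [b' [c' [d' [ha' hb' hc' hd' E2]]]]] := increment sh2 hx hy hx' hy'.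
have [m1 _ _ _] := near_id ha hb; have [_ m2 _ _] := near_id hc hd.
have [_ _ m3 _] := near_id ha' hb'; have [_ _ _ m4] := near_id hc' hd'.
rewrite E1 E2; move: m1 m2 m3 m4; clear.
move: (ds h1 (a, b)) (dt h1 (c, d)) (ds h2 (a', b')) (dt h2 (c', d')) (x' - x) (y' - y).
move=> k1 k2 k3 k4 u v m1 m2 m3 m4.
have big (k l s t : R) : `|k - 1| <= 1 / 4 -> `|l| <= 1 / 4 -> `|t| <= `|s| ->
    `|s| <= 2 * `|k * s + l * t|.
  move=> hk hl ts; have := ler_normD (k * s + l * t) (- (l * t)).
  have := ler_normD (k * s) (s - k * s).
  rewrite addrK normrN normrM (addrCA (k * s)) subrr addr0.
  have -> : s - k * s = - ((k - 1) * s) by ring.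
  rewrite normrN normrM [`|l * t|]normrM.
  have := ler_pM (normr_ge0 _) (normr_ge0 _) hl ts.
  have := ler_wpM2r (normr_ge0 s) hk; lra.
have [uv|vu] := leP `|v| `|u|.
- have H := big _ _ _ _ m1 m2 uv; split; left => //.
  exact: le_trans uv H.
- have H := big _ _ _ _ m4 m3 (ltW vu); rewrite addrC in H; split; right => //.
  exact: le_trans (ltW vu) H.
Qed.

Lemma box_injective x y x' y' : `|x - p.1| < e -> `|y - p.2| < e ->
  `|x' - p.1| < e -> `|y' - p.2| < e -> h1 (x', y') = h1 (x, y) -> h2 (x', y') = h2 (x, y) ->
  (x', y') = (x, y).
Proof.
move=> hx hy hx' hy' e1 e2; have := box_expansion hx hy hx' hy'.
rewrite e1 e2 !subrr normr0 mulr0 !normr_le0 !subr_eq0 => -[h h'].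
have /eqP -> : x' == x by case: h.
by have /eqP -> : y' == y by case: h'.
Qed.

(* The target is hit at a minimiser of the squared distance to it. *)
Lemma box_surjective r : 0 < r < e -> forall w1 w2,
  `|w1 - h1 p| <= r / 8 -> `|w2 - h2 p| <= r / 8 ->
  exists q, [/\ `|q.1 - p.1| <= r, `|q.2 - p.2| <= r, h1 q = w1 & h2 q = w2].
Proof.
move=> /andP[r0 re] w1 w2 hw1 hw2.
pose D q := (h1 q - w1) * (h1 q - w1) + (h2 q - w2) * (h2 q - w2).
have sD : sm O 1 D.
  by apply: sm_add; apply: sm_mul; apply: sm_sub => //; exact: sm_cst.
pose K := (`[p.1 - r, p.1 + r] `*` `[p.2 - r, p.2 + r])%classic : set pt.
have Kb x y : K (x, y) <-> `|x - p.1| <= r /\ `|y - p.2| <= r.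
  rewrite /K /= !in_itv /= !ler_norml; split=> -[/andP[? ?] /andP[? ?]].
    by split; apply/andP; split; lra.
  by split; apply/andP; split; lra.
have pp (x : R) : `|x - x| <= r by rewrite subrr normr0 ltW.
have [|||[x y] /[!inE] /Kb[kx ky] Hq] := @compact_EVT_min _ R D K.
- by exists p; case: p Kb pp => a b Kb pp; apply/Kb; split; exact: pp.
- by apply: compact_setX; exact: segment_compact.
- apply: continuous_in_subspaceT => -[x y] /[!inE] /Kb[kx ky].
  by apply: (sm_continuous sD); apply: boxO; exact: le_lt_trans re.
have hx : `|x - p.1| < e by exact: le_lt_trans re.
have hy : `|y - p.2| < e by exact: le_lt_trans re.
have Oxy : O (x, y) by exact: boxO.
have Dmin x' y' : `|x' - p.1| <= r -> `|y' - p.2| <= r -> D (x, y) <= D (x', y').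
  by move=> kx' ky'; apply: Hq; apply: mem_set; apply/Kb.
have pe (z : R) : `|z - z| < e by rewrite subrr normr0.
have Dp : D p <= r ^+ 2 / 32.
  rewrite /D; move: hw1 hw2; rewrite !ler_norml => /andP[? ?] /andP[? ?].
  have sq (A w : R) : - (r / 8) <= w - A -> w - A <= r / 8 -> (A - w) * (A - w) <= r ^+ 2 / 64 by nra.
  have q1 : (h1 p - w1) * (h1 p - w1) <= r ^+ 2 / 64 by apply: sq.
  have q2 : (h2 p - w2) * (h2 p - w2) <= r ^+ 2 / 64 by apply: sq.
  by have -> : r ^+ 2 / 32 = r ^+ 2 / 64 + r ^+ 2 / 64 by [field]; exact: lerD.
have Dxy : D (x, y) <= D p.
  by rewrite [X in _ <= D X]surjective_pairing; apply: Dmin; exact: pp.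
(* The value at the minimiser is within [r / sqrt 32] of the target in each component, and the
   target within [r / 8] of the value at [p]. The sum is below [r / 2], so the expansion estimate
   keeps the minimiser off the edge of the square. *)
have strict : `|x - p.1| < r /\ `|y - p.2| < r.
  have := box_expansion (pe p.1) (pe p.2) hx hy; rewrite -surjective_pairing.
  have small (h w hp : R) : (h - w) * (h - w) <= r ^+ 2 / 32 -> `|w - hp| <= r / 8 ->
      2 * `|h - hp| < r.
    move=> m1; rewrite ler_norml => /andP[? ?].
    have : `|h - hp| < r / 2 by rewrite ltr_norml; apply/andP; split; nra.
    lra.
  have D32 : D (x, y) <= r ^+ 2 / 32 by exact: le_trans Dxy Dp.
  have s1 : 2 * `|h1 (x, y) - h1 p| < r.
    apply: small hw1; apply: le_trans D32; rewrite /D lerDl -expr2; exact: sqr_ge0.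
  have s2 : 2 * `|h2 (x, y) - h2 p| < r.
    apply: small hw2; apply: le_trans D32; rewrite /D lerDr -expr2; exact: sqr_ge0.
  by move=> [g g']; split; [case: g|case: g'] => h; first [exact: le_lt_trans h s1|exact: le_lt_trans h s2].
have [sx sy] := strict.
have nearx : \forall z \near x, `|z - p.1| <= r.
  apply/nbhs_ballP; exists (r - `|x - p.1|); first by rewrite /= subr_gt0.
  move=> z; rewrite /ball /= distrC => hz.
  have := ler_normD (z - x) (x - p.1); rewrite subrKA; lra.
have neary : \forall z \near y, `|z - p.2| <= r.
  apply/nbhs_ballP; exists (r - `|y - p.2|); first by rewrite /= subr_gt0.
  move=> z; rewrite /ball /= distrC => hz.
  have := ler_normD (z - y) (y - p.2); rewrite subrKA; lra.
have A1 := sm_is_ds sh1 Oxy; have A2 := sm_is_ds sh2 Oxy.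
have B1 := sm_is_dt sh1 Oxy; have B2 := sm_is_dt sh2 Oxy.
have key (a b c d : R) : - (c * a + a * c + (d * b + b * d)) = 0 -> a * c + b * d = 0 by lra.
have E1 : (h1 (x, y) - w1) * ds h1 (x, y) + (h2 (x, y) - w2) * ds h2 (x, y) = 0.
  have C1 := is_derive1B A1 (is_derive_cst w1 x (1 : R)).
  have C2 := is_derive1B A2 (is_derive_cst w2 x (1 : R)).
  have DD := is_derive1N (is_derive1D (is_derive1M C1 C1) (is_derive1M C2 C2)).
  have := local_max_derive_eq0 DD; rewrite /= !subr0 => H.
  apply: key; apply: H; apply: filterS nearx => z hz; rewrite lerN2; exact: Dmin.
have E2 : (h1 (x, y) - w1) * dt h1 (x, y) + (h2 (x, y) - w2) * dt h2 (x, y) = 0.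
  have C1 := is_derive1B B1 (is_derive_cst w1 y (1 : R)).
  have C2 := is_derive1B B2 (is_derive_cst w2 y (1 : R)).
  have DD := is_derive1N (is_derive1D (is_derive1M C1 C1) (is_derive1M C2 C2)).
  have := local_max_derive_eq0 DD; rewrite /= !subr0 => H.
  apply: key; apply: H; apply: filterS neary => z hz; rewrite lerN2; exact: Dmin.
exists (x, y); rewrite /=; have [m1 m2 m3 m4] := near_id hx hy.
(* [E1] and [E2] say that the transposed Jacobian kills the error vector; its determinant is
   positive since the Jacobian is close to the identity. *)
have [z1 z2] : h1 (x, y) - w1 = 0 /\ h2 (x, y) - w2 = 0.
  move: (h1 (x, y) - w1) (h2 (x, y) - w2) (ds h1 (x, y)) (ds h2 (x, y)) (dt h1 (x, y))
    (dt h2 (x, y)) E1 E2 m1 m2 m3 m4; clear.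
  move=> u v k l k' l' E1 E2; rewrite !ler_norml => /andP[? ?] /andP[? ?] /andP[? ?] /andP[? ?].
  have det : 0 < k * l' - l * k' by nra.
  have u0 : u * (k * l' - l * k') = 0.
    have -> : u * (k * l' - l * k') = l' * (u * k + v * l) - l * (u * k' + v * l') by ring.
    by rewrite E1 E2 !mulr0 subrr.
  have v0 : v * (k * l' - l * k') = 0.
    have -> : v * (k * l' - l * k') = k * (u * k' + v * l') - k' * (u * k + v * l) by ring.
    by rewrite E1 E2 !mulr0 subrr.
  have dn : k * l' - l * k' != 0 by rewrite gt_eqF.
  by split; apply: (mulIf dn); rewrite mul0r.
by split=> //; apply/eqP; rewrite -subr_eq0; apply/eqP.
Qed.

End Normalized.

Variables (O : set pt) (f1 f2 : pt -> R) (p : pt).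
Hypotheses (oO : open O) (s1 : sm O 1 f1) (s2 : sm O 1 f2) (Op : O p).
Hypothesis det_neq0 : ds f1 p * dt f2 p - dt f1 p * ds f2 p != 0.

(* [h1], [h2] are the components of [(Df_p)^-1 o f]. *)
Let D := ds f1 p * dt f2 p - dt f1 p * ds f2 p.
Let h1 q := dt f2 p / D * f1 q - dt f1 p / D * f2 q.
Let h2 q := ds f1 p / D * f2 q - ds f2 p / D * f1 q.

Let lin_ds (a b : R) (f g : pt -> R) q : sm O 1 f -> sm O 1 g -> O q ->
  ds (fun q => a * f q - b * g q) q = a * ds f q - b * ds g q.
Proof.
move=> sf sg Oq; apply: is_ds.
have := is_derive1B (is_derive1M (is_derive_cst a q.1 (1 : R)) (sm_is_ds sf Oq))
  (is_derive1M (is_derive_cst b q.1 (1 : R)) (sm_is_ds sg Oq)).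
by rewrite !mul0r !add0r.
Qed.

Let lin_dt (a b : R) (f g : pt -> R) q : sm O 1 f -> sm O 1 g -> O q ->
  dt (fun q => a * f q - b * g q) q = a * dt f q - b * dt g q.
Proof.
move=> sf sg Oq; apply: is_dt.
have := is_derive1B (is_derive1M (is_derive_cst a q.2 (1 : R)) (sm_is_dt sf Oq))
  (is_derive1M (is_derive_cst b q.2 (1 : R)) (sm_is_dt sg Oq)).
by rewrite !mul0r !add0r.
Qed.

Let sh1 : sm O 1 h1.
Proof. by apply: sm_sub; apply: sm_mul => //; exact: sm_cst. Qed.
Let sh2 : sm O 1 h2.
Proof. by apply: sm_sub; apply: sm_mul => //; exact: sm_cst. Qed.

Let good_box : exists2 e : R, 0 < e & forall x y, `|x - p.1| < e -> `|y - p.2| < e ->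
  O (x, y) /\ [/\ `|ds h1 (x, y) - 1| <= 1 / 4, `|dt h1 (x, y)| <= 1 / 4,
      `|ds h2 (x, y)| <= 1 / 4 & `|dt h2 (x, y) - 1| <= 1 / 4].
Proof.
have q0 : (0 : R) < 1 / 4 by lra.
have v1 : ds h1 p = 1.
  rewrite lin_ds // /D; move: det_neq0; move: (ds f1 p) (dt f1 p) (ds f2 p) (dt f2 p) => a b c d h.
  by field.
have v2 : dt h1 p = 0.
  rewrite lin_dt // /D; move: det_neq0; move: (ds f1 p) (dt f1 p) (ds f2 p) (dt f2 p) => a b c d h.
  by field.
have v3 : ds h2 p = 0.
  rewrite lin_ds // /D; move: det_neq0; move: (ds f1 p) (dt f1 p) (ds f2 p) (dt f2 p) => a b c d h.
  by field.
have v4 : dt h2 p = 1.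
  rewrite lin_dt // /D; move: det_neq0; move: (ds f1 p) (dt f1 p) (ds f2 p) (dt f2 p) => a b c d h.
  by field.
have [e0 e00 H0] := box_nbhs (open_nbhs_nbhs (conj oO Op)).
have cont g : sm O 0 g -> exists2 e : R, 0 < e & forall x y, `|x - p.1| < e -> `|y - p.2| < e ->
    `|g (x, y) - g p| <= 1 / 4.
  move=> sg; have [e e1 H] := box_nbhs (continuous_dist_lt (sm_continuous sg Op) q0).
  by exists e => // x y hx hy; rewrite distrC ltW // H.
have [e1 e10 H1] := cont _ (sm_ds oO sh1); have [e2 e20 H2] := cont _ (sm_dt oO sh1).
have [e3 e30 H3] := cont _ (sm_ds oO sh2); have [e4 e40 H4] := cont _ (sm_dt oO sh2).
exists (Num.min e0 (Num.min (Num.min e1 e2) (Num.min e3 e4))).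
  by rewrite !lt_min e00 e10 e20 e30.
move=> x y; rewrite !lt_min => /and3P[x0 /andP[x1 x2] /andP[x3 x4]].
move=> /and3P[y0 /andP[y1 y2] /andP[y3 y4]]; split; first exact: H0.
by split; [have := H1 _ _ x1 y1; rewrite v1|have := H2 _ _ x2 y2; rewrite v2 subr0
  |have := H3 _ _ x3 y3; rewrite v3 subr0|have := H4 _ _ x4 y4; rewrite v4].
Qed.

Lemma local_homeo_injective : exists2 B, nbhs p B &
  forall q q', B q -> B q' -> f1 q = f1 q' -> f2 q = f2 q' -> q = q'.
Proof.
have [e e0 He] := good_box.
exists [set q | `|q.1 - p.1| < e /\ `|q.2 - p.2| < e].
  by apply: (nbhs_box e0) => x y hx hy.
move=> [x y] [x' y'] [/= hx hy] [/= hx' hy'] e1 e2; apply/esym.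
apply: (@box_injective O h1 h2 p e sh1 sh2) => //; try by rewrite /h1 /h2 e1 e2.
- by move=> u v hu hv; have [] := He _ _ hu hv.
- by move=> u v hu hv; have [] := He _ _ hu hv.
Qed.

Lemma local_homeo_open B : nbhs p B -> nbhs (f1 p, f2 p) ((fun q => (f1 q, f2 q)) @` B).
Proof.
move=> nB; have [e e0 He] := good_box; have [d d0 Hd] := box_nbhs nB.
pose r := Num.min e d / 2.
have m0 : 0 < Num.min e d by rewrite lt_min e0.
have r0 : 0 < r by rewrite divr_gt0.
have re : r < e by rewrite /r; have : Num.min e d <= e by [rewrite ge_min lexx]; lra.
have rd : r < d by rewrite /r; have : Num.min e d <= d by [rewrite ge_min lexx orbT]; lra.
have H1 u v : `|u - p.1| < e -> `|v - p.2| < e -> O (u, v) by move=> hu hv; have [] := He _ _ hu hv.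
have H2 u v (hu : `|u - p.1| < e) (hv : `|v - p.2| < e) := (He u v hu hv).2.
have r8 : 0 < r / 8 by lra.
have cF (a b : R) : {for (f1 p, f2 p), continuous (fun w : pt => a * w.1 - b * w.2)}.
  apply: continuousB; apply: continuousM; try exact: cvg_cst; [exact: cvg_fst|exact: cvg_snd].
have [d1 d10 K1] := box_nbhs (continuous_dist_lt (cF (dt f2 p / D) (dt f1 p / D)) r8).
have [d2 d20 K2] := box_nbhs (continuous_dist_lt (cF (- (ds f2 p / D)) (- (ds f1 p / D))) r8).
apply: (@nbhs_box _ _ (Num.min d1 d2)); first by rewrite lt_min d10.
move=> w1 w2; rewrite !lt_min /= => /andP[a1 a2] /andP[b1 b2].
have k1 := K1 _ _ a1 b1; have k2 := K2 _ _ a2 b2.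
have [|||[x y] [/= qx qy E1 E2]] := @box_surjective O h1 h2 p e sh1 sh2 e0 H1 H2 r _
   (dt f2 p / D * w1 - dt f1 p / D * w2) (ds f1 p / D * w2 - ds f2 p / D * w1).
- by rewrite r0.
- by rewrite distrC ltW.
- rewrite distrC ltW //; move: k2; rewrite /h2 /= !mulNr !opprK.
  by rewrite (addrC (- _) (_ * f2 p)) (addrC (- _) (_ * w2)).
exists (x, y); first by apply: Hd; exact: le_lt_trans rd.
move: E1 E2; rewrite /h1 /h2; move: det_neq0; rewrite -/D.
have solve (a b c d' u v : R) : a * d' - b * c != 0 ->
   d' / (a * d' - b * c) * u - b / (a * d' - b * c) * v = 0 ->
   a / (a * d' - b * c) * v - c / (a * d' - b * c) * u = 0 -> u = 0 /\ v = 0.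
  move=> dn z1 z2; split.
    have -> : u = a * (d' / (a * d' - b * c) * u - b / (a * d' - b * c) * v)
        + b * (a / (a * d' - b * c) * v - c / (a * d' - b * c) * u) by field.
    by rewrite z1 z2 !mulr0 addr0.
  have -> : v = c * (d' / (a * d' - b * c) * u - b / (a * d' - b * c) * v)
        + d' * (a / (a * d' - b * c) * v - c / (a * d' - b * c) * u) by field.
  by rewrite z1 z2 !mulr0 addr0.
move=> dn E1 E2.
have key (a b u1 u2 v1 v2 : R) : a * u1 - b * v1 = a * u2 - b * v2 ->
  a * (u1 - u2) - b * (v1 - v2) = 0 by lra.
have [||u0 v0] := solve (ds f1 p) (dt f1 p) (ds f2 p) (dt f2 p) (f1 (x, y) - w1) (f2 (x, y) - w2) dn.
- exact: key E1.
- exact: key E2.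
by congr pair; apply/eqP; rewrite -subr_eq0; apply/eqP.
Qed.

End LocalHomeo.

(** * Polar coordinates *)

Lemma row_lincomb (R : realType) n (a b : R) (u v : 'rV[R]_n) i :
  (a *: u + b *: v) 0 i = a * u 0 i + b * v 0 i.
Proof. by rewrite !mxE. Qed.

HB.lock Definition px (R : realType) (F : R * R -> 'rV[R]_3) : R * R -> 'rV[R]_3 := dx F.
HB.lock Definition py (R : realType) (F : R * R -> 'rV[R]_3) : R * R -> 'rV[R]_3 := dy F.
HB.lock Definition rcos (R : realType) (p : R * R) : R := expR p.1 * cos p.2.
HB.lock Definition rsin (R : realType) (p : R * R) : R := expR p.1 * sin p.2.

Lemma rcosE (R : realType) (p : R * R) : rcos p = expR p.1 * cos p.2.
Proof. by rewrite unlock. Qed.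

Lemma rsinE (R : realType) (p : R * R) : rsin p = expR p.1 * sin p.2.
Proof. by rewrite unlock. Qed.

Lemma pxE (R : realType) (F : R * R -> 'rV[R]_3) : px F = 'D_((1 : R), (0 : R)) F.
Proof. by rewrite unlock. Qed.

Lemma pyE (R : realType) (F : R * R -> 'rV[R]_3) : py F = 'D_((0 : R), (1 : R)) F.
Proof. by rewrite unlock. Qed.

Lemma is_derive_pair_comp (R : realType) (h : R * R -> 'rV[R]_3) (c1 c2 : R -> R) (x a b : R) i :
  differentiable h (c1 x, c2 x) -> is_derive x 1 c1 a -> is_derive x 1 c2 b ->
  is_derive x 1 (fun y => h (c1 y, c2 y) 0 i) (a * px h (c1 x, c2 x) 0 i + b * py h (c1 x, c2 x) 0 i).
Proof.
move=> dh D1 D2.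
have d1 : differentiable c1 x by apply/derivable1_diffP; case: D1.
have d2 : differentiable c2 x by apply/derivable1_diffP; case: D2.
have dc := differentiable_pair d1 d2.
have dhc : differentiable (h \o (fun y => (c1 y, c2 y))) x by exact: differentiable_comp.
have D : derivable (h \o (fun y => (c1 y, c2 y))) x 1 by exact: diff_derivable.
have E : 'D_1 (h \o (fun y => (c1 y, c2 y))) x = a *: px h (c1 x, c2 x) + b *: py h (c1 x, c2 x).
  rewrite deriveE // diff_comp //= diff_pair //= -!deriveE //.
  have -> : 'D_1 c1 x = a by exact: derive_val.
  have -> : 'D_1 c2 x = b by exact: derive_val.
  rewrite pxE pyE !deriveE // -!linearZ -linearD; congr ('d _ _ _).
  by congr pair; rewrite /= /GRing.scale /= !mulr1 !mulr0 ?addr0 ?add0r.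
have -> : a * px h (c1 x, c2 x) 0 i + b * py h (c1 x, c2 x) 0 i =
    'D_1 (fun y => h (c1 y, c2 y) 0 i) x.
  by rewrite -row_lincomb -E (derive_mx D) mxE.
by apply: derivableP; move: D => /derivable_mxP; apply.
Qed.

Section Polar.
Variable R : realType.
Local Notation pt := (R * R)%type.
Implicit Types (p q : pt) (O U : set pt).

Definition polar p : pt := (rcos p, rsin p).

Let x_s p : is_derive p.1 1 (fun s => rcos (s, p.2)) (rcos p).
Proof.
rewrite unlock /=; have := is_derive1M (is_derive_expR p.1) (is_derive_cst (cos p.2) p.1 (1 : R)).
by rewrite mulr0 addr0.
Qed.

Let y_s p : is_derive p.1 1 (fun s => rsin (s, p.2)) (rsin p).
Proof.
rewrite unlock /=; have := is_derive1M (is_derive_expR p.1) (is_derive_cst (sin p.2) p.1 (1 : R)).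
by rewrite mulr0 addr0.
Qed.

Let x_t p : is_derive p.2 1 (fun t => rcos (p.1, t)) (- rsin p).
Proof.
rewrite rsinE unlock; have := is_derive1M (is_derive_cst (expR p.1) p.2 (1 : R)) (is_derive_cos p.2).
by rewrite mul0r add0r mulrN.
Qed.

Let y_t p : is_derive p.2 1 (fun t => rsin (p.1, t)) (rcos p).
Proof.
rewrite rcosE unlock; have := is_derive1M (is_derive_cst (expR p.1) p.2 (1 : R)) (is_derive_sin p.2).
by rewrite mul0r add0r.
Qed.

Let x_continuous p : {for p, continuous (@rcos R)}.
Proof.
rewrite unlock; apply: continuousM.
  by apply: (@continuous_comp _ _ _ fst expR); [exact: cvg_fst|exact: continuous_expR].
by apply: (@continuous_comp _ _ _ snd cos); [exact: cvg_snd|exact: continuous_cos].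
Qed.

Let y_continuous p : {for p, continuous (@rsin R)}.
Proof.
rewrite unlock; apply: continuousM.
  by apply: (@continuous_comp _ _ _ fst expR); [exact: cvg_fst|exact: continuous_expR].
by apply: (@continuous_comp _ _ _ snd sin); [exact: cvg_snd|exact: continuous_sin].
Qed.

Lemma polar_continuous : continuous polar.
Proof. move=> p; exact: cvg_pair (@x_continuous p) (@y_continuous p). Qed.

(** The real and imaginary parts of [exp (s + i t)] are, up to sign, permuted by both partial
    derivatives, so one joint induction settles all orders. *)
Lemma sm_polar O n : sm O n (@rcos R) /\ sm O n (@rsin R).
Proof.
elim: n => [|n [IHx IHy]].
  by split; (split; last by []) => p _; [exact: x_continuous|exact: y_continuous].
split; split.
- by move=> p _; exact: x_continuous.
- exists (@rcos R), (fun p => - rsin p); split=> [p _|p _||].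
  + exact: x_s.
  + exact: x_t.
  + exact: IHx.
  + exact: sm_opp.
- by move=> p _; exact: y_continuous.
- exists (@rsin R), (@rcos R); split=> [p _|p _||]; [exact: y_s|exact: y_t|exact: IHy|exact: IHx].
Qed.

Lemma polar_norm p : (polar p).1 ^+ 2 + (polar p).2 ^+ 2 = expR p.1 ^+ 2.
Proof. by rewrite /= rcosE rsinE !exprMn -mulrDr cos2Dsin2 mulr1. Qed.

Lemma polar_periodic s t : polar (s, t + pi *+ 2) = polar (s, t).
Proof. by rewrite /polar !rcosE !rsinE /= cosD2pi sinD2pi. Qed.

Lemma polar_surjective q : 0 < q.1 ^+ 2 + q.2 ^+ 2 ->
  exists2 p, q = polar p & 0 <= p.2 <= pi *+ 2.
Proof.
move=> q0; pose r := Num.sqrt (q.1 ^+ 2 + q.2 ^+ 2).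
have r0 : 0 < r by rewrite sqrtr_gt0.
have rn : r != 0 by rewrite gt_eqF.
have rE : r ^+ 2 = q.1 ^+ 2 + q.2 ^+ 2 by rewrite sqr_sqrtr // ltW.
have u1 : -1 <= q.1 / r <= 1.
  have a1 : `|q.1| <= r by rewrite -sqrtr_sqr ler_wsqrtr // lerDl sqr_ge0.
  by rewrite -ler_norml normrM normfV (gtr0_norm r0) ler_pdivrMr // mul1r.
have P0 := pi_gt0 R.
have [t qE] : exists t, q = polar (ln r, t).
  have cE : cos (acos (q.1 / r)) = q.1 / r by rewrite acosK // in_itv.
  have sE : sin (acos (q.1 / r)) = `|q.2| / r.
    rewrite sin_acos //; have -> : 1 - (q.1 / r) ^+ 2 = (q.2 / r) ^+ 2.
      have -> : (q.2 / r) ^+ 2 = (r ^+ 2 - q.1 ^+ 2) / r ^+ 2.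
        by rewrite expr_div_n rE addrAC subrr add0r.
      by field.
    by rewrite sqrtr_sqr normrM normfV (gtr0_norm r0).
  have h : expR (ln r) = r by rewrite lnK // posrE.
  have [q2|q2] := leP 0 q.2.
    exists (acos (q.1 / r)); rewrite /polar !rcosE !rsinE /= h cE sE (ger0_norm q2) !(mulrC r) !divfK //.
    exact: surjective_pairing.
  exists (- acos (q.1 / r)); rewrite /polar !rcosE !rsinE /= h cosN sinN cE sE (ltr0_norm q2) mulNr opprK.
  by rewrite !(mulrC r) !divfK //; exact: surjective_pairing.
have P2 : 0 < pi *+ 2 :> R by rewrite mulrn_wgt0.
have [k kP] := period_reduce P2 t.
exists (ln r, t + k%:~R * (pi *+ 2)) => //.
by rewrite (periodic_int polar_periodic).
Qed.

Lemma polar_angle_inj s t t' : t < t' < t + pi *+ 2 -> polar (s, t) <> polar (s, t').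
Proof.
rewrite /polar !rcosE !rsinE /= => /andP[h1 h2].
move=> [/(mulfI (lt0r_neq0 (expR_gt0 _))) ec /(mulfI (lt0r_neq0 (expR_gt0 _))) es].
have : cos (t' - t) = 1 by rewrite cosB -ec -es -!expr2 cos2Dsin2.
(* Half the angle lies strictly between 0 and [pi], where the sine is positive, whereas
   [cos (t' - t) = 1] forces it to vanish. *)
have -> : t' - t = ((t' - t) / 2) *+ 2 by rewrite -mulr_natr divfK // pnatr_eq0.
rewrite cos_mulr2n => hc.
have : 0 < sin ((t' - t) / 2).
  by apply: sin_gt0_pi; move: h2; rewrite mulr2n => h2; apply/andP; split; lra.
have := sin2cos2 ((t' - t) / 2); move: hc; rewrite mulr2n.
by move: (cos _) (sin _) => u v; nra.
Qed.

(** The Jacobian determinant is [expR p.1 ^+ 2]. *)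
Lemma polar_open p B : nbhs p B -> nbhs (polar p) (polar @` B).
Proof.
move=> nB; have [sx sy] := sm_polar setT 1.
apply: (local_homeo_open openT sx sy I _ nB).
rewrite (is_ds (x_s p)) (is_ds (y_s p)) (is_dt (x_t p)) (is_dt (y_t p)).
have -> : rcos p * rcos p - - rsin p * rsin p = (polar p).1 ^+ 2 + (polar p).2 ^+ 2 by rewrite /=; ring.
by rewrite polar_norm expf_neq0 // lt0r_neq0 // expR_gt0.
Qed.

Section Pullback.
Variables (U : set pt) (F : pt -> 'rV[R]_3).
Hypothesis oU : open U.
Local Notation V := (polar @^-1` U).

Lemma polar_preimage_open : open V.
Proof. by apply: open_comp => // p _; exact: polar_continuous. Qed.

Lemma pullback_s n G i p : Ck U n.+1 G -> V p ->
  is_derive p.1 1 (fun s => G (polar (s, p.2)) 0 i)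
    (rcos p * px G (polar p) 0 i + rsin p * py G (polar p) 0 i).
Proof.
case: p => a b [dG _] Vp.
apply: (@is_derive_pair_comp R G (fun s => rcos (s, b)) (fun s => rsin (s, b))).
- exact: dG.
- exact: (x_s (a, b)).
- exact: (y_s (a, b)).
Qed.

Lemma pullback_t n G i p : Ck U n.+1 G -> V p ->
  is_derive p.2 1 (fun t => G (polar (p.1, t)) 0 i)
    (- rsin p * px G (polar p) 0 i + rcos p * py G (polar p) 0 i).
Proof.
case: p => a b [dG _] Vp.
apply: (@is_derive_pair_comp R G (fun t => rcos (a, t)) (fun t => rsin (a, t))).
- exact: dG.
- exact: (x_t (a, b)).
- exact: (y_t (a, b)).
Qed.

(** Partial derivatives of a pullback are combinations of pullbacks of [px G] and [py G] with smooth
    coefficients, which carries the induction. *)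
Lemma pullback_smooth n G : Ck U n G -> smv V n (G \o polar).
Proof.
have C (H : pt -> 'rV[R]_3) : (forall q, U q -> {for q, continuous H}) -> forall i p, V p ->
    {for p, continuous (fun q => (H \o polar) q 0 i)}.
  move=> cH i p Vp; apply: (@continuous_comp _ _ _ polar (fun v => H v 0 i)).
    exact: polar_continuous.
  apply: (@continuous_comp _ _ _ H (fun v : 'rV[R]_3 => v 0 i)); first exact: cH.
  exact: coord_continuous.
elim: n G => [|n IH] G CG i; first by split=> // p Vp; exact: C.
have [dG CD] := CG; split.
  by move=> p Vp; apply: C => // q /dG; exact: differentiable_continuous.
have [sx sy] := sm_polar V n.
have s1 := IH _ (CD (1, 0)) i; have s2 := IH _ (CD (0, 1)) i.
rewrite -pxE in s1; rewrite -pyE in s2.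
exists (fun p => rcos p * px G (polar p) 0 i + rsin p * py G (polar p) 0 i),
  (fun p => - rsin p * px G (polar p) 0 i + rcos p * py G (polar p) 0 i); split.
- by move=> p Vp; exact: (pullback_s i CG Vp).
- by move=> p Vp; exact: (pullback_t i CG Vp).
- by apply: sm_add; apply: sm_mul.
- by apply: sm_add; apply: sm_mul => //; exact: sm_opp.
Qed.

Lemma pullback_vs n G p : Ck U n.+1 G -> V p ->
  vs (G \o polar) p = rcos p *: px G (polar p) + rsin p *: py G (polar p).
Proof.
by move=> CG Vp; apply/rowP => i; rewrite vsE row_lincomb; apply: is_ds; exact: (pullback_s i CG Vp).
Qed.

Lemma pullback_vt n G p : Ck U n.+1 G -> V p ->
  vt (G \o polar) p = - rsin p *: px G (polar p) + rcos p *: py G (polar p).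
Proof.
by move=> CG Vp; apply/rowP => i; rewrite vtE row_lincomb; apply: is_dt; exact: (pullback_t i CG Vp).
Qed.

(** Conformal change of variables: in the sum the first-order terms and the mixed terms cancel, and
    the factor is the squared modulus of the derivative of [exp]. *)
Lemma pullback_laplacian p : Ck U 2 F -> V p ->
  vs (vs (F \o polar)) p + vt (vt (F \o polar)) p =
  expR p.1 ^+ 2 *: (px (px F) (polar p) + py (py F) (polar p)).
Proof.
move=> CF Vp; have oV := polar_preimage_open; have [_ CD] := CF.
have C1 : Ck U 1 (px F) by rewrite pxE; exact: CD.
have C2 : Ck U 1 (py F) by rewrite pyE; exact: CD.
have [sx sy] := sm_polar V 1.
have sx' : ds (@rcos R) p = rcos p by apply: is_ds; exact: (x_s p).
have sy' : ds (@rsin R) p = rsin p by apply: is_ds; exact: (y_s p).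
have tx' : dt (@rcos R) p = - rsin p by apply: is_dt; exact: (x_t p).
have ty' : dt (fun q => - rsin q) p = - rcos p by apply: is_dt; exact: is_derive1N (y_t p).
rewrite (vs_ext oV (fun q Vq => pullback_vs CF Vq) Vp).
rewrite (vt_ext oV (fun q Vq => pullback_vt CF Vq) Vp).
have rowD (u v : 'rV[R]_3) i : (u + v) 0 i = u 0 i + v 0 i by rewrite mxE.
have rowZ (k : R) (u : 'rV[R]_3) i : (k *: u) 0 i = k * u 0 i by rewrite mxE.
apply/rowP => i; rewrite rowZ !rowD vsE vtE.
have s1 := pullback_smooth C1 i; have s2 := pullback_smooth C2 i.
have -> : (fun q => (rcos q *: px F (polar q) + rsin q *: py F (polar q)) 0 i) =
    (fun q => rcos q * (px F \o polar) q 0 i + rsin q * (py F \o polar) q 0 i).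
  by apply/funext => q; rewrite row_lincomb.
have -> : (fun q => (- rsin q *: px F (polar q) + rcos q *: py F (polar q)) 0 i) =
    (fun q => - rsin q * (px F \o polar) q 0 i + rcos q * (py F \o polar) q 0 i).
  by apply/funext => q; rewrite row_lincomb.
rewrite (dsD (sm_mul sx s1) (sm_mul sy s2) Vp) (dsM sx s1 Vp) (dsM sy s2 Vp).
rewrite (dtD (sm_mul (sm_opp sy) s1) (sm_mul sx s2) Vp) (dtM (sm_opp sy) s1 Vp) (dtM sx s2 Vp).
have d1 : ds (fun q => (px F \o polar) q 0 i) p = rcos p * px (px F) (polar p) 0 i
  + rsin p * py (px F) (polar p) 0 i by apply: is_ds; exact: pullback_s C1 Vp.
have d2 : ds (fun q => (py F \o polar) q 0 i) p = rcos p * px (py F) (polar p) 0 i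
  + rsin p * py (py F) (polar p) 0 i by apply: is_ds; exact: pullback_s C2 Vp.
have e1 : dt (fun q => (px F \o polar) q 0 i) p = - rsin p * px (px F) (polar p) 0 i
  + rcos p * py (px F) (polar p) 0 i by apply: is_dt; exact: pullback_t C1 Vp.
have e2 : dt (fun q => (py F \o polar) q 0 i) p = - rsin p * px (py F) (polar p) 0 i
  + rcos p * py (py F) (polar p) 0 i by apply: is_dt; exact: pullback_t C2 Vp.
rewrite sx' sy' tx' ty' d1 d2 e1 e2 -polar_norm /comp.
have -> : (polar p).1 ^+ 2 + (polar p).2 ^+ 2 = rcos p ^+ 2 + rsin p ^+ 2 by [].
move: (px (px F) (polar p) 0 i) (py (px F) (polar p) 0 i) (px (py F) (polar p) 0 i)
  (py (py F) (polar p) 0 i) (px F (polar p) 0 i) (py F (polar p) 0 i).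
move: (rcos p) (rsin p).
move=> *; ring.
Qed.

End Pullback.
End Polar.

(** * Spherical caps *)

Section Stereographic.
Variable R : realType.
Implicit Types (w : R * R) (u v : 'rV[R]_3).

(** Inverse stereographic projection without the normalising denominator: the point of the sphere
    scaled by [1 + |w|^2]. Cones do not see the positive factor, and the coordinates stay
    polynomial. *)
Definition sigma w : 'rV[R]_3 :=
  \row_(i < 3) match val i with
               | 0%N => 2 * w.1
               | 1%N => 2 * w.2
               | _ => w.1 ^+ 2 + w.2 ^+ 2 - 1
               end.
Definition vnorm u := Num.sqrt (dot u u).
(** Stereographic projection of [u / |u|], extended to vectors of any length so that segments in
    space can be projected. *)
Definition stereo u : R * R := (u 0 0 / (vnorm u - u 0 2%:R), u 0 1 / (vnorm u - u 0 2%:R)).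
Definition north : 'rV[R]_3 := \row_(i < 3) (if val i == 2%N then 1 else 0).

Lemma sigmaE w : [/\ sigma w 0 0 = 2 * w.1, sigma w 0 1 = 2 * w.2 &
  sigma w 0 2%:R = w.1 ^+ 2 + w.2 ^+ 2 - 1].
Proof. by rewrite !mxE. Qed.

Lemma northE : [/\ north 0 0 = 0, north 0 1 = 0 & north 0 2%:R = 1].
Proof. by rewrite !mxE. Qed.

Lemma dot_north u : dot north u = u 0 2%:R.
Proof. by have [e0 e1 e2] := northE; rewrite dot3E e0 e1 e2; ring. Qed.

Lemma sigma_norm w : vnorm (sigma w) = 1 + w.1 ^+ 2 + w.2 ^+ 2.
Proof.
have [e0 e1 e2] := sigmaE w; rewrite /vnorm dot3E e0 e1 e2.
have -> : 2 * w.1 * (2 * w.1) + 2 * w.2 * (2 * w.2) +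
  (w.1 ^+ 2 + w.2 ^+ 2 - 1) * (w.1 ^+ 2 + w.2 ^+ 2 - 1) = (1 + w.1 ^+ 2 + w.2 ^+ 2) ^+ 2 by ring.
by rewrite sqrtr_sqr ger0_norm // !addr_ge0 ?sqr_ge0.
Qed.

Lemma sigma_off w : sigma w 0 2%:R < vnorm (sigma w).
Proof. by have [_ _ ->] := sigmaE w; rewrite sigma_norm; lra. Qed.

Lemma sigma_neq0 w : sigma w <> 0.
Proof. by move=> h; have := sigma_off w; rewrite h /vnorm dot3E !mxE !mulr0 !addr0 sqrtr0 ltxx. Qed.

Lemma stereo_sigma w : stereo (sigma w) = w.
Proof.
rewrite /stereo sigma_norm; have [-> -> ->] := sigmaE w.
have -> : 1 + w.1 ^+ 2 + w.2 ^+ 2 - (w.1 ^+ 2 + w.2 ^+ 2 - 1) = 2 by ring.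
by case: w => x y /=; congr pair; rewrite mulrAC mulfV ?mul1r // pnatr_eq0.
Qed.

Lemma vnorm_sq u : vnorm u ^+ 2 = dot u u.
Proof. by rewrite sqr_sqrtr // dot3_ge0. Qed.

Lemma vnormZ k u : 0 < k -> vnorm (k *: u) = k * vnorm u.
Proof.
move=> k0; rewrite /vnorm dot3Zl dot3Zr mulrA -expr2 sqrtrM ?sqr_ge0 //.
by rewrite sqrtr_sqr gtr0_norm.
Qed.

Lemma sigma_stereo u : u 0 2%:R < vnorm u ->
  sigma (stereo u) = (2 / (vnorm u - u 0 2%:R)) *: u.
Proof.
move=> h; have dn : vnorm u - u 0 2%:R != 0 by rewrite gt_eqF // subr_gt0.
have [e0 e1 e2] := sigmaE (stereo u); have := vnorm_sq u; rewrite dot3E => nu.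
apply: rV3P; rewrite ?e0 ?e1 ?e2 mxE /stereo /=.
- by field.
- by field.
- move: nu dn; move: (vnorm u) (u 0 0) (u 0 1) (u 0 2%:R) => r x y z nu dn.
  have -> : (x / (r - z)) ^+ 2 + (y / (r - z)) ^+ 2 - 1 = (x * x + y * y + z * z - r ^+ 2
     + 2 * z * (r - z)) / (r - z) ^+ 2 by field.
  by rewrite -nu subrr add0r; field.
Qed.

Lemma stereoZ k u : 0 < k -> stereo (k *: u) = stereo u.
Proof.
move=> k0; rewrite /stereo vnormZ // !mxE -mulrBr.
have kn : k != 0 by rewrite gt_eqF.
by congr pair; rewrite -mulf_div mulfV // mul1r.
Qed.

(** Identifies the vectors on which [stereo] degenerates: the ray through the pole. *)
Lemma on_axis u : ~~ (u 0 2%:R < vnorm u) -> u = u 0 2%:R *: north /\ 0 <= u 0 2%:R.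
Proof.
rewrite -leNgt => h; have h0 : 0 <= vnorm u by exact: sqrtr_ge0.
have := vnorm_sq u; rewrite dot3E => nu; have [e0 e1 e2] := northE.
split; last exact: le_trans h.
by apply: rV3P; rewrite mxE ?e0 ?e1 ?e2; nra.
Qed.

Lemma continuous_stereo (T : topologicalType) (f : T -> 'rV[R]_3) x :
  (forall i, {for x, continuous (fun y => f y 0 i)}) -> f x 0 2%:R < vnorm (f x) ->
  {for x, continuous (fun y => stereo (f y))}.
Proof.
move=> cf h.
have cd : {for x, continuous (fun y => (vnorm (f y) - f y 0 2%:R)^-1)}.
  apply: continuousV; first by rewrite gt_eqF // subr_gt0.
  apply: continuousB; last exact: cf.
  apply: (@continuous_comp _ _ _ (fun y => dot (f y) (f y)) Num.sqrt).
    exact: (@continuous_dot3 R T f f x).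
  exact: sqrt_continuous.
have c0 : {for x, continuous (fun y => f y 0 0 * (vnorm (f y) - f y 0 2%:R)^-1)}.
  by apply: continuousM => //; exact: cf.
have c1 : {for x, continuous (fun y => f y 0 1 * (vnorm (f y) - f y 0 2%:R)^-1)}.
  by apply: continuousM => //; exact: cf.
exact: cvg_pair c0 c1.
Qed.

Section Cap.
Variables (g nu : R -> 'rV[R]_3) (P : R).
Hypothesis P_gt0 : 0 < P.
Hypothesis cg : forall i, continuous (fun t : R => g t 0 i).
Hypothesis cnu : forall i, continuous (fun t : R => nu t 0 i).
Hypothesis gP : forall t, g (t + P) = g t.
Hypothesis gg : forall t, dot (g t) (g t) = 1.
Hypothesis nunu : forall t, dot (nu t) (nu t) = 1.

Let cone v := forall t, dot v (g t) <= 0.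
Hypothesis cone_nu : forall t, cone (nu t).
Hypothesis touch : forall t v, cone v -> dot v (g t) = 0 ->
  v = dot v (nu t) *: nu t /\ 0 <= dot v (nu t).
Hypothesis strict : forall t, exists t', dot (nu t) (g t') < 0.
Hypothesis omit : forall t, nu t 0 2%:R != 1.

Definition cap : set (R * R) := [set w | forall t, dot (sigma w) (g t) <= 0].

Let red t : exists2 t', 0 <= t' <= P & g t' = g t.
Proof.
have [k kP] := period_reduce P_gt0 t; exists (t + k%:~R * P) => //.
exact: (@periodic_int R P _ (fun p => g p.2) (fun s t => gP t) k 0 t).
Qed.

Let max_on_period (f : R -> R) : continuous f ->
  exists2 t0, 0 <= t0 <= P & forall t, 0 <= t <= P -> f t <= f t0.
Proof.
move=> cf; have [|t0] := @EVT_max R f 0 P (ltW P_gt0).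
  by apply: continuous_subspaceT => x; exact: cf.
by rewrite in_itv /= => h H; exists t0 => // t tP; apply: H; rewrite in_itv.
Qed.

Let cdot v : continuous (fun t => dot v (g t)).
Proof. by move=> t; apply: (@continuous_dot3 R _ (fun=> v) g) => i; [exact: cvg_cst|exact: cg]. Qed.

Let nu_norm t : vnorm (nu t) = 1. Proof. by rewrite /vnorm nunu sqrtr1. Qed.

Let nu_off t : nu t 0 2%:R < vnorm (nu t).
Proof.
rewrite nu_norm lt_neqAle omit /=.
have := dot3_unit_le 2%:R (nunu t); exact: le_trans (ler_norm _).
Qed.

Lemma cap_stereo u : u 0 2%:R < vnorm u -> cap (stereo u) <-> cone u.
Proof.
move=> h; rewrite /cap /= sigma_stereo //.
have k0 : 0 < 2 / (vnorm u - u 0 2%:R) by rewrite divr_gt0 // subr_gt0.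
by split=> H t; have := H t; rewrite dot3Zl pmulr_rle0.
Qed.

Let sigma_continuous i : continuous (fun w => sigma w 0 i).
Proof.
move=> w.
have c1 : {for w, continuous (fun w : R * R => w.1)} by exact: cvg_fst.
have c2 : {for w, continuous (fun w : R * R => w.2)} by exact: cvg_snd.
have cc (k : R) : {for w, continuous (fun=> k : R)} by exact: cvg_cst.
case: i => -[|[|[|//]]] Hi.
- rewrite (_ : (fun _ => _) = fun w => 2 * w.1); last by apply/funext => z; rewrite mxE.
  exact: (continuousM (cc 2) c1).
- rewrite (_ : (fun _ => _) = fun w => 2 * w.2); last by apply/funext => z; rewrite mxE.
  exact: (continuousM (cc 2) c2).
- rewrite (_ : (fun _ => _) = fun w => w.1 * w.1 + w.2 * w.2 - 1); last first.
    by apply/funext => z; rewrite mxE.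
  exact: (continuousB (continuousD (continuousM c1 c1) (continuousM c2 c2)) (cc 1)).
Qed.

Let cdots t : continuous (fun w => dot (sigma w) (g t)).
Proof.
move=> w; apply: (@continuous_dot3 R _ sigma (fun=> g t)) => i.
  exact: sigma_continuous.
exact: cvg_cst.
Qed.

Lemma cap_closed : closed cap.
Proof.
have -> : cap = \bigcap_t ((fun w => dot (sigma w) (g t)) @^-1` [set x | x <= 0]).
  by apply/seteqP; split => [w H t _|w H t]; [exact: H|exact: (H t)].
apply: closed_bigI => t _; apply: closed_comp; last exact: closed_le.
by move=> w _; exact: cdots.
Qed.

Lemma cap_boundary w t : cap w -> dot (sigma w) (g t) = 0 -> w = stereo (nu t).
Proof.
move=> kw w0; have [E l0] := touch kw w0.
have {}l0 : 0 < dot (sigma w) (nu t).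
  rewrite lt_neqAle l0 andbT eq_sym; apply/eqP => h.
  by apply: (@sigma_neq0 w); rewrite E h scale0r.
by rewrite -[LHS]stereo_sigma E stereoZ.
Qed.

(** Off the boundary curve all products with [g t] are strictly negative, and by periodicity they
    have a negative maximum. Each of the three coordinates may use up a third of this margin. *)
Lemma cap_interior w : cap w -> ~ (exists t, w = stereo (nu t)) -> nbhs w cap.
Proof.
move=> kw nb.
have neg t : dot (sigma w) (g t) < 0.
  rewrite lt_neqAle kw andbT; apply/eqP => h; apply: nb; exists t; exact: cap_boundary.
have [t0 _ H0] := max_on_period (@cdot (sigma w)).
have q0 : 0 < - dot (sigma w) (g t0) / 3 by have := neg t0; lra.
have ni i : nbhs w [set w' | `|sigma w 0 i - sigma w' 0 i| < - dot (sigma w) (g t0) / 3].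
  exact: (continuous_dist_lt (@sigma_continuous i w) q0).
apply: (filterS _ (filterI (ni 0) (filterI (ni 1) (ni 2%:R)))) => w' [h0 [h1 h2]] t.
have [t' t'P <-] := red t; have le0 := H0 _ t'P.
have bnd i : `|sigma w 0 i - sigma w' 0 i| < - dot (sigma w) (g t0) / 3 ->
    (sigma w' 0 i - sigma w 0 i) * g t' 0 i < - dot (sigma w) (g t0) / 3.
  move=> hb; apply: le_lt_trans (ler_norm _) _; rewrite normrM distrC (le_lt_trans _ hb) //.
  by rewrite ler_piMr //; exact: dot3_unit_le.
have b0 := bnd _ h0; have b1 := bnd _ h1; have b2 := bnd _ h2.
have E : dot (sigma w') (g t') = dot (sigma w) (g t') + (sigma w' 0 0 - sigma w 0 0) * g t' 0 0
   + (sigma w' 0 1 - sigma w 0 1) * g t' 0 1 + (sigma w' 0 2%:R - sigma w 0 2%:R) * g t' 0 2%:R.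
  by rewrite !dot3E; ring.
rewrite E; move: le0 b0 b1 b2.
move: (dot (sigma w) (g t0)) (dot (sigma w) (g t')) ((sigma w' 0 0 - sigma w 0 0) * g t' 0 0)
  ((sigma w' 0 1 - sigma w 0 1) * g t' 0 1) ((sigma w' 0 2%:R - sigma w 0 2%:R) * g t' 0 2%:R).
move=> x y z z' z'' *; lra.
Qed.

Lemma cap_curve t : cap (stereo (nu t)).
Proof. by apply/cap_stereo; [exact: nu_off|exact: cone_nu]. Qed.

Lemma cap_curve_inj t t' : stereo (nu t) = stereo (nu t') -> nu t = nu t'.
Proof.
move=> h; have := sigma_stereo (nu_off t); rewrite h sigma_stereo; last exact: nu_off.
rewrite !nu_norm => E.
have d (s : R) : 0 < 1 - nu s 0 2%:R by rewrite subr_gt0 -[ltRHS](nu_norm s); exact: nu_off.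
(* The third coordinate [z] is recovered from [2 z / (1 - z)], which is injective in [z]. *)
have E2 : nu t 0 2%:R = nu t' 0 2%:R.
  have := congr1 (fun v : 'rV_3 => v 0 2%:R) E; rewrite /= !mxE.
  have := d t; have := d t'; move: (nu t 0 2%:R) (nu t' 0 2%:R) => x y dy dx.
  move=> F; have : (2 / (1 - y) * y) * ((1 - y) * (1 - x)) = (2 / (1 - x) * x) * ((1 - y) * (1 - x)).
    by rewrite F.
  have -> : (2 / (1 - y) * y) * ((1 - y) * (1 - x)) = 2 * y * (1 - x) by field; rewrite gt_eqF.
  have -> : (2 / (1 - x) * x) * ((1 - y) * (1 - x)) = 2 * x * (1 - y) by field; rewrite gt_eqF.
  lra.
move: E; rewrite E2 => E.
have kn : 2 / (1 - nu t' 0 2%:R) != 0 by rewrite gt_eqF // divr_gt0.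
by have := scalerI kn E => ->.
Qed.

Let north_off : ~ cone north -> forall u, cone u -> u <> 0 -> u 0 2%:R < vnorm u.
Proof.
move=> nn u cu u0; case: (boolP (_ < _)) => // /on_axis[E l0]; exfalso.
have {}l0 : 0 < u 0 2%:R.
  by rewrite lt_neqAle l0 andbT eq_sym; apply/eqP => h; apply: u0; rewrite E h scale0r.
apply: nn => t; have := cu t; rewrite E dot3Zl pmulr_rle0 //.
Qed.

Let lin_continuous (u v : 'rV[R]_3) i : continuous (fun x : R => (u + x *: v) 0 i).
Proof.
move=> x; rewrite (_ : (fun _ => _) = fun x => u 0 i + x * v 0 i); last first.
  by apply/funext => y; rewrite !mxE.
have := is_derive1D (is_derive_cst (u 0 i) x (1 : R))
  (is_derive1M (is_derive_id x (1 : R)) (is_derive_cst (v 0 i) x (1 : R))).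
exact: is_derive1_continuous.
Qed.

(** The cone is convex, so a segment from [nu 0] stays in it. It avoids 0 by [strict], and it avoids
    the ray of the pole because the pole is not in the cone, so it projects to a path in the cap. *)
Lemma cap_bounded_connected : ~ cone north -> connected cap.
Proof.
move=> nn; apply: (@starlike_connected _ R cap (stereo (nu 0))); first exact: cap_curve.
move=> w kw; pose u x : 'rV[R]_3 := nu 0 + x *: (sigma w - nu 0).
have uE x : u x = (1 - x) *: nu 0 + x *: sigma w.
  by rewrite /u scalerBr scalerBl scale1r addrA addrAC.
have uc x : 0 <= x <= 1 -> cone (u x).
  move=> /andP[x0 x1] t; rewrite uE dot3Dl !dot3Zl.
  have := cone_nu 0 t; have := kw t; move: (dot _ _) (dot _ _) => y z; nra.
have u0 x : 0 <= x <= 1 -> u x <> 0.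
  move=> /andP[x0 x1] h; have [t' ht] := strict 0.
  have [x10|x1n] := eqVneq x 1.
    by apply: (@sigma_neq0 w); rewrite -h uE x10 subrr scale0r scale1r add0r.
  have : dot (u x) (g t') = 0 by rewrite h dot3E !mxE; ring.
  have {}x1 : x < 1 by rewrite lt_neqAle x1n.
  rewrite uE dot3Dl !dot3Zl; have := kw t'; move: ht; move: (dot _ _) (dot _ _) => y z; nra.
have uo x : 0 <= x <= 1 -> u x 0 2%:R < vnorm (u x) by move=> h; apply: north_off; auto.
exists (fun x => stereo (u x)); split.
- apply: continuous_in_subspaceT => x /[!inE] /=; rewrite in_itv /= => x01.
  by apply: continuous_stereo; [move=> i; exact: lin_continuous|exact: uo].
- by rewrite uE subr0 scale1r scale0r addr0.
- by rewrite uE subrr scale1r scale0r add0r stereo_sigma.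
- by move=> x x01; apply/cap_stereo; [exact: uo|exact: uc].
Qed.

(** Were the pole orthogonal to some [g t], [touch] would make it equal to [nu t], which [omit]
    forbids. *)
Let north_strict : cone north -> forall t, g t 0 2%:R < 0.
Proof.
move=> cn t; rewrite -dot_north lt_neqAle cn andbT; apply/eqP => h.
have [E l0] := touch cn h; have := congr1 (fun v : 'rV_3 => dot v v) E.
have [_ _ e2] := northE.
rewrite /= dot3Zl dot3Zr nunu mulr1 dot_north e2 => l1.
have l : dot north (nu t) = 1 by nra.
have : nu t 0 2%:R = 1 by have := congr1 (fun v : 'rV_3 => v 0 2%:R) E; rewrite l scale1r e2.
by move/eqP; rewrite (negbTE (omit t)).
Qed.

(** Segments in the cone may now cross the ray of the pole, where projection fails. Instead each
    point is pushed away from the pole until it reaches the boundary curve, which is itself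
    connected. *)
Lemma cap_unbounded_connected : cone north -> connected cap.
Proof.
move=> cn; have ns := north_strict cn.
have [n0 n1 n2] := northE.
pose G := (fun t => stereo (nu t)) @` setT.
have cG : connected G.
  apply: connected_continuous_connected.
    by apply/connected_intervalP => x y _ _ z _.
  apply: continuous_subspaceT => t.
  by apply: continuous_stereo; [move=> i; exact: cnu|exact: nu_off].
have path w : cap w -> exists2 A, connected A & [/\ A w, A `<=` cap & A `&` G !=set0].
  move=> kw; pose v := sigma w; pose u x : 'rV[R]_3 := v + x *: (- north).
  have uE x t : dot (u x) (g t) = dot v (g t) - x * g t 0 2%:R.
    by rewrite dot3Dl dot3Zl dot3Nl dot_north mulrN.
  (* [- q t] is the time at which the moving vector becomes orthogonal to [g t], so the exit time
     from the cone is minus the maximum of [q]. *)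
  pose q t := - (dot v (g t) / g t 0 2%:R).
  have cq : continuous q.
    move=> t; have c1 : {for t, continuous (fun t => dot v (g t) * (g t 0 2%:R)^-1)}.
      apply: continuousM; first exact: cdot.
      by apply: continuousV; [rewrite lt_eqF|exact: cg].
    exact: (continuousN c1).
  have [t1 _ H1] := max_on_period cq.
  pose x1 := - q t1.
  have x1E : x1 = dot v (g t1) / g t1 0 2%:R by rewrite /x1 /q opprK.
  have x10 : 0 <= x1 by rewrite x1E mulr_le0 ?kw // invr_le0 ltW.
  have uc x : 0 <= x <= x1 -> cone (u x).
    move=> /andP[x0 xx1] t; have [t' t'P <-] := red t.
    have := H1 _ t'P; rewrite uE subr_le0 => h.
    rewrite -ler_ndivlMr //; apply: le_trans xx1 _; move: h; rewrite /x1 /q; lra.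
  have uo x : 0 <= x -> u x 0 2%:R < vnorm (u x).
    move=> x0; case: (boolP (_ < _)) => // /on_axis[E l0]; exfalso.
    have : v = (u x 0 2%:R + x) *: north.
      by rewrite scalerDl -E /u scalerN subrK.
    move=> vE; have := sigma_off w; rewrite -/v.
    have [e0 e1 e2] := sigmaE w; rewrite -/v in e0 e1 e2.
    have := congr1 (fun v : 'rV_3 => v 0 0) vE; have := congr1 (fun v : 'rV_3 => v 0 1) vE.
    have := congr1 (fun v : 'rV_3 => v 0 2%:R) vE.
    rewrite /= [X in _ = X]mxE [X in _ -> _ = X -> _]mxE [X in _ -> _ -> _ = X -> _]mxE.
    rewrite n0 n1 n2 e0 e1 e2 => f2 f1 f0 _.
    by move: f0 f1 f2 l0 x0; move: (u x 0 2%:R) => k; nra.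
  exists ((fun x => stereo (u x)) @` `[0, x1]).
    apply: connected_continuous_connected; first exact: segment_connected.
    apply: continuous_in_subspaceT => x /[!inE] /=; rewrite in_itv /= => /andP[x0 _].
    by apply: continuous_stereo; [move=> i; exact: lin_continuous|exact: uo].
  split.
  - exists 0; first by rewrite /= in_itv /= lexx.
    by rewrite /u scale0r addr0 stereo_sigma.
  - move=> _ [x /= xx <-]; rewrite in_itv /= in xx.
    by apply/cap_stereo; [apply: uo; case/andP: xx|exact: uc].
  - have x1x : 0 <= x1 <= x1 by rewrite x10 lexx.
    exists (stereo (u x1)); split; first by exists x1 => //; rewrite /= in_itv.
    exists t1 => //; apply/esym.
    have kx : cap (stereo (u x1)) by apply/cap_stereo; [exact: uo|exact: uc].
    apply: cap_boundary => //; rewrite sigma_stereo; last exact: uo.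
    by rewrite dot3Zl uE x1E divfK ?subrr ?mulr0 // lt_eqF.
have -> : cap = \bigcup_(A in [set A | [/\ connected A, A `<=` cap & G `<=` A]]) A.
  apply/seteqP; split => [w kw|w [A [_ Acap _] Aw]]; last exact: Acap.
  have [A cA [Aw Acap AG]] := path w kw.
  exists (A `|` G); last by left.
  split; [exact: connectedU| |by right].
  by move=> z [/Acap//|[t _ <-]]; exact: cap_curve.
apply: bigcup_connected; last by move=> A [].
by exists (stereo (nu 0)) => A [_ _ GA]; apply: GA; exists 0.
Qed.

(** Along the positive axis the third coordinate of [sigma] grows quadratically and the first
    linearly. The threshold makes [(x - 1) z > 2], and multiplying by [x + 1] beats the linear term,
    which is at most [2 x]. *)
Lemma cap_bounded_far : ~ cone north -> exists M : R, forall x, M < x -> ~ cap (x, 0).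
Proof.
move=> nn; have [t ht] : exists t, 0 < g t 0 2%:R.
  apply: contrapT => h; apply: nn => t; rewrite dot_north leNgt; apply/negP => h'.
  by apply: h; exists t.
exists (1 + 2 / g t 0 2%:R) => x xM /(_ t); have [e0 e1 e2] := sigmaE (x, 0).
rewrite dot3E e0 e1 e2 /=; have := dot3_unit_le 0 (gg t).
have k : 2 / g t 0 2%:R * g t 0 2%:R = 2 by rewrite divfK // gt_eqF.
have k0 : 0 < 2 / g t 0 2%:R by rewrite divr_gt0.
rewrite ler_norml => /andP[].
move: k k0 ht xM; move: (2 / g t 0 2%:R) (g t 0 0) (g t 0 1) (g t 0 2%:R) => r a b z k k0 z0 xr a1 a2.
rewrite leNgt => /negP; apply.
have x1 : 1 < x by lra.
have h : 2 < (x - 1) * z by rewrite -k ltr_pM2r //; lra.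
have : 2 * (x + 1) < (x - 1) * z * (x + 1) by rewrite ltr_pM2r //; lra.
nra.
Qed.

Lemma cap_unbounded_far : cone north -> exists M : R, forall x, M < x -> cap (x, 0).
Proof.
move=> cn; have ns := north_strict cn.
have [t0 _ H0] := max_on_period (cg (i := 2%:R)).
have z0 := ns t0; exists (1 - 2 / g t0 0 2%:R) => x xM t.
have [t' t'P <-] := red t; have := H0 _ t'P; have [e0 e1 e2] := sigmaE (x, 0).
rewrite dot3E e0 e1 e2 /=; have := dot3_unit_le 0 (gg t').
have k : 2 / g t0 0 2%:R * g t0 0 2%:R = 2 by rewrite divfK // lt_eqF.
rewrite ler_norml => /andP[].
move: k z0 xM; move: (2 / g t0 0 2%:R) => r; move: (g t' 0 0) (g t' 0 1) (g t' 0 2%:R) (g t0 0 2%:R).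
move=> a b z y k y0 xr a1 a2 zy.
have r0 : r < 0 by nra.
have x1 : 1 < x by lra.
have h : (x - 1) * y < - 2 by rewrite -k -mulNr ltr_nM2r //; lra.
have h2 : (x - 1) * y * (x + 1) < - 2 * (x + 1) by rewrite ltr_pM2r //; lra.
have : (x ^+ 2 - 1) * z <= (x ^+ 2 - 1) * y by rewrite ler_pM2l //; nra.
nra.
Qed.

End Cap.
End Stereographic.

(** * From the strip to the annulus: images, caps and the pole *)

Section CappedAnnulus.
Variables (R : realType) (L : R) (O : set (R * R)) (X N : R * R -> 'rV[R]_3) (h : R * R -> R * R).
Local Notation P := (pi *+ 2).
Local Notation on_bd s := (s = 0 \/ s = L).
Local Notation cone s v := (forall t, dot v (X (s, t)) <= 0).
Local Notation gauss p := (N p 0 0 / (1 - N p 0 2%:R), N p 0 1 / (1 - N p 0 2%:R)).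
Hypotheses (L_gt0 : 0 < L) (oO : open O).
Hypothesis SO : forall p : R * R, 0 <= p.1 <= L -> O p.
Hypothesis XP : forall s t, X (s, t + P) = X (s, t).
Hypothesis cX : forall s i, on_bd s -> continuous (fun t : R => X (s, t) 0 i).
Hypothesis cN : forall s i, on_bd s -> continuous (fun t : R => N (s, t) 0 i).
Hypothesis XX : forall s t, on_bd s -> dot (X (s, t)) (X (s, t)) = 1.
Hypothesis NN : forall p, O p -> dot (N p) (N p) = 1.
Hypothesis XN : forall s t, on_bd s -> dot (X (s, t)) (N (s, t)) = 0.
Hypothesis cone_N : forall s t, on_bd s -> cone s (N (s, t)).
Hypothesis touch : forall s t v, on_bd s -> cone s v -> dot v (X (s, t)) = 0 ->
  v = dot v (N (s, t)) *: N (s, t) /\ 0 <= dot v (N (s, t)).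
Hypothesis convex : forall s t0 t, on_bd s -> t0 < t < t0 + P -> dot (X (s, t)) (N (s, t0)) < 0.
Hypothesis convex_mod : forall s t0 t, on_bd s ->
  dot (X (s, t)) (N (s, t0)) < 0 \/ exists k : int, t = t0 + k%:~R * P.
Hypothesis disjoint : forall v : 'rV[R]_3, v <> 0 -> cone 0 v -> cone L v -> False.
Hypothesis side : forall s t sg, (s = 0 /\ sg = -1) \/ (s = L /\ sg = 1) ->
  exists2 e : R, 0 < e & forall x y, `|x - s| < e -> `|y - t| < e ->
    O (x, y) /\ (0 <= sg * (x - s) -> cone s (N (x, y))) /\
    (sg * (x - s) < 0 -> 0 < dot (N (x, y)) (X (s, y))).
Hypothesis omit : forall p, O p -> N p 0 2%:R != 1.
Hypothesis gauss_inj : forall p : R * R, 0 <= p.1 <= L -> exists2 B, nbhs p B &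
  forall q q', B q -> B q' -> gauss q = gauss q' -> q = q'.
Hypothesis gauss_open : forall (p : R * R) B, 0 <= p.1 <= L -> nbhs p B ->
  nbhs (gauss p) ((fun q => gauss q) @` B).
Hypothesis gauss_cont : forall p, O p -> {for p, continuous (fun q => gauss q)}.
Hypothesis hG : forall p, O p -> h (polar p) = gauss p.

Let P_gt0 : 0 < P :> R. Proof. by rewrite mulrn_wgt0 // pi_gt0. Qed.

Let A := annulus (expR L).
Let d s : set (R * R) := circle (expR s).
Let K s := cap (fun t => X (s, t)).
Let Z := @polar R @` [set p : R * R | 0 <= p.1 <= L].

Let lt_sq (a b : R) : (expR a ^+ 2 < expR b ^+ 2) = (a < b).
Proof. by rewrite ltr_sqr ?nnegrE ?expR_ge0 // ltr_expR. Qed.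

Let A_polar p : A (polar p) <-> 0 < p.1 < L.
Proof. by rewrite /A /annulus /= polar_norm lt_sq -[1](expr1n R 2) -(@expR0 R) lt_sq. Qed.

Let d_polar s t : d s (polar (s, t)).
Proof. by rewrite /d /circle /= (polar_norm (s, t)). Qed.

Let AP q : A q -> exists2 p, 0 < p.1 < L & q = polar p.
Proof.
move=> Aq; have [|p qE _] := @polar_surjective R q.
  by move: Aq; rewrite /A /annulus /= => /andP[h1 _]; apply: lt_trans h1.
by exists p => //; apply/A_polar; rewrite -qE.
Qed.

Let dP s q : d s q -> exists t, q = polar (s, t).
Proof.
move=> dq; have [|[s' t] qE _] := @polar_surjective R q.
  by move: dq; rewrite /d /circle /= => ->; rewrite exprn_gt0 // expR_gt0.
exists t; move: dq; rewrite qE /d /circle /= (polar_norm (s', t)) /= => E.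
suff -> : s' = s by [].
by apply: le_anti; rewrite !leNgt -(lt_sq s s') -(lt_sq s' s) E ltxx.
Qed.

Let bd0 : on_bd (0 : R). Proof. by left. Qed.
Let bdL : on_bd L. Proof. by right. Qed.
Let bdS (s t : R) : on_bd s -> 0 <= (s, t).1 <= L.
Proof. by move=> [->|->] /=; rewrite lexx ltW. Qed.
Let bdO (s t : R) : on_bd s -> O (s, t). Proof. by move=> sbd; exact: SO (bdS t sbd). Qed.

Let ZE : A `|` (d 0 `|` d L) = Z.
Proof.
apply/seteqP; split => [q [/AP[p /andP[p1 p2] ->]|[/dP[t ->]|/dP[t ->]]]|_ [[s t] /= /andP[s0 sL] <-]].
- by exists p => //=; rewrite !ltW.
- by exists (0, t) => //; exact: bdS.
- by exists (L, t) => //; exact: bdS.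
- move: s0 sL; rewrite !le_eqVlt => /orP[/eqP<- _|s0 /orP[/eqP->|sL]].
  + by right; left; exact: d_polar.
  + by right; right; exact: d_polar.
  + by left; apply/A_polar; rewrite /= s0.
Qed.

Let Z_compact : compact Z.
Proof.
have -> : Z = @polar R @` (`[0, L] `*` `[0, P]).
  apply/seteqP; split => [_ [[s t] /= pS <-]|_ [[s t] [/= sI _] <-]]; last first.
    by exists (s, t) => //; move: sI; rewrite /= in_itv.
  have [k kP] := period_reduce P_gt0 t; exists (s, t + k%:~R * P).
    by split; rewrite /= in_itv.
  by rewrite (periodic_int (@polar_periodic R)).
apply: continuous_compact; first by apply: continuous_subspaceT; exact: polar_continuous.
by apply: compact_setX; exact: segment_compact.
Qed.

Let vnorm_N p : O p -> vnorm (N p) = 1.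
Proof. by move=> Op; rewrite /vnorm NN // sqrtr1. Qed.

Let N_off p : O p -> N p 0 2%:R < vnorm (N p).
Proof.
move=> Op; rewrite vnorm_N // lt_neqAle omit //=.
exact: le_trans (ler_norm _) (dot3_unit_le 2%:R (NN Op)).
Qed.

Let hE p : O p -> h (polar p) = stereo (N p).
Proof. by move=> Op; rewrite hG // /stereo vnorm_N. Qed.

Let K_h s p : O p -> K s (h (polar p)) <-> cone s (N p).
Proof. by move=> Op; rewrite hE //; apply: cap_stereo; exact: N_off. Qed.

Let LI q : Z q -> exists2 B, nbhs q B & forall q1 q2, B q1 -> B q2 -> h q1 = h q2 -> q1 = q2.
Proof.
move=> [p pS <-]; have [B nB HB] := gauss_inj pS.
have nO : nbhs p O by apply: open_nbhs_nbhs; split=> //; exact: SO.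
exists (@polar R @` (B `&` O)); first by apply: polar_open; exact: filterI.
by move=> _ _ [p1 [B1 O1] <-] [p2 [B2 O2] <-]; rewrite !hG // => /HB ->.
Qed.

Let LS q B : Z q -> nbhs q B -> nbhs (h q) (h @` B).
Proof.
move=> [p pS <-] nB.
have nO : nbhs p O by apply: open_nbhs_nbhs; split=> //; exact: SO.
rewrite hG; last exact: SO.
have nB' : nbhs p (@polar R @^-1` B `&` O) by apply: filterI => //; exact: polar_continuous nB.
apply: filterS (gauss_open pS nB') => _ [p' [Bp' Op'] <-].
by exists (polar p') => //; rewrite hG.
Qed.

Let ch q : Z q -> {for q, continuous h}.
Proof.
move=> [p pS <-]; have Op := SO pS; move=> B; rewrite /= hG // => nB.
have nO : nbhs p O by apply: open_nbhs_nbhs.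
have n1 : nbhs p ((fun q => gauss q) @^-1` B `&` O) by apply: filterI => //; exact: (gauss_cont Op).
apply: filterS (polar_open n1) => _ [p' [Bp' Op'] <-] /=.
by rewrite hG.
Qed.

Let bd_side s q : on_bd s -> d s q ->
  exists2 B, nbhs q B & forall q', B q' -> (A q' <-> ~ K s (h q')).
Proof.
move=> sbd /dP[t ->].
have [sg sgP] : exists sg : R, (s = 0 /\ sg = -1) \/ (s = L /\ sg = 1).
  by case: sbd => ->; [exists (-1); left|exists 1; right].
have [e e0 He] := side t sgP.
(* With a radius at most [L] the box does not reach the other boundary line, so the sign of
   [sg * (x - s)] alone decides membership in the strip. *)
pose e' := Num.min e L.
have e'0 : 0 < e' by rewrite lt_min e0.
exists (@polar R @` [set p | `|p.1 - s| < e' /\ `|p.2 - t| < e']).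
  by apply: polar_open; apply: (nbhs_box e'0) => x y.
move=> _ [[x y] /= [hx hy] <-]; move: hx hy; rewrite !lt_min => /andP[x1 x2] /andP[y1 _].
have [Oxy [out inn]] := He _ _ x1 y1.
have E : 0 < x < L <-> sg * (x - s) < 0.
  move: x2; rewrite ltr_norml => /andP[].
  case: sgP => -[-> ->] h1 h2; split => [/andP[h3 h4]|h3]; try (apply/andP; split); lra.
rewrite A_polar /= E K_h //; split=> [lt0 /(_ y)|ncone].
  by rewrite leNgt inn.
by rewrite ltNge; apply/negP => /out.
Qed.

Let bd_closure s : on_bd s -> d s `<=` closure A.
Proof.
move=> sbd q /dP[t ->] B nB.
have [e e0 He] := box_nbhs (polar_continuous nB).
pose r := Num.min e L / 2.
have m0 : 0 < Num.min e L by rewrite lt_min e0.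
have m1 : Num.min e L <= e by rewrite ge_min lexx.
have m2 : Num.min e L <= L by rewrite ge_min lexx orbT.
have [x xI xs] : exists2 x, 0 < x < L & `|x - s| < e.
  case: sbd => ->; [exists r|exists (L - r)]; rewrite ?ltr_norml /r;
    by apply/andP; split; lra.
exists (polar (x, t)); split; first exact/A_polar.
by apply: He => //=; rewrite subrr normr0.
Qed.

Let A_open : open A.
Proof.
rewrite openE => q /AP[p pI ->].
have nI : nbhs p [set p : R * R | 0 < p.1 < L].
  by apply: open_nbhs_nbhs; split=> //; exact: strip_open.
by apply: filterS (polar_open nI) => _ [p' pI' <-]; exact/A_polar.
Qed.

Let lin_cont (a b : R) : continuous (fun x : R => a + x * b).
Proof.
move=> x; have := is_derive1D (is_derive_cst a x (1 : R))
  (is_derive1M (is_derive_id x (1 : R)) (is_derive_cst b x (1 : R))).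
exact: is_derive1_continuous.
Qed.

Let A_connected : connected A.
Proof.
have -> : A = @polar R @` [set p : R * R | 0 < p.1 < L].
  apply/seteqP; split => [q /AP[p pI ->]|_ [p pI <-]]; last exact/A_polar.
  by exists p.
apply: connected_continuous_connected; last by apply: continuous_subspaceT; exact: polar_continuous.
apply: (@starlike_connected _ R _ (L / 2, 0)).
  by have := L_gt0; move: (L) => l hl; rewrite /=; apply/andP; split; lra.
move=> [s t] /= /andP[s0 sL].
exists (fun x => (L / 2 + x * (s - L / 2), 0 + x * t)); split.
- apply: continuous_subspaceT => x; exact: cvg_pair (@lin_cont _ _ x) (@lin_cont _ _ x).
- by rewrite !mul0r !addr0.
- by rewrite !mul1r add0r addrCA subrr addr0.
- by move=> x /andP[x0 x1] /=; apply/andP; split; nra.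
Qed.

Let plane_connected : connected [set: R * R].
Proof.
apply: (@starlike_connected _ R _ (0, 0)) => // -[s t] _.
exists (fun x => (0 + x * s, 0 + x * t)); split=> //.
- apply: continuous_subspaceT => x; exact: cvg_pair (@lin_cont _ _ x) (@lin_cont _ _ x).
- by rewrite !mul0r !addr0.
- by rewrite !mul1r !add0r.
Qed.

Let plane_hausdorff : hausdorff_space (R * R)%type.
Proof. exact: (@norm_hausdorff R (R * R)%type). Qed.

Let K_disjoint w : K 0 w -> K L w -> False.
Proof. by move=> k0 kL; exact: (disjoint (@sigma_neq0 R w)). Qed.

Let h_bd s q : on_bd s -> d s q -> K s (h q).
Proof. by move=> sbd /dP[t ->]; apply/K_h; [exact: bdO|exact: cone_N]. Qed.

(** Equal normals at [t] and [t'] would make [X (s, t')] orthogonal to [N (s, t)], which strict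
    convexity allows only modulo the period. *)
Let h_inj s q q' : on_bd s -> d s q -> d s q' -> h q = h q' -> q = q'.
Proof.
move=> sbd /dP[t ->] /dP[t' ->]; rewrite !hE; [|exact: bdO..].
move=> /(cap_curve_inj (nu := fun t => N (s, t)) (fun t => NN (bdO t sbd)) (fun t => omit (bdO t sbd))) E.
have [H|[k ->]] := convex_mod t t' sbd; last by rewrite (periodic_int (@polar_periodic R)).
by move: H; rewrite E XN // ltxx.
Qed.

Let K_interior s w : on_bd s -> K s w -> ~ (h @` d s) w -> nbhs w (K s).
Proof.
move=> sbd kw nw; apply: (cap_interior (nu := fun t => N (s, t)) P_gt0) => //.
- by move=> i; exact: cX.
- by move=> t; exact: XX.
- by move=> t v; exact: touch.
- by move=> [t wE]; apply: nw; exists (polar (s, t)); [exact: d_polar|rewrite wE hE //; exact: bdO].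
Qed.

Let K_connected s : on_bd s -> connected (K s).
Proof.
move=> sbd; have [cn|ncn] := pselect (cone s (@north R)).
  apply: (cap_unbounded_connected (nu := fun t => N (s, t)) P_gt0) => //.
  - by move=> i; exact: cX.
  - by move=> i; exact: cN.
  - by move=> t; exact/NN/bdO.
  - by move=> t; exact: cone_N.
  - by move=> t v; exact: touch.
  - by move=> t; exact/omit/bdO.
apply: (cap_bounded_connected (nu := fun t => N (s, t))) => //.
- by move=> t; exact/NN/bdO.
- by move=> t; exact: cone_N.
- move=> t; exists (t + P / 2); rewrite dot3C; apply: convex => //.
  by have := P_gt0; move: (P) => p hp; apply/andP; split; lra.
- by move=> t; exact/omit/bdO.
Qed.

Let h_bounded : exists M : R, forall x, M < x -> ~ (h @` Z) (x, 0).
Proof.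
have : compact ((fun q => (h q).1) @` Z).
  apply: continuous_compact => //; apply: continuous_in_subspaceT => q /[!inE] Zq.
  by apply: (@continuous_comp _ _ _ h fst); [exact: ch|exact: cvg_fst].
move=> /compact_bounded [M [_ HM]]; exists (`|M| + 1) => x Mx [q Zq hq].
have h1 : M < `|M| + 1 by have := ler_norm M; lra.
have : `|x| <= `|M| + 1 by apply: (HM _ h1); exists q => //; rewrite hq.
by rewrite leNgt (lt_le_trans Mx (ler_norm _)).
Qed.

Let cover w : (h @` A) w \/ K 0 w \/ K L w.
Proof.
have [e c LS' c'] : [/\ Z = A `|` (d 0 `|` d L), compact (A `|` (d 0 `|` d L)),
    forall q B, (A `|` (d 0 `|` d L)) q -> nbhs q B -> nbhs (h q) (h @` B) &
    forall q, (A `|` (d 0 `|` d L)) q -> {for q, continuous h}] by rewrite ZE; split.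
exact: (capped_cover plane_hausdorff c c' LS' (fun q => @bd_side 0 q bd0) (fun q => @bd_side L q bdL)
  (@cap_closed R _) (@cap_closed R _) (fun w => @K_interior 0 w bd0) (fun w => @K_interior L w bdL)
  (fun q => @h_bd 0 q bd0) (fun q => @h_bd L q bdL) A_open (d_polar 0 0) plane_connected).
Qed.

(* Far away points of the plane are not in the bounded image of the closed
   annulus, hence in one of the caps: that cap contains the north pole. *)
Let north_in_cone : cone 0 (@north R) \/ cone L (@north R).
Proof.
apply: contrapT => /not_orP[n0 nL].
have [M0 H0] := cap_bounded_far (g := fun t => X (0, t)) (fun t => XX t bd0) n0.
have [M1 H1] := cap_bounded_far (g := fun t => X (L, t)) (fun t => XX t bdL) nL.
have [M HM] := h_bounded.
pose x := Num.max M (Num.max M0 M1) + 1.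
have [x0 x1 x2] : [/\ M < x, M0 < x & M1 < x].
  have a0 : M <= Num.max M (Num.max M0 M1) by rewrite le_max lexx.
  have a1 : M0 <= Num.max M (Num.max M0 M1) by rewrite !le_max lexx orbT.
  have a2 : M1 <= Num.max M (Num.max M0 M1) by rewrite !le_max lexx !orbT.
  by rewrite /x; split; lra.
have [[q Aq hq]|[k|k]] := cover (x, 0).
- by apply: (HM _ x0); exists q => //; rewrite -ZE; left.
- exact: H0 x1 k.
- exact: H1 x2 k.
Qed.

(** The topological argument needs as first cap one that the compact image cannot contain. The cap
    with the pole qualifies, and it may belong to either circle. *)
Let annulus_gauss_from s s' : (s = 0 /\ s' = L) \/ (s = L /\ s' = 0) -> cone s (@north R) ->
  injective_on A h /\ region_bounded_by (h @` A) (h @` d s) (h @` d s').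
Proof.
move=> ss cn.
have sbd : on_bd s by case: ss => -[-> _]; [left|right].
have sbd' : on_bd s' by case: ss => -[_ ->]; [right|left].
have E : A `|` (d s `|` d s') = Z by case: ss => -[-> ->]; rewrite -ZE // (setUC (d L)).
have cZ : compact (A `|` (d s `|` d s')) by rewrite E.
have chs q : (A `|` (d s `|` d s')) q -> {for q, continuous h} by rewrite E; exact: ch.
have LI' q : (A `|` (d s `|` d s')) q -> exists2 B, nbhs q B &
    forall q1 q2, B q1 -> B q2 -> h q1 = h q2 -> q1 = q2 by rewrite E; exact: LI.
have LS' q B : (A `|` (d s `|` d s')) q -> nbhs q B -> nbhs (h q) (h @` B) by rewrite E; exact: LS.
have K12 w : K s w -> K s' w -> False.
  by case: ss => -[-> ->] k k'; [exact: K_disjoint k k'|exact: K_disjoint k' k].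
have unb : ~ (K s `<=` h @` (A `|` (d s `|` d s'))).
  rewrite E => sub; have [M HM] := h_bounded.
  have [||||||M' HM'] :=
    cap_unbounded_far (g := fun t => X (s, t)) (nu := fun t => N (s, t)) P_gt0 _ _ _ _ _ _ cn.
  - by move=> i; exact: cX.
  - by move=> t; exact: XP.
  - by move=> t; exact: XX.
  - by move=> t; exact/NN/bdO.
  - by move=> t v; exact: touch.
  - by move=> t; exact/omit/bdO.
  pose x := Num.max M M' + 1.
  have a0 : M < x by rewrite /x; have : M <= Num.max M M' by [rewrite le_max lexx]; lra.
  have a1 : M' < x by rewrite /x; have : M' <= Num.max M M' by [rewrite le_max lexx orbT]; lra.
  exact: HM _ a0 (sub _ (HM' _ a1)).
have B1 q := @bd_side s q sbd; have B2 q := @bd_side s' q sbd'.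
have c1 : closed (K s) := @cap_closed R _; have c2 : closed (K s') := @cap_closed R _.
have i1 w := @K_interior s w sbd; have i2 w := @K_interior s' w sbd'.
have g1 q := @h_bd s q sbd; have g2 q := @h_bd s' q sbd'.
have j1 q q' := @h_inj s q q' sbd; have j2 q q' := @h_inj s' q q' sbd'.
have cl1 := bd_closure sbd; have cl2 := bd_closure sbd'.
have kc1 := K_connected sbd; have kc2 := K_connected sbd'.
have hP := plane_hausdorff; have p1 := d_polar s 0; have p2 := d_polar s' 0.
split=> [q q'|].
  exact: (capped_injective hP hP cZ chs LI' LS' B1 B2 c1 c2 K12 i2 g1 g2 j1 j2 A_open cl1 cl2
    p1 p2 A_connected kc1 kc2 unb).
split; first exact: (capped_open_image LS' A_open).
split; first split.
- exact: (capped_image_closure chs cl1 cl2 A_connected (@subset_refl _ A) (@subsetUl _ A _)).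
- exact: (capped_complement_components hP hP cZ chs LI' LS' B1 B2 c1 c2 K12 i1 i2 g1 g2 j1 j2
    A_open cl1 cl2 p1 p2 A_connected kc1 kc2 unb plane_connected).
split; last exact: (capped_closure hP cZ chs cl1 cl2).
rewrite -subset0 => w [Aw [[q dq hq]|[q dq hq]]].
- apply: (capped_miss1 hP hP cZ chs LS' B1 c1 K12 g2 A_open kc1 unb Aw).
  by rewrite -hq; exact: g1.
- apply: (capped_miss2 hP hP cZ chs LI' LS' B1 B2 c1 c2 K12 i2 g1 g2 j1 j2 A_open cl1 cl2
    p1 p2 A_connected kc1 kc2 unb Aw).
  by rewrite -hq; exact: g2.
Qed.

Lemma annulus_gauss : injective_on (annulus (expR L)) h /\
  region_bounded_by (h @` annulus (expR L)) (h @` circle 1) (h @` circle (expR L)).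
Proof.
have -> : h @` circle 1 = h @` d 0 by rewrite /d expR0.
have [n0|nL] := north_in_cone.
  by apply: annulus_gauss_from => //; left.
have [|inj [oA [dA [disj clA]]]] := @annulus_gauss_from L 0 _ nL; first by right.
by split=> //; split=> //; split=> //; rewrite (setUC (h @` d 0)) -setUA (setUC (h @` d 0)) setUA.
Qed.

End CappedAnnulus.

(** * Free boundary minimal strips *)

Section FreeBoundaryStrip.
Variables (R : realType) (L P : R) (O : set (R * R)) (X : R * R -> 'rV[R]_3).
Hypotheses (L_gt0 : 0 < L) (P_gt0 : 0 < P) (oO : open O).
Hypothesis SO : forall p : R * R, 0 <= p.1 <= L -> O p.
Hypothesis smX : forall n, smv O n X.
Hypothesis XP : forall s t, X (s, t + P) = X (s, t).

Local Notation S := [set p : R * R | 0 <= p.1 <= L].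
Local Notation I := [set p : R * R | 0 < p.1 < L].
Local Notation bd := [set p : R * R | p.1 = 0 \/ p.1 = L].
Local Notation Xs := (vs X).
Local Notation Xt := (vt X).
Local Notation a := (vs (vs X)).
Local Notation b := (vt (vs X)).
Local Notation n := (fun p => crs (vs X p) (vt X p)).
Local Notation W := (fun p => dot (vs X p) (vs X p)).

Hypothesis imm : forall p, O p -> n p <> 0.
Hypothesis conf : forall p, S p -> dot (Xs p) (Xs p) = dot (Xt p) (Xt p) /\
  dot (Xs p) (Xt p) = 0.
Hypothesis minimal : forall p, I p -> dot (a p + vt Xt p) (n p) = 0.
Hypothesis inside : forall p, I p -> dot (X p) (X p) < 1.
Hypothesis on_sphere : forall p, bd p -> dot (X p) (X p) = 1.
Hypothesis orthogonal : forall p, bd p -> dot (n p) (X p) = 0.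

Let sXs k : smv O k Xs. Proof. exact: (smv_vs oO (smX k.+1)). Qed.
Let sXt k : smv O k Xt. Proof. exact: (smv_vt oO (smX k.+1)). Qed.
Let sa k : smv O k a. Proof. exact: (smv_vs oO (sXs k.+1)). Qed.
Let sb k : smv O k b. Proof. exact: (smv_vt oO (sXs k.+1)). Qed.
Let sXtt k : smv O k (vt Xt). Proof. exact: (smv_vt oO (sXt k.+1)). Qed.
Let sn k : smv O k n. Proof. exact: (smv_cross (sXs k) (sXt k)). Qed.
Let sW k : sm O k W. Proof. exact: (sm_dot (sXs k) (sXs k)). Qed.
Let oI : open I. Proof. exact: strip_open. Qed.
Let IO p : I p -> O p. Proof. exact: strip_sub. Qed.
Let IS p : I p -> S p. Proof. by move=> /andP[h1 h2] /=; rewrite !ltW. Qed.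
Let bdS p : bd p -> S p.
Proof. by move=> /= -[] ->; rewrite lexx ltW. Qed.
Let cdot A B p : (forall k, smv O k A) -> (forall k, smv O k B) -> O p ->
  {for p, continuous (fun q => dot (A q) (B q))}.
Proof. by move=> sA sB; apply: sm_continuous; apply: (@sm_dot _ _ 0%N). Qed.

Lemma strip_W_gt0 p : O p -> 0 < W p.
Proof.
move=> Op; rewrite lt_neqAle dot3_ge0 andbT eq_sym; apply/eqP => W0.
apply: (imm Op); apply: dot3_eq0; rewrite cross_norm W0 mul0r sub0r.
by have -> : Xs p = 0 by [exact: dot3_eq0]; rewrite dot3E !mxE; ring.
Qed.

Let nn p : S p -> dot (n p) (n p) = W p ^+ 2.
Proof. by move=> /conf[e1 e2]; rewrite cross_norm -e1 e2; ring. Qed.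

(** Expansion in the orthogonal frame [Xs], [Xt], [n] with squared lengths [W], [W], [W ^+ 2],
    cleared of denominators. *)
Lemma strip_frame p u v : S p -> dot u v * W p ^+ 2 = dot u (n p) * dot v (n p)
    + W p * (dot u (Xs p) * dot v (Xs p) + dot u (Xt p) * dot v (Xt p)).
Proof.
move=> Sp; rewrite -nn // cross_frame; have [e1 e2] := conf Sp.
by rewrite -e1 e2; ring.
Qed.

Let frame_eq0 p u : S p -> dot u (n p) = 0 -> dot u (Xs p) = 0 -> dot u (Xt p) = 0 -> u = 0.
Proof.
move=> Sp h1 h2 h3; apply: dot3_eq0; have W0 := strip_W_gt0 (SO Sp).
have := strip_frame u u Sp; rewrite h1 h2 h3 !mul0r addr0 mulr0 addr0 => /eqP.
by rewrite mulf_eq0 expf_eq0 /= (gt_eqF W0) orbF => /eqP.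
Qed.

Let st p : O p -> vs Xt p = b p.
Proof. by move=> Op; rewrite (vschwarz oO (smX 2) Op). Qed.

(** Conformality is known only on the closed strip and cannot be differentiated across its edge.
    Identities are derived on the open strip and then extended by continuity. *)
Let I_ext (f g : R * R -> R) : (forall p, O p -> {for p, continuous f}) ->
  (forall p, O p -> {for p, continuous g}) -> (forall p, I p -> f p = g p) ->
  forall p, S p -> f p = g p.
Proof.
move=> cf cg fg p Sp; apply/eqP; rewrite -subr_eq0; apply/eqP.
apply: (strip_closure L_gt0 SO (f := fun p => f p - g p)) Sp => [q Oq|q Iq].
  by apply: continuousB; [exact: cf|exact: cg].
by rewrite fg // subrr.
Qed.

Lemma strip_conf1 p : I p -> dot (a p) (Xs p) = dot (b p) (Xt p).
Proof.
move=> Ip; have Op := IO Ip.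
have := ds_ext (p := p) oI (fun q Iq => (conf (IS Iq)).1) Ip.
rewrite !(ds_dot (n := 0%N) _ _ Op) // st // !(dot3C _ (a p)) !(dot3C _ (b p)); lra.
Qed.

Lemma strip_conf2 p : I p -> dot (b p) (Xs p) = dot (vt Xt p) (Xt p).
Proof.
move=> Ip; have Op := IO Ip.
have := dt_ext (p := p) oI (fun q Iq => (conf (IS Iq)).1) Ip.
rewrite !(dt_dot (n := 0%N) _ _ Op) // !(dot3C _ (vt Xt p)) !(dot3C _ (b p)); lra.
Qed.

Lemma strip_conf3 p : I p -> dot (a p) (Xt p) = - dot (b p) (Xs p).
Proof.
move=> Ip; have Op := IO Ip.
have := ds_zero_on (p := p) oI (fun q Iq => (conf (IS Iq)).2) Ip.
rewrite (ds_dot (n := 0%N) _ _ Op) // st // !(dot3C _ (b p)); lra.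
Qed.

Lemma strip_conf4 p : I p -> dot (b p) (Xt p) = - dot (vt Xt p) (Xs p).
Proof.
move=> Ip; have Op := IO Ip.
have := dt_zero_on (p := p) oI (fun q Iq => (conf (IS Iq)).2) Ip.
rewrite (dt_dot (n := 0%N) _ _ Op) // !(dot3C _ (vt Xt p)); lra.
Qed.

(** The derivatives of the conformality relations kill the tangential part of the Laplacian, and
    minimality its normal part. *)
Lemma strip_harmonic_in p : I p -> vt Xt p = - a p.
Proof.
move=> Ip; apply/eqP; rewrite -subr_eq0 opprK addrC; apply/eqP.
have := (strip_conf1 Ip, strip_conf2 Ip, strip_conf3 Ip, strip_conf4 Ip).
move=> [[[h1 h2] h3] h4].
apply: (frame_eq0 (IS Ip)); first exact: minimal.
- by rewrite dot3Dl h1 h4 addNr.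
- by rewrite dot3Dl h3 h2 addNr.
Qed.

Lemma strip_harmonic p : S p -> vt Xt p = - a p.
Proof.
move=> Sp; apply/rowP => i.
apply: (I_ext (f := fun q => vt Xt q 0 i) (g := fun q => (- a q) 0 i)) Sp => q Oq.
- exact: (sm_continuous (sXtt 0 i) Oq).
- have := sm_continuous (sm_opp (sa 0 i)) Oq.
  by have -> : (fun r => (- a r) 0 i) = (fun r => - a r 0 i) by apply/funext => r; rewrite mxE.
- by rewrite strip_harmonic_in.
Qed.

Let conf1 p : S p -> dot (a p) (Xs p) = dot (b p) (Xt p).
Proof.
by apply: (I_ext (f := fun p => dot (a p) (Xs p)) (g := fun p => dot (b p) (Xt p)));
  [move=> q; exact: cdot|move=> q; exact: cdot|exact: strip_conf1].
Qed.

Let conf3 p : S p -> dot (a p) (Xt p) = - dot (b p) (Xs p).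
Proof.
apply: (I_ext (f := fun p => dot (a p) (Xt p)) (g := fun p => - dot (b p) (Xs p))).
- by move=> q; exact: cdot.
- by move=> q Oq; apply: continuousN; exact: cdot.
- exact: strip_conf3.
Qed.

Let at_ p : O p -> vt a p = vs b p.
Proof. by move=> Op; rewrite (vschwarz oO (sXs 2) Op). Qed.

Let bt_ p : I p -> vt b p = - vs a p.
Proof.
move=> Ip; have Op := IO Ip.
rewrite -(vsN (sa 1) Op) -(vs_ext oI strip_harmonic_in Ip).
by rewrite -(vschwarz oO (sXt 2) Op); apply/esym/(vt_ext oO) => // q; exact: st.
Qed.

Let sas k : smv O k (vs a). Proof. exact: (smv_vs oO (sa k.+1)). Qed.
Let sbs k : smv O k (vs b). Proof. exact: (smv_vs oO (sb k.+1)). Qed.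

(** For harmonic [X], [X_zz = (a - i b) / 2], so [X_zz . X_zz = (Qf - 2 i Pf) / 4]. The tangential
    part of [X_zz] is isotropic, so this is the square of the Hopf coefficient. *)
Let Pf p := dot (a p) (b p).
Let Qf p := dot (a p) (a p) - dot (b p) (b p).

Let Pf_s p : O p -> ds Pf p = dot (vs a p) (b p) + dot (a p) (vs b p).
Proof. by move=> Op; rewrite (ds_dot (n := 0%N) _ _ Op). Qed.

Let Pf_t p : I p -> dt Pf p = dot (vs b p) (b p) - dot (a p) (vs a p).
Proof.
move=> Ip; have Op := IO Ip.
by rewrite (dt_dot (n := 0%N) _ _ Op) // at_ // bt_ // (dot3C (a p)) dot3Nl (dot3C (a p)).
Qed.

Let sPf k : sm O k Pf. Proof. exact: (sm_dot (sa k) (sb k)). Qed.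

Let dsB (f g : R * R -> R) p : sm O 1 f -> sm O 1 g -> O p ->
  ds (fun q => f q - g q) p = ds f p - ds g p.
Proof.
move=> sf sg Op; have D := is_derive1B (sm_is_ds sf Op) (sm_is_ds sg Op).
exact: is_derive1_unique (sm_is_ds (sm_sub sf sg) Op) D.
Qed.

Let dtB (f g : R * R -> R) p : sm O 1 f -> sm O 1 g -> O p ->
  dt (fun q => f q - g q) p = dt f p - dt g p.
Proof.
move=> sf sg Op; have D := is_derive1B (sm_is_dt sf Op) (sm_is_dt sg Op).
exact: is_derive1_unique (sm_is_dt (sm_sub sf sg) Op) D.
Qed.

Lemma hopf_harmonic p : I p -> ds (ds Pf) p + dt (dt Pf) p = 0.
Proof.
move=> Ip; have Op := IO Ip.
have -> : ds (ds Pf) p = dot (vs (vs a) p) (b p) + dot (vs a p) (vs b p)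
    + (dot (vs a p) (vs b p) + dot (a p) (vs (vs b) p)).
  rewrite (ds_ext oO Pf_s Op) (dsD (O := O) (n := 0%N)) //; try exact: sm_dot.
  by rewrite !(ds_dot (n := 0%N) _ _ Op).
have -> : dt (dt Pf) p = dot (vt (vs b) p) (b p) + dot (vs b p) (vt b p)
    - (dot (vt a p) (vs a p) + dot (a p) (vt (vs a) p)).
  rewrite (dt_ext oI Pf_t Ip) dtB //; try exact: sm_dot.
  by rewrite !(dt_dot (n := 0%N) _ _ Op).
have e1 : vt (vs b) p = - vs (vs a) p.
  rewrite (vschwarz oO (sb 2) Op) -(vsN (sas 1) Op).
  exact: (vs_ext oI) Ip.
have e2 : vt (vs a) p = vs (vs b) p.
  rewrite (vschwarz oO (sa 2) Op); exact: (vs_ext oO) Op.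
rewrite e1 e2 at_ // bt_ // (dot3C (vs b p)) !dot3Nl (dot3C (vs b p)); ring.
Qed.

Lemma hopf_cauchy_riemann p : I p -> ds Qf p = - 2 * dt Pf p /\ dt Qf p = 2 * ds Pf p.
Proof.
move=> Ip; have Op := IO Ip; rewrite Pf_t // Pf_s //.
rewrite dsB //; try exact: sm_dot; rewrite dtB //; try exact: sm_dot.
rewrite !(ds_dot (n := 0%N) _ _ Op) // !(dt_dot (n := 0%N) _ _ Op) // at_ // bt_ //.
rewrite !(dot3C (a p)) !(dot3C (b p)) !dot3Nl; split; ring.
Qed.

(** * Behaviour on the boundary lines and constancy of the second fundamental form *)

Lemma boundary_tangent p : bd p -> dot (Xt p) (X p) = 0.
Proof.
move=> bp; have Op := SO (bdS bp).
have D := sm_is_dt (sm_dot (smX 1) (smX 1)) Op.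
have D' : is_derive p.2 1 (fun y => dot (X (p.1, y)) (X (p.1, y))) 0.
  have := is_derive_cst (1 : R) p.2 (1 : R); apply: is_derive1_ext => y.
  by rewrite on_sphere.
have := is_derive1_unique D D'; rewrite (dt_dot (n := 0%N) _ _ Op) //.
by rewrite (dot3C (X p)); lra.
Qed.

(** On the boundary [Xs] is [kappa] times the unit vector [X], so this is its signed length. *)
Definition kappa p := dot (Xs p) (X p).

Lemma boundary_radial p : bd p -> kappa p ^+ 2 = W p /\ Xs p = kappa p *: X p.
Proof.
move=> bp; have Sp := bdS bp; have W0 := strip_W_gt0 (SO Sp).
have F v : dot (X p) v * W p = kappa p * dot v (Xs p).
  have := strip_frame (X p) v Sp; rewrite (dot3C _ (n p)) orthogonal // mul0r add0r.
  rewrite (dot3C _ (Xt p)) boundary_tangent // mul0r addr0 => E.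
  apply: (mulIf (lt0r_neq0 W0)); rewrite -mulrA -expr2 E /kappa (dot3C (Xs p) (X p)); ring.
have k2 : kappa p ^+ 2 = W p.
  by have := F (X p); rewrite on_sphere // mul1r => ->; rewrite /kappa (dot3C (X p)); ring.
split=> //; apply/eqP; rewrite -subr_eq0; apply/eqP/dot3_eq0.
rewrite -scaleNr dot3Dl dot3Zl !(dot3C _ (Xs p + _)) !dot3Dl !dot3Zl.
rewrite on_sphere // (dot3C (X p)) -/(kappa p) -k2; ring.
Qed.

(** The boundary is a line of curvature: differentiating [Xs . n = 0] and [X . n = 0] along it, and
    using [Xs = kappa X], moves the derivative from [n] onto [X], and [Xt . n = 0]. *)
Lemma boundary_bn p : bd p -> dot (b p) (n p) = 0.
Proof.
move=> bp; have Op := SO (bdS bp).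
have e1 : dot (b p) (n p) + dot (Xs p) (vt n p) = 0.
  rewrite -(dt_dot (n := 0%N) _ _ Op) //.
  by apply: (dt_zero_on oO) => // q _; exact: dot_crossl.
have e2 : dot (Xt p) (n p) + dot (X p) (vt n p) = 0.
  have D := sm_is_dt (sm_dot (smX 1) (sn 1)) Op.
  have D' : is_derive p.2 1 (fun y => dot (X (p.1, y)) (n (p.1, y))) 0.
    have := is_derive_cst (0 : R) p.2 (1 : R); apply: is_derive1_ext => y.
    by rewrite dot3C orthogonal.
  by rewrite -(is_derive1_unique D D') (dt_dot (n := 0%N) _ _ Op).
have [_ E] := boundary_radial bp.
move: e1 e2; rewrite E dot3Zl -E dot_crossr add0r => + h.
by rewrite h mulr0 addr0.
Qed.

Let Pf_frame p : S p -> Pf p * W p ^+ 2 = dot (a p) (n p) * dot (b p) (n p).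
Proof.
move=> Sp; rewrite /Pf (strip_frame _ _ Sp) conf1 // conf3 //; ring.
Qed.

Let Qf_frame p : S p -> Qf p * W p ^+ 2 = dot (a p) (n p) ^+ 2 - dot (b p) (n p) ^+ 2.
Proof.
move=> Sp; rewrite /Qf mulrBl !(strip_frame _ _ Sp) -conf1 // conf3 //; ring.
Qed.

Let XsP : forall s t, Xs (s, t + P) = Xs (s, t) := vs_periodic XP.
Let XtP : forall s t, Xt (s, t + P) = Xt (s, t) := vt_periodic XP.
Let aP : forall s t, a (s, t + P) = a (s, t) := vs_periodic XsP.
Let bP : forall s t, b (s, t + P) = b (s, t) := vt_periodic XsP.

Lemma hopf_imag_zero p : S p -> Pf p = 0.
Proof.
have bd0 q : bd q -> Pf q = 0.
  move=> bq; have := Pf_frame (bdS bq); rewrite boundary_bn // mulr0 => /eqP.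
  by rewrite mulf_eq0 expf_eq0 /= (gt_eqF (strip_W_gt0 (SO (bdS bq)))) orbF => /eqP.
move=> Sp; apply/eqP; rewrite eq_le; apply/andP; split.
- have [|q Iq|p0 [b0 M0]] := strip_max_principle L_gt0 P_gt0 oO SO (sPf 2).
  + by move=> s t; rewrite /Pf aP bP.
  + by rewrite hopf_harmonic.
  + by rewrite -(bd0 _ b0); exact: M0.
- have [|q Iq|p0 [b0 M0]] := strip_max_principle L_gt0 P_gt0 oO SO (sm_opp (sPf 2)).
  + by move=> s t; rewrite /Pf aP bP.
  + have Op := IO Iq.
    have -> : ds (ds (fun q => - Pf q)) q = - ds (ds Pf) q.
      rewrite (ds_ext (g := fun r => - ds Pf r) oO) //.
        apply: is_derive1_unique (is_derive1N (sm_is_ds (sm_ds oO (sPf 2)) Op)).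
        exact: sm_is_ds (sm_opp (sm_ds oO (sPf 2))) Op.
      move=> r Or; apply: is_derive1_unique (is_derive1N (sm_is_ds (sPf 1) Or)).
      exact: sm_is_ds (sm_opp (sPf 1)) Or.
    have -> : dt (dt (fun q => - Pf q)) q = - dt (dt Pf) q.
      rewrite (dt_ext (g := fun r => - dt Pf r) oO) //.
        apply: is_derive1_unique (is_derive1N (sm_is_dt (sm_dt oO (sPf 2)) Op)).
        exact: sm_is_dt (sm_opp (sm_dt oO (sPf 2))) Op.
      move=> r Or; apply: is_derive1_unique (is_derive1N (sm_is_dt (sPf 1) Or)).
      exact: sm_is_dt (sm_opp (sPf 1)) Or.
    by rewrite -opprD hopf_harmonic // oppr0.
  + by have := M0 _ Sp; rewrite (bd0 _ b0); lra.
Qed.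

Lemma hopf_constant : exists k, 0 <= k /\ forall p, S p ->
  dot (a p) (n p) * dot (b p) (n p) = 0 /\
  dot (a p) (n p) ^+ 2 - dot (b p) (n p) ^+ 2 = k * W p ^+ 2.
Proof.
have Pz q : I q -> Pf q = 0 by move=> Iq; exact: hopf_imag_zero (IS Iq).
have sQ : sm O 1 Qf by apply: sm_sub; exact: sm_dot.
have [|| k kP] := strip_const L_gt0 SO sQ.
- move=> p Ip; have [-> _] := hopf_cauchy_riemann Ip.
  by rewrite (dt_zero_on oI Pz Ip) mulr0.
- move=> p Ip; have [_ ->] := hopf_cauchy_riemann Ip.
  by rewrite (ds_zero_on oI Pz Ip) mulr0.
exists k; have E p : S p -> dot (a p) (n p) * dot (b p) (n p) = 0 /\
    dot (a p) (n p) ^+ 2 - dot (b p) (n p) ^+ 2 = k * W p ^+ 2.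
  by move=> Sp; rewrite -Pf_frame // hopf_imag_zero // mul0r -Qf_frame // kP.
(* The sign of the constant is read off at a boundary point, where [b . n] vanishes. *)
split=> //; pose p0 : R * R := (0, 0).
have b0 : bd p0 by left.
have [_] := E p0 (bdS b0); rewrite boundary_bn // expr0n subr0 => h.
have W0 := strip_W_gt0 (SO (bdS b0)).
by rewrite -(pmulr_lge0 _ (exprn_gt0 2 W0)) -h sqr_ge0.
Qed.

(** Inside, [|X|^2] is below its boundary value 1, which gives the weak sign; [kappa ^+ 2 = W > 0]
    makes it strict. *)
Lemma kappa_right t : 0 < kappa (L, t).
Proof.
have bp : bd (L, t) by right.
have [k2 _] := boundary_radial bp; have W0 := strip_W_gt0 (SO (bdS bp)).
have D := sm_is_ds (sm_dot (smX 1) (smX 1)) (SO (bdS bp)).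
have : 0 <= 2 * kappa (L, t).
  move: D; rewrite (ds_dot (n := 0%N) _ _ (SO (bdS bp))) // (dot3C (X _)) -/(kappa (L, t)) => D.
  have -> : 2 * kappa (L, t) = kappa (L, t) + kappa (L, t) by ring.
  apply: (is_derive1_le_left D); exists L => //= h /andP[h0 hL].
  by rewrite (on_sphere bp) ltW // inside //=; apply/andP; split; lra.
by move: k2 W0; nra.
Qed.

Lemma kappa_left t : kappa (0, t) < 0.
Proof.
have bp : bd (0, t) by left.
have [k2 _] := boundary_radial bp; have W0 := strip_W_gt0 (SO (bdS bp)).
have D := sm_is_ds (sm_dot (smX 1) (smX 1)) (SO (bdS bp)).
have : 2 * kappa (0, t) <= 0.
  move: D; rewrite (ds_dot (n := 0%N) _ _ (SO (bdS bp))) // (dot3C (X _)) -/(kappa (0, t)) => D.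
  have -> : 2 * kappa (0, t) = kappa (0, t) + kappa (0, t) by ring.
  apply: (is_derive1_le_right D); exists L => //= h /andP[h0 hL].
  by rewrite (on_sphere bp) ltW // inside //=; apply/andP; split; lra.
by move: k2 W0; nra.
Qed.

(** Differentiating [Xt . X = 0] along the boundary gives [X_tt . X = - W], and harmonicity turns
    this into [a . X = W]. *)
Lemma boundary_aXs p : bd p -> dot (a p) (Xs p) = kappa p * W p.
Proof.
move=> bp; have Op := SO (bdS bp).
have e2 : dot (vt Xt p) (X p) + dot (Xt p) (Xt p) = 0.
  have D := sm_is_dt (sm_dot (sXt 1) (smX 1)) Op.
  have D' : is_derive p.2 1 (fun y => dot (Xt (p.1, y)) (X (p.1, y))) 0.
    have := is_derive_cst (0 : R) p.2 (1 : R); apply: is_derive1_ext => y.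
    by rewrite boundary_tangent.
  by rewrite -(is_derive1_unique D D') (dt_dot (n := 0%N) _ _ Op).
have [_ E] := boundary_radial bp; have [W1 _] := conf (bdS bp).
rewrite {1}E dot3Zr; move: e2; rewrite strip_harmonic ?dot3Nl; last exact: bdS.
by rewrite -W1 => h; congr (_ * _); lra.
Qed.

(* If the second fundamental form vanished, [1 / W] would be subharmonic, but
   its maximum cannot lie on either boundary line. *)
Lemma not_totally_geodesic :
  ~ (forall p, S p -> dot (a p) (n p) = 0 /\ dot (b p) (n p) = 0).
Proof.
move=> flat; pose g p := (W p)^-1.
have W0 p : O p -> W p != 0 by move=> Op; rewrite gt_eqF // strip_W_gt0.
have sg k : sm O k g by apply: sm_inv.
pose Ws p := 2 * dot (a p) (Xs p); pose Wt p := 2 * dot (b p) (Xs p).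
have sWs k : sm O k Ws by apply: sm_mul; [exact: sm_cst|exact: sm_dot].
have sWt k : sm O k Wt by apply: sm_mul; [exact: sm_cst|exact: sm_dot].
have gs p : O p -> ds g p = - (g p * g p * Ws p).
  move=> Op; rewrite (dsV (sW 1) Op (W0 _ Op)) (ds_dot (n := 0%N) _ _ Op) // (dot3C (Xs p)).
  by rewrite /g /Ws expr2 invfM; ring.
have gt p : O p -> dt g p = - (g p * g p * Wt p).
  move=> Op; rewrite (dtV (sW 1) Op (W0 _ Op)) (dt_dot (n := 0%N) _ _ Op) // (dot3C (Xs p)).
  by rewrite /g /Wt expr2 invfM; ring.
have gss p : O p -> ds (ds g) p = - ((ds g p * g p + g p * ds g p) * Ws p + g p * g p * ds Ws p).
  move=> Op; rewrite (ds_ext oO gs Op).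
  have D1 := is_derive1M (sm_is_ds (sg 1) Op) (sm_is_ds (sg 1) Op).
  have := is_derive1N (is_derive1M D1 (sm_is_ds (sWs 1) Op)); rewrite -surjective_pairing => D2.
  apply: is_derive1_unique D2; apply: sm_is_ds Op.
  by apply: (@sm_opp _ _ 1); apply: sm_mul => //; exact: sm_mul.
have gtt p : O p -> dt (dt g) p = - ((dt g p * g p + g p * dt g p) * Wt p + g p * g p * dt Wt p).
  move=> Op; rewrite (dt_ext oO gt Op).
  have D1 := is_derive1M (sm_is_dt (sg 1) Op) (sm_is_dt (sg 1) Op).
  have := is_derive1N (is_derive1M D1 (sm_is_dt (sWt 1) Op)); rewrite -surjective_pairing => D2.
  apply: is_derive1_unique D2; apply: sm_is_dt Op.
  by apply: (@sm_opp _ _ 1); apply: sm_mul => //; exact: sm_mul.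
have dWs p : O p -> ds Ws p = 2 * (dot (vs a p) (Xs p) + dot (a p) (a p)).
  move=> Op; rewrite (dsM (O := O) (n := 0%N)) //; [|exact: sm_cst|exact: sm_dot].
  rewrite (ds_dot (n := 0%N) _ _ Op) //.
  have D : is_derive p.1 1 (fun=> 2 : R) (0 : R) by exact: is_derive_cst.
  by rewrite (is_derive1_unique (sm_is_ds (sm_cst O 1 2) Op) D) mul0r add0r.
have dWt p : I p -> dt Wt p = 2 * (- dot (vs a p) (Xs p) + dot (b p) (b p)).
  move=> Ip; have Op := IO Ip; rewrite (dtM (O := O) (n := 0%N)) //; [|exact: sm_cst|exact: sm_dot].
  rewrite (dt_dot (n := 0%N) _ _ Op) // bt_ // dot3Nl.
  have D : is_derive p.2 1 (fun=> 2 : R) (0 : R) by exact: is_derive_cst.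
  by rewrite (is_derive1_unique (sm_is_dt (sm_cst O 1 2) Op) D) mul0r add0r.
have gP s t : g (s, t + P) = g (s, t) by rewrite /g XsP.
have [q Iq|p0 [b0 M0]] := strip_max_principle L_gt0 P_gt0 oO SO (sg 2) gP.
  have Oq := IO Iq; have Sq := IS Iq.
  rewrite gss // gtt // gs // gt // dWs // dWt //.
  have Wq := strip_W_gt0 Oq; have [f1 f2] := flat _ Sq.
  have := strip_frame (a q) (a q) Sq; have := strip_frame (b q) (b q) Sq.
  rewrite f1 f2 -conf1 // conf3 // /g /Ws /Wt.
  move: (dot (a q) (Xs q)) (dot (b q) (Xs q)) (dot (vs a q) (Xs q)) (dot (a q) (a q))
    (dot (b q) (b q)) (dot (Xs q) (Xs q)) Wq => p r z aa bb w w0 h1 h2.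
  have wn : w != 0 by rewrite gt_eqF.
  have E1 : aa = (p * p + r * r) / w.
    apply: (mulIf (expf_neq0 2 wn)); rewrite h2; field; exact: wn.
  have E2 : bb = (p * p + r * r) / w.
    apply: (mulIf (expf_neq0 2 wn)); rewrite h1; field; exact: wn.
  (* With vanishing normal components, [a] and [b] both have squared length [(p ^+ 2 + r ^+ 2) / w],
     and the Laplacian of [1 / W] collapses to a sum of squares. *)
  set rhs := (X in 0 <= X); have -> : rhs = 4 * (p ^+ 2 + r ^+ 2) / w ^+ 3.
    by rewrite /rhs E1 E2; field; exact: wn.
  apply: divr_ge0; last by apply: exprn_ge0; exact: ltW.
  by apply: mulr_ge0 => //; apply: addr_ge0; exact: sqr_ge0.
(* The [s]-derivative of [1 / W] on the boundary is a negative multiple of [kappa], so [1 / W]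
   increases into the strip from both lines. *)
have Op0 := SO (bdS b0); have Wp0 := strip_W_gt0 Op0.
have D := sm_is_ds (sg 1) Op0; rewrite gs // /Ws boundary_aXs // in D.
have g0 : 0 < g p0 by rewrite invr_gt0.
case: p0 b0 M0 Op0 Wp0 D g0 => s t /= b0 M0 Op0 Wp0 D g0.
have gg : 0 < g (s, t) * g (s, t) * W (s, t) by rewrite !mulr_gt0.
case: b0 => sE; subst s.
- have : - (g (0, t) * g (0, t) * (2 * (kappa (0, t) * W (0, t)))) <= 0.
    apply: (is_derive1_le_right D); exists L => //= h /andP[h0 hL].
    by rewrite add0r; apply: M0 => /=; rewrite !ltW.
  have := kappa_left t; move: gg; move: (g _) (kappa _) (dot _ _) => x y z; nra.
- have : 0 <= - (g (L, t) * g (L, t) * (2 * (kappa (L, t) * W (L, t)))).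
    apply: (is_derive1_le_left D); exists L => //= h /andP[h0 hL].
    by apply: M0 => /=; apply/andP; split; lra.
  have := kappa_right t; move: gg; move: (g _) (kappa _) (dot _ _) => x y z; nra.
Qed.

(** With [k > 0] the difference of squares keeps [a . n] away from 0, so the vanishing product
    forces [b . n = 0]. The sign of the remaining square root is constant over the connected
    strip. *)
Lemma second_form_constant : exists2 c, c != 0 & forall p, S p ->
  dot (a p) (n p) = c * W p /\ dot (b p) (n p) = 0.
Proof.
have [k [k0 kP]] := hopf_constant.
have kn : k != 0.
  apply/eqP => kz; apply: not_totally_geodesic => p Sp.
  have [h1 h2] := kP _ Sp; rewrite kz mul0r in h2.
  move: h1 h2; move: (dot _ _) (dot _ _) => x y h1 h2.
  have /eqP := h1; rewrite mulf_eq0 => /orP[]/eqP h; split=> //;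
    apply/eqP; rewrite -sqrf_eq0; apply/eqP; move: h2; rewrite h; lra.
have {}k0 : 0 < k by rewrite lt_neqAle eq_sym kn.
have H p : S p -> dot (b p) (n p) = 0 /\ dot (a p) (n p) != 0 /\
    dot (a p) (n p) ^+ 2 = k * W p ^+ 2.
  move=> Sp; have [h1 h2] := kP _ Sp; have Wp := strip_W_gt0 (SO Sp).
  have kW : 0 < k * W p ^+ 2 by rewrite mulr_gt0 // exprn_gt0.
  have an : dot (a p) (n p) != 0.
    by apply/eqP => h; move: h2 kW; rewrite h expr0n sub0r => <-; rewrite oppr_gt0 ltNge sqr_ge0.
  have bn : dot (b p) (n p) = 0.
    by move: h1 => /eqP; rewrite mulf_eq0 (negbTE an) => /eqP.
  by move: h2; rewrite bn expr0n subr0.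
have ca p : O p -> {for p, continuous (fun q => dot (a q) (n q))} by exact: cdot.
have cna p : O p -> {for p, continuous (fun q => - dot (a q) (n q))}.
  by move=> Op; apply: continuousN; exact: ca.
pose p0 : R * R := (0, 0); have S0 : S p0 by apply: bdS; left.
have sk : 0 < Num.sqrt k by rewrite sqrtr_gt0.
have root p x : 0 < x -> S p -> x ^+ 2 = k * W p ^+ 2 -> x = Num.sqrt k * W p.
  move=> x0 Sp e; have Wp := strip_W_gt0 (SO Sp).
  apply/eqP; rewrite -(@eqrXn2 _ 2) ?ltW // ?mulr_gt0 //.
  by rewrite exprMn sqr_sqrtr ?(ltW k0) // e.
have [h|h] := ltP 0 (dot (a p0) (n p0)).
- exists (Num.sqrt k); first by rewrite gt_eqF.
  move=> p Sp; have [h1 [h2 h3]] := H _ Sp; split=> //; apply: root => //.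
  by apply: (strip_sign SO ca _ S0 Sp h) => q /H[_ []].
- exists (- Num.sqrt k); first by rewrite oppr_eq0 gt_eqF.
  move=> p Sp; have [h1 [h2 h3]] := H _ Sp; split=> //.
  rewrite mulNr -(root p (- dot (a p) (n p))) ?opprK ?sqrrN //.
  have h' : 0 < - dot (a p0) (n p0).
    by rewrite oppr_gt0 lt_neqAle h andbT; have [_ []] := H _ S0.
  by apply: (strip_sign SO cna _ S0 Sp h') => q /H[_ []]; rewrite oppr_eq0.
Qed.

(** * The unit normal, convexity of the boundary curves and their cones *)

Variable c : R.
Hypothesis c_gt0 : 0 < c.
Hypothesis second_form : forall p, S p -> dot (a p) (n p) = c * W p /\ dot (b p) (n p) = 0.
Hypothesis simple : forall s t t', s = 0 \/ s = L -> t < t' < t + P -> X (s, t) <> X (s, t').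

Definition normal p := locked ((Num.sqrt (dot (n p) (n p)))^-1 *: n p).

Lemma normalE p : normal p = (Num.sqrt (dot (n p) (n p)))^-1 *: n p.
Proof. by rewrite /normal -lock. Qed.

Local Notation N := normal.
Hypothesis omit : forall p, O p -> N p 0 2%:R != 1.

Let nn_gt0 p : O p -> 0 < dot (n p) (n p).
Proof.
move=> Op; rewrite lt_neqAle dot3_ge0 andbT eq_sym; apply/eqP => h.
by apply: (imm Op); exact: dot3_eq0.
Qed.

Lemma normal_smooth k : smv O k N.
Proof.
move=> i; have -> : (fun q => N q 0 i) = (fun q => ((Num.sqrt (dot (n q) (n q)))^-1 *: n q) 0 i).
  by apply/funext => q; rewrite normalE.
move: i; apply: smv_scale; last exact: sn.
apply: sm_inv; first by move=> p Op; rewrite gt_eqF // sqrtr_gt0 nn_gt0.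
by apply: sm_sqrt; [exact: nn_gt0|apply: sm_dot; exact: sn].
Qed.

Let sN := normal_smooth.

Lemma normal_unit p : O p -> dot (N p) (N p) = 1.
Proof.
move=> Op; have h := nn_gt0 Op; rewrite normalE dot3Zl dot3Zr mulrA -invfM -expr2 sqr_sqrtr ?ltW //.
by rewrite mulVf // gt_eqF.
Qed.

Let N_Xs p : dot (N p) (Xs p) = 0.
Proof. by rewrite normalE dot3Zl dot3C dot_crossl mulr0. Qed.

Let N_Xt p : dot (N p) (Xt p) = 0.
Proof. by rewrite normalE dot3Zl dot3C dot_crossr mulr0. Qed.

Let W_gt0 p : O p -> 0 < W p. Proof. exact: strip_W_gt0. Qed.

Let nE p : S p -> n p = W p *: N p.
Proof.
move=> Sp; have [e1 e2] := conf Sp; have h := W_gt0 (SO Sp).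
have E : Num.sqrt (dot (n p) (n p)) = W p.
  by rewrite cross_norm -e1 e2 expr0n subr0 -expr2 sqrtr_sqr gtr0_norm.
by rewrite normalE E scalerA mulfV ?scale1r // gt_eqF.
Qed.

Lemma normal_frame p u v : S p -> dot u v = dot u (N p) * dot v (N p)
  + (dot u (Xs p) * dot v (Xs p) + dot u (Xt p) * dot v (Xt p)) / W p.
Proof.
move=> Sp; have h := W_gt0 (SO Sp).
have F := strip_frame u v Sp; rewrite nE // !dot3Zr in F.
have hn : W p != 0 by rewrite gt_eqF.
move: F hn; move: (dot (Xs p) (Xs p)) (dot u v) (dot u (N p)) (dot v (N p)) (dot u (Xs p))
  (dot v (Xs p)) (dot u (Xt p)) (dot v (Xt p)) => w uv x y z x' y' z' F hn.
by apply: (mulIf (expf_neq0 2 hn)); rewrite F; field.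
Qed.

Let normal_eq p u v : S p -> dot u (N p) = dot v (N p) -> dot u (Xs p) = dot v (Xs p) ->
  dot u (Xt p) = dot v (Xt p) -> u = v.
Proof.
move=> Sp h1 h2 h3; apply/eqP; rewrite -subr_eq0; apply/eqP/dot3_eq0.
rewrite (normal_frame _ _ Sp) !dot3Dl !dot3Nl h1 h2 h3 !subrr; ring.
Qed.

(** Weingarten equation: the components of [N_s] come from differentiating [N . N = 1], [N . Xs = 0]
    and [N . Xt = 0]. *)
Lemma normal_s p : S p -> vs N p = - (c / W p) *: Xs p.
Proof.
move=> Sp; have Op := SO Sp; have [h1 h2] := second_form Sp; have h := W_gt0 Op.
have [_ e2] := conf Sp.
have wn : W p != 0 by rewrite gt_eqF.
rewrite nE // !dot3Zr in h1 h2.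
have aN : dot (a p) (N p) = c by apply: (mulfI wn); rewrite h1 mulrC.
have bN : dot (b p) (N p) = 0 by apply: (mulfI wn); rewrite h2 mulr0.
apply: (normal_eq Sp); rewrite dot3Zl.
- have : ds (fun q => dot (N q) (N q)) p = 0.
    rewrite (ds_ext oO normal_unit Op); apply: is_ds; exact: is_derive_cst.
  by rewrite (ds_dot (n := 0%N) _ _ Op) // (dot3C (N p)) (dot3C (Xs p)) N_Xs mulr0; lra.
- have : ds (fun q => dot (N q) (Xs q)) p = 0.
    by apply: (ds_zero_on oO).
  rewrite (ds_dot (n := 0%N) _ _ Op) // (dot3C (N p)) aN => E.
  by rewrite mulNr divfK //; lra.
- have : ds (fun q => dot (N q) (Xt q)) p = 0.
    by apply: (ds_zero_on oO).
  rewrite (ds_dot (n := 0%N) _ _ Op) // (dot3C (N p)) st // bN addr0 => ->.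
  by rewrite e2 mulr0.
Qed.

Lemma normal_t p : S p -> vt N p = (c / W p) *: Xt p.
Proof.
move=> Sp; have Op := SO Sp; have [h1 h2] := second_form Sp; have h := W_gt0 Op.
have [e1 e2] := conf Sp.
have wn : W p != 0 by rewrite gt_eqF.
rewrite nE // !dot3Zr in h1 h2.
have aN : dot (a p) (N p) = c by apply: (mulfI wn); rewrite h1 mulrC.
have bN : dot (b p) (N p) = 0 by apply: (mulfI wn); rewrite h2 mulr0.
have tN : dot (vt Xt p) (N p) = - c.
  by rewrite (strip_harmonic Sp) dot3Nl aN.
apply: (normal_eq Sp); rewrite dot3Zl.
- have : dt (fun q => dot (N q) (N q)) p = 0.
    rewrite (dt_ext oO normal_unit Op); apply: is_dt; exact: is_derive_cst.
  by rewrite (dt_dot (n := 0%N) _ _ Op) // (dot3C (N p)) (dot3C (Xt p)) N_Xt mulr0; lra.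
- have : dt (fun q => dot (N q) (Xs q)) p = 0.
    by apply: (dt_zero_on oO).
  rewrite (dt_dot (n := 0%N) _ _ Op) // (dot3C (N p)) bN addr0 => ->.
  by rewrite (dot3C (Xt p)) e2 mulr0.
- have : dt (fun q => dot (N q) (Xt q)) p = 0.
    by apply: (dt_zero_on oO).
  rewrite (dt_dot (n := 0%N) _ _ Op) // (dot3C (N p)) tN => E.
  by rewrite -e1 divfK //; lra.
Qed.

Lemma normal_periodic s t : N (s, t + P) = N (s, t).
Proof. by rewrite !normalE XsP XtP. Qed.

Let X_N p : bd p -> dot (X p) (N p) = 0.
Proof. by move=> bp; rewrite normalE dot3Zr dot3C orthogonal // mulr0. Qed.

(** As [Xs] is radial here with [kappa ^+ 2 = W], the position vector [X] takes its place in the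
    frame. *)
Lemma boundary_frame p u v : bd p -> dot u v = dot u (X p) * dot v (X p)
  + dot u (Xt p) * dot v (Xt p) / W p + dot u (N p) * dot v (N p).
Proof.
move=> bp; rewrite (normal_frame _ _ (bdS bp)); have [k2 kE] := boundary_radial bp.
have h := W_gt0 (SO (bdS bp)); have hn : W p != 0 by rewrite gt_eqF.
have e w : dot w (Xs p) = kappa p * dot w (X p) by rewrite {1}kE dot3Zr.
rewrite (e u) (e v); move: k2 hn; move: (dot (Xs p) (Xs p)) (kappa p) => w k <- kn.
by field; move: kn; rewrite expf_eq0.
Qed.

Lemma boundary_convex s t0 t : s = 0 \/ s = L -> t0 < t < t0 + P ->
  dot (X (s, t)) (N (s, t0)) < 0.
Proof.
move=> sbd; have bp y : bd (s, y) by [].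
have Op y : O (s, y) := SO (bdS (bp y)).
apply: (@curve_globally_convex R (fun y => X (s, y)) (fun y => Xt (s, y)) (fun y => N (s, y))
  (fun y => W (s, y)) (fun y => c / W (s, y)) P P_gt0).
- by move=> y i; rewrite vtE; exact: (sm_is_dt (smX 1 i) (Op y)).
- by move=> y i; rewrite -normal_t ?vtE; [exact: (sm_is_dt (sN 1 i) (Op y))|exact: bdS].
- move=> i y; have := sm_is_dt (sXt 1 i) (Op y); exact: is_derive1_continuous.
- move=> y; have s1 : sm O 1 (fun p => c / W p).
    apply: sm_mul; first exact: sm_cst.
    by apply: sm_inv; [move=> p /W_gt0 h; rewrite gt_eqF|apply: sm_dot; exact: sXs].
  by have := sm_is_dt s1 (Op y); exact: is_derive1_continuous.
- by move=> y; rewrite divr_gt0 // W_gt0.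
- by move=> y; have [-> _] := conf (bdS (bp y)).
- by move=> y; exact: W_gt0.
- by move=> y; exact: on_sphere.
- by move=> y; exact: normal_unit.
- by move=> y; exact: X_N.
- by move=> y; rewrite dot3C.
- by move=> y u v; exact: boundary_frame.
- by move=> y; exact: XP.
- by move=> y; exact: XtP.
- by move=> y; exact: normal_periodic.
- by move=> y y'; exact: simple.
Qed.

Lemma boundary_convex_mod s t0 t : s = 0 \/ s = L ->
  dot (X (s, t)) (N (s, t0)) < 0 \/ exists k : int, t = t0 + k%:~R * P.
Proof.
move=> sbd; have [k /andP[k0 kP]] := period_reduce P_gt0 (t - t0).
have E : X (s, t) = X (s, t + k%:~R * P) by rewrite (periodic_int (P := P) XP).
move: k0 kP; rewrite !le_eqVlt => /orP[/eqP k0 _|k0 /orP[/eqP kP|kP]].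
- by right; exists (- k); rewrite mulrNz mulNr; lra.
- by right; exists (1 - k); rewrite mulrzBr mulrBl mul1r; lra.
- by left; rewrite E; apply: boundary_convex => //; apply/andP; split; lra.
Qed.

Definition cone s (v : 'rV[R]_3) := forall t, dot v (X (s, t)) <= 0.

Lemma cone_normal s t : s = 0 \/ s = L -> cone s (N (s, t)).
Proof.
move=> sbd y; rewrite dot3C; have [h|[k ->]] := boundary_convex_mod t y sbd; first exact: ltW.
by rewrite (periodic_int (P := P) XP) X_N.
Qed.

Lemma cone_touch s t v : s = 0 \/ s = L -> cone s v -> dot v (X (s, t)) = 0 ->
  v = dot v (N (s, t)) *: N (s, t) /\ 0 <= dot v (N (s, t)).
Proof.
move=> sbd vC v0; have bp : bd (s, t) by []; have Op := SO (bdS bp).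
have vt0 : dot v (Xt (s, t)) = 0.
  have D i : is_derive t 1 (fun y => X (s, y) 0 i) (Xt (s, t) 0 i).
    by rewrite vtE; exact: (sm_is_dt (smX 1 i) Op).
  have D0 i : is_derive t 1 (fun=> v 0 i) ((0 : 'rV[R]_3) 0 i).
    by rewrite mxE; exact: is_derive_cst.
  have := is_derive_dot3 D0 D; rewrite {1}dot3E !mxE !mul0r !add0r => DD.
  apply: (local_max_derive_eq0 DD); apply/nbhs_ballP; exists 1 => //= y _.
  by rewrite v0; exact: vC.
have E u : dot v u = dot v (N (s, t)) * dot u (N (s, t)).
  by rewrite (boundary_frame _ _ bp) v0 vt0 !mul0r !add0r.
split.
  apply/eqP; rewrite -subr_eq0; apply/eqP/dot3_eq0.
  by rewrite dot3BZ normal_unit // (E v); ring.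
(* The sign of the multiple is tested at the point half a period away, which lies strictly inside
   the hemisphere of [N (s, t)]. *)
have tP : t < t + P / 2 < t + P by have := P_gt0; move=> h; apply/andP; split; lra.
have := boundary_convex sbd tP => h.
have := vC (t + P / 2); rewrite E; move: h; move: (dot (X _) _) (dot v _) => x y; nra.
Qed.

(** [X . v] is harmonic and so attains its maximum on a boundary line, where it is nonpositive. In
    each of the cases of negative and zero maximum it increases from there into the strip. *)
Lemma cones_disjoint v : v <> 0 -> cone 0 v -> cone L v -> False.
Proof.
move=> v0 C0 CL; pose u p := dot (X p) v.
have sv k : smv O k (fun=> v) by move=> i; exact: sm_cst.
have su k : sm O k u by apply: sm_dot.
have vs0 p : O p -> vs (fun=> v) p = 0.
  by move=> Op; apply/rowP => i; rewrite vsE mxE; apply: is_ds; exact: is_derive_cst.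
have vt0 p : O p -> vt (fun=> v) p = 0.
  by move=> Op; apply/rowP => i; rewrite vtE mxE; apply: is_dt; exact: is_derive_cst.
have dot0 (w : 'rV[R]_3) : dot w 0 = 0 by rewrite dot3E !mxE; ring.
have us p : O p -> ds u p = dot (Xs p) v.
  by move=> Op; rewrite (ds_dot (n := 0%N) _ _ Op) // vs0 // dot0 addr0.
have ut p : O p -> dt u p = dot (Xt p) v.
  by move=> Op; rewrite (dt_dot (n := 0%N) _ _ Op) // vt0 // dot0 addr0.
have uss p : O p -> ds (ds u) p = dot (a p) v.
  move=> Op; rewrite (ds_ext oO us Op) (ds_dot (n := 0%N) _ _ Op) // vs0 // dot0 addr0 //.
have utt p : O p -> dt (dt u) p = dot (vt Xt p) v.
  move=> Op; rewrite (dt_ext oO ut Op) (dt_dot (n := 0%N) _ _ Op) // vt0 // dot0 addr0 //.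
have uP s t : u (s, t + P) = u (s, t) by rewrite /u XP.
have [p Ip|[s t] [/= sbd M]] := strip_max_principle L_gt0 P_gt0 oO SO (su 2) uP.
  have Op := SO (IS Ip); rewrite uss // utt //.
  by rewrite (strip_harmonic (IS Ip)) dot3Nl subrr.
have bp : bd (s, t) by []; have Op := SO (bdS bp).
have Cs : cone s v by case: sbd => ->.
have [_ kE] := boundary_radial bp.
have D := sm_is_ds (su 1) Op; rewrite us // kE dot3Zl -/(u (s, t)) /= in D.
have : u (s, t) <= 0 by rewrite /u dot3C; exact: Cs.
(* For a negative maximum the relation [u_s = kappa u] and the signs of [kappa] already make [u]
   increase inwards. *)
rewrite le_eqVlt => /orP[/eqP u0|u0]; last first.
  case: sbd => sE; subst s.
  - have : kappa (0, t) * u (0, t) <= 0.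
      apply: (is_derive1_le_right D); exists L => //= h /andP[h0 hL].
      by rewrite add0r; apply: M => /=; rewrite !ltW.
    have := kappa_left t.
    by move: u0; move: (u _) (kappa _) => x y; nra.
  - have : 0 <= kappa (L, t) * u (L, t).
      apply: (is_derive1_le_left D); exists L => //= h /andP[h0 hL].
      by apply: M => /=; apply/andP; split; lra.
    have := kappa_right t.
    by move: u0; move: (u _) (kappa _) => x y; nra.
have vX : dot v (X (s, t)) = 0 by rewrite dot3C.
have [vE l0] := cone_touch sbd Cs vX.
have {}l0 : 0 < dot v (N (s, t)).
  rewrite lt_neqAle l0 andbT eq_sym; apply/eqP => h.
  by apply: v0; rewrite vE h scale0r.
have us0 : ds u (s, t) = 0 by rewrite us // kE dot3Zl -/(u (s, t)) u0 mulr0.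
(* At a zero maximum [u_s] vanishes as well, but [v] is a positive multiple of [N], so [u_ss] is a
   positive multiple of [c] and [u] still rises into the strip. *)
have uss0 : 0 < ds (ds u) (s, t).
  rewrite uss // vE dot3Zr mulr_gt0 //; have [h1 _] := second_form (bdS bp).
  have h := W_gt0 Op; rewrite (nE (bdS bp)) dot3Zr in h1.
  by have -> : dot (a (s, t)) (N (s, t)) = c by apply: (mulfI (lt0r_neq0 h)); rewrite h1 mulrC.
have [e e0 He] := derive_gt0_near (sm_is_ds (sm_ds oO (su 2)) Op) uss0.
rewrite /= -/(ds u (s, t)) us0 in He.
pose r := Num.min e L / 2.
have m0 : 0 < Num.min e L by rewrite lt_min e0 L_gt0.
have m1 : Num.min e L <= e by rewrite ge_min lexx.
have m2 : Num.min e L <= L by rewrite ge_min lexx orbT.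
have r0 : 0 < r by rewrite /r; lra.
have re : r < e by rewrite /r; lra.
have rL : r < L by rewrite /r; lra.
clearbody r; clear m0 m1 m2.
have Ds x : 0 <= x <= L -> is_derive x 1 (fun x => u (x, t)) (ds u (x, t)).
  by move=> xS; exact: (@sm_is_ds R O 0 u (x, t) (su 1) (@SO (x, t) xS)).
case: sbd => sE; subst s.
- have [x /andP[x1 x2]|x /andP[x1 x2]] := @mean_value R (fun x => u (x, t)) (fun x => ds u (x, t)) 0 r r0.
    by apply: Ds; apply/andP; split; lra.
  rewrite u0 !subr0 => E.
  have : 0 < ds u (x, t).
    have xe : 0 < x < e by apply/andP; split; lra.
    by have := He _ xe; rewrite (add0r x) => /andP[_].
  have : u (r, t) <= u (0, t) by apply: M => /=; apply/andP; split; lra.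
  by rewrite E u0; move: (ds u (x, t)) => y; nra.
- have Lr : L - r < L by lra.
  have [x /andP[x1 x2]|x /andP[x1 x2]] :=
    @mean_value R (fun x => u (x, t)) (fun x => ds u (x, t)) (L - r) L Lr.
    by apply: Ds; apply/andP; split; lra.
  rewrite u0 => E.
  have : ds u (x, t) < 0.
    have xe : 0 < L - x < e by apply/andP; split; lra.
    by have := He _ xe; rewrite opprB (addrC L) subrK => /andP[].
  have : u (L - r, t) <= u (L, t) by apply: M => /=; apply/andP; split; lra.
  by move: E; rewrite u0; move: (ds u (x, t)) (u (L - r, t)) => y z; nra.
Qed.

(* [sg] is the outward direction at the boundary line [s]. *)
Lemma boundary_side s t sg : (s = 0 /\ sg = -1) \/ (s = L /\ sg = 1) ->
  exists2 e : R, 0 < e & forall x y, `|x - s| < e -> `|y - t| < e ->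
    O (x, y) /\ (0 <= sg * (x - s) -> cone s (N (x, y))) /\
    (sg * (x - s) < 0 -> 0 < dot (N (x, y)) (X (s, y))).
Proof.
move=> sgP; have sbd : s = 0 \/ s = L by case: sgP => -[]; auto.
have bp y : bd (s, y) by []; have Op y : O (s, y) := SO (bdS (bp y)).
have kpos : 0 < sg * kappa (s, t).
  case: sgP => -[-> ->].
    by rewrite mulN1r oppr_gt0; apply: kappa_left.
  by rewrite mul1r; apply: kappa_right.
have sg2 : sg * sg = 1 by case: sgP => -[_ ->]; ring.
have smvN : smv O 0 (vs N) by exact: (smv_vs oO (sN 1)).
(* The outward rate of change of [N . X]. The angles of [N] and of [X] are kept independent, since
   [N (x, y)] must be tested against all nearby boundary points [X (s, y')]. *)
pose f (z : (R * R) * R) := sg * dot (vs N z.1) (X (s, z.2)).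
have cX i : continuous (fun y : R => X (s, y) 0 i).
  by move=> y; have := sm_is_dt (smX 1 i) (Op y); exact: is_derive1_continuous.
have cf : {for ((s, t), t), continuous f}.
  apply: continuousM; first exact: cvg_cst.
  apply: continuous_dot3 => i.
    apply: (@continuous_comp _ _ _ fst (fun q => vs N q 0 i)); first exact: cvg_fst.
    exact: (sm_continuous (smvN i) (Op t)).
  apply: (@continuous_comp _ _ _ snd (fun y => X (s, y) 0 i)); first exact: cvg_snd.
  exact: cX.
have f0 : f ((s, t), t) < 0.
  rewrite /f /= normal_s ?dot3Zl; last exact: bdS.
  rewrite -/(kappa (s, t)) mulrCA mulNr oppr_lt0 mulr_gt0 // divr_gt0 //; exact: W_gt0.
have : nbhs ((s, t), t) (f @^-1` [set x | x < 0]).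
  apply: cf; apply: open_nbhs_nbhs; split=> //; exact: open_lt.
move=> [[A B] /= [nA nB] AB].
have [e1 e10 H1] := box_nbhs nA.
move: nB => /nbhs_ballP[e2 /= e20 H2].
have [e3 e30 H3] := box_nbhs (open_nbhs_nbhs (conj oO (Op t))).
have neg x y y' : `|x - s| < e1 -> `|y - t| < e1 -> `|y' - t| < e2 ->
    sg * dot (vs N (x, y)) (X (s, y')) < 0.
  move=> hx hy hy'; apply: (AB ((x, y), y')); split=> /=; first exact: H1.
  by apply: H2; rewrite /ball /= distrC.
(* For boundary points away from [t] modulo the period, global convexity at [t] is strict. It has a
   positive margin by compactness and survives a small change of [N]. *)
have [e4 e40 H4] : exists2 e : R, 0 < e & forall x y, `|x - s| < e -> `|y - t| < e ->
    forall y', t + Num.min e2 P / 2 <= y' <= t + P - Num.min e2 P / 2 -> dot (N (x, y)) (X (s, y')) < 0.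
  have [h|h] := leP (t + Num.min e2 P / 2) (t + P - Num.min e2 P / 2); last first.
    by exists 1 => // x y _ _ y' /andP[z1 z2]; have := le_trans z1 z2; rewrite leNgt h.
  pose F y' := dot (N (s, t)) (X (s, y')).
  have cF : continuous F.
    by move=> y'; apply: (@continuous_dot3 R _ (fun=> N (s, t)) (fun y => X (s, y))) => i;
      [exact: cvg_cst|exact: cX].
  have m0 : 0 < Num.min e2 P by rewrite lt_min e20 P_gt0.
  have [|y0 y0in Hy] := @EVT_max R F _ _ h.
    by apply: continuous_subspaceT => y'; exact: cF.
  have Fneg : F y0 < 0.
    rewrite /F dot3C; apply: boundary_convex => //; move: y0in; rewrite in_itv /= => /andP[z1 z2].
    by apply/andP; split; lra.
  have q0 : 0 < - F y0 / 3 by lra.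
  have ni i : exists2 e : R, 0 < e & forall x y, `|x - s| < e -> `|y - t| < e ->
      `|N (x, y) 0 i - N (s, t) 0 i| < - F y0 / 3.
    have [e ee He] := box_nbhs (continuous_dist_lt (sm_continuous (sN 0 i) (Op t)) q0).
    by exists e => // x y hx hy; rewrite distrC; exact: He.
  have [d0 d00 G0] := ni 0; have [d1 d10 G1] := ni 1; have [d2 d20 G2] := ni 2%:R.
  exists (Num.min d0 (Num.min d1 d2)); first by rewrite !lt_min d00 d10.
  move=> x y; rewrite !lt_min => /and3P[x0 x1 x2] /and3P[y00 y1 y2] y' yin.
  have Fle : F y' <= F y0 by apply: Hy; rewrite in_itv.
  have u1 : dot (X (s, y')) (X (s, y')) = 1 by exact: on_sphere.
  have bnd i : `|N (x, y) 0 i - N (s, t) 0 i| < - F y0 / 3 ->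
      (N (x, y) 0 i - N (s, t) 0 i) * X (s, y') 0 i < - F y0 / 3.
    move=> hb; apply: le_lt_trans (ler_norm _) _; rewrite normrM (le_lt_trans _ hb) //.
    by rewrite ler_piMr //; exact: dot3_unit_le.
  have key (k0 n0 n1 n2 m0' m1' m2' a1 a2 a3 : R) : (n2 - m2') * a3 < - k0 / 3 ->
      (n1 - m1') * a2 < - k0 / 3 -> (n0 - m0') * a1 < - k0 / 3 ->
      m0' * a1 + m1' * a2 + m2' * a3 <= k0 -> n0 * a1 + n1 * a2 + n2 * a3 < 0 by lra.
  rewrite /F dot3E in Fle; rewrite dot3E.
  exact: key (bnd _ (G2 _ _ x2 y2)) (bnd _ (G1 _ _ x1 y1)) (bnd _ (G0 _ _ x0 y00)) Fle.
exists (Num.min (Num.min e1 e2) (Num.min e3 e4)); first by rewrite !lt_min e10 e20 e30.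
move=> x y; rewrite !lt_min => /andP[/andP[x1 x2] /andP[x3 x4]] /andP[/andP[y1 y2] /andP[y3 y4]].
split; first exact: H3.
have seg z : Num.min s x <= z <= Num.max s x -> `|z - s| < e1 /\ `|z - s| < e3.
  move: x1 x3; rewrite !ltr_norml => /andP[? ?] /andP[? ?] /andP[].
  by case: (leP s x) => ? ? ?; split; apply/andP; split; lra.
have mv y' : exists z, `|z - s| < e1 /\
    dot (N (x, y)) (X (s, y')) - dot (N (s, y)) (X (s, y')) = dot (vs N (z, y)) (X (s, y')) * (x - s).
  have [z zb|z zb E] := @mean_value_between R (fun z => dot (N (z, y)) (X (s, y')))
      (fun z => dot (vs N (z, y)) (X (s, y'))) s x.
    have [_ z3] := seg _ zb.
    have D i : is_derive z 1 (fun z => N (z, y) 0 i) (vs N (z, y) 0 i).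
      by rewrite vsE; exact: (@sm_is_ds R O 0 _ (z, y) (sN 1 i) (H3 _ _ z3 y3)).
    have D0 i : is_derive z 1 (fun=> X (s, y') 0 i) ((0 : 'rV[R]_3) 0 i).
      by rewrite mxE; exact: is_derive_cst.
    have := is_derive_dot3 D D0.
    by rewrite [X in _ + X]dot3E !mxE !mulr0 !addr0.
  by exists z; split=> //; have [] := seg _ zb.
have near_neg y' : `|y' - t| < e2 -> 0 <= sg * (x - s) -> dot (N (x, y)) (X (s, y')) <= 0.
  move=> hy' out; have [z [hz E]] := mv y'.
  have := cone_normal y sbd y'; have := neg z y y' hz y1 hy'.
  move: E out; move: (dot (N (x, y)) _) (dot (N (s, y)) _) (dot (vs N _) _) (x - s) => k1 k2 k3 k4 E.
  have -> : k1 = k2 + (sg * k3) * (sg * k4) by rewrite mulrACA sg2 mul1r -E; ring.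
  by move: (sg * k3) (sg * k4) => l3 l4 out C0 B0; nra.
split=> [out y'|inn].
(* After reduction by periods [y'] is near [t], in the range of [H4], or near [t + P], where one
   more period leads back to the first case. *)
- have [k /andP[k0 kP]] := period_reduce P_gt0 (y' - t).
  rewrite -(periodic_int (P := P) XP k s y').
  move: (y' + k%:~R * P) (addrAC y' (k%:~R * P) (- t)) => y'' Ey; rewrite -Ey in k0 kP.
  have m1 : Num.min e2 P <= e2 by rewrite ge_min lexx.
  have m0 : 0 < Num.min e2 P by rewrite lt_min e20 P_gt0.
  have [h|h] := ltP y'' (t + Num.min e2 P / 2).
    by apply: near_neg => //; rewrite ltr_norml; apply/andP; split; lra.
  have [h'|h'] := leP y'' (t + P - Num.min e2 P / 2).
    by apply: ltW; apply: (H4 x y x4 y4); rewrite h h'.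
  rewrite -(subrK P y'') XP; apply: near_neg => //.
  by rewrite ltr_norml; apply/andP; split; lra.
- have [z [hz E]] := mv y; have := neg z y y hz y1 y2.
  have NX : dot (N (s, y)) (X (s, y)) = 0 by rewrite dot3C X_N.
  rewrite NX subr0 in E.
  move: E inn; move: (dot (N (x, y)) _) (dot (vs N _) _) (x - s) => k1 k3 k4 ->.
  have -> : k3 * k4 = (sg * k3) * (sg * k4) by rewrite mulrACA sg2 mul1r.
  by move=> h1 h2; rewrite nmulr_rgt0.
Qed.

(** * The Gauss map of the strip as a local homeomorphism *)

Definition gauss p : R * R := (N p 0 0 / (1 - N p 0 2%:R), N p 0 1 / (1 - N p 0 2%:R)).
Let g1 p := N p 0 0 / (1 - N p 0 2%:R).
Let g2 p := N p 0 1 / (1 - N p 0 2%:R).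
Let den p := 1 - N p 0 2%:R.

Let den_neq0 p : O p -> den p != 0.
Proof. by move=> Op; rewrite /den subr_eq0 eq_sym omit. Qed.

Let sden k : sm O k den.
Proof. by apply: sm_sub; [exact: sm_cst|exact: sN]. Qed.

Let sg1 k : sm O k g1.
Proof. by apply: sm_mul; [exact: sN|apply: sm_inv => //; exact: sden]. Qed.

Let sg2 k : sm O k g2.
Proof. by apply: sm_mul; [exact: sN|apply: sm_inv => //; exact: sden]. Qed.

Let den_s p : O p -> ds den p = - vs N p 0 2%:R.
Proof.
move=> Op; rewrite vsE; apply: is_ds.
have := is_derive1B (is_derive_cst (1 : R) p.1 (1 : R)) (sm_is_ds (sN 1 2%:R) Op).
by rewrite sub0r.
Qed.

Let den_t p : O p -> dt den p = - vt N p 0 2%:R.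
Proof.
move=> Op; rewrite vtE; apply: is_dt.
have := is_derive1B (is_derive_cst (1 : R) p.2 (1 : R)) (sm_is_dt (sN 1 2%:R) Op).
by rewrite sub0r.
Qed.

Let quotient_s (g : R * R -> R) i p : O p -> sm O 1 g -> (forall q, O q -> g q * den q = N q 0 i) ->
  ds g p * den p - g p * vs N p 0 2%:R = vs N p 0 i.
Proof.
move=> Op sg gE; rewrite [RHS]vsE -(ds_ext oO gE Op) (dsM sg (sden 1) Op) den_s //.
by rewrite mulrN.
Qed.

Let quotient_t (g : R * R -> R) i p : O p -> sm O 1 g -> (forall q, O q -> g q * den q = N q 0 i) ->
  dt g p * den p - g p * vt N p 0 2%:R = vt N p 0 i.
Proof.
move=> Op sg gE; rewrite [RHS]vtE -(dt_ext oO gE Op) (dtM sg (sden 1) Op) den_t //.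
by rewrite mulrN.
Qed.

(** Shown through the kernel [ker]: a direction killed by the differential of [gauss] gives a
    derivative [v] of [N] proportional to [(- g1, - g2, 1)]. Orthogonality to [N] forces [v = 0],
    and [N_s], [N_t] are independent because [c] is nonzero. *)
Lemma gauss_jacobian p : S p -> ds g1 p * dt g2 p - dt g1 p * ds g2 p != 0.
Proof.
move=> Sp; have Op := SO Sp; have dn := den_neq0 Op.
have E1 q : O q -> g1 q * den q = N q 0 0 by move=> /den_neq0 h; rewrite divfK.
have E2 q : O q -> g2 q * den q = N q 0 1 by move=> /den_neq0 h; rewrite divfK.
have s1 := quotient_s Op (sg1 1) E1; have s2 := quotient_s Op (sg2 1) E2.
have t1 := quotient_t Op (sg1 1) E1; have t2 := quotient_t Op (sg2 1) E2.
have ns := normal_s Sp; have nt := normal_t Sp.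
have W0 := W_gt0 Op; have [e1 e2] := conf Sp.
have N1 := normal_unit Op.
have ker (x y : R) : x * ds g1 p + y * dt g1 p = 0 -> x * ds g2 p + y * dt g2 p = 0 ->
    x = 0 /\ y = 0.
  move=> h1 h2; pose v := x *: vs N p + y *: vt N p.
  have v0 : v 0 0 = - g1 p * v 0 2%:R.
    rewrite !mxE -s1 -t1.
    have -> : x * (ds g1 p * den p - g1 p * vs N p 0 2%:R) + y * (dt g1 p * den p - g1 p * vt N p 0 2%:R)
      = (x * ds g1 p + y * dt g1 p) * den p - g1 p * (x * vs N p 0 2%:R + y * vt N p 0 2%:R) by ring.
    by rewrite h1; ring.
  have v1 : v 0 1 = - g2 p * v 0 2%:R.
    rewrite !mxE -s2 -t2.
    have -> : x * (ds g2 p * den p - g2 p * vs N p 0 2%:R) + y * (dt g2 p * den p - g2 p * vt N p 0 2%:R)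
      = (x * ds g2 p + y * dt g2 p) * den p - g2 p * (x * vs N p 0 2%:R + y * vt N p 0 2%:R) by ring.
    by rewrite h2; ring.
  have vN : dot v (N p) = 0.
    by rewrite dot3Dl !dot3Zl ns nt !dot3Zl (dot3C (Xs p)) (dot3C (Xt p)) N_Xs N_Xt; ring.
  have v2 : v 0 2%:R = 0.
    move: vN N1; rewrite !dot3E v0 v1 -(E1 _ Op) -(E2 _ Op).
    move: (dn); rewrite /den; move: (g1 p) (g2 p) (N p 0 2%:R) (v 0 2%:R) => a b z k dz F1 F2.
    have H : (a * a + b * b) * (1 - z) = 1 + z.
      by apply: (mulIf dz); rewrite -mulrA; move: F2; lra.
    have : k * ((a * a + b * b) * (1 - z) - z) = 0 by move: F1; lra.
    by rewrite H => h; lra.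
  have vz : v = 0 by apply: rV3P; rewrite ?v0 ?v1 v2 ?mulr0 mxE.
  have cW : c / W p * W p = c by rewrite divfK // gt_eqF.
  have d1 : dot v (Xs p) = - (x * c).
    rewrite dot3Dl !dot3Zl ns nt !dot3Zl (dot3C (Xt p)) e2 !mulr0 addr0.
    by rewrite mulNr cW mulrN.
  have d2 : dot v (Xt p) = y * c.
    by rewrite dot3Dl !dot3Zl ns nt !dot3Zl e2 !mulr0 add0r -e1 cW.
  have z0 (w : 'rV[R]_3) : dot 0 w = 0 by rewrite dot3E !mxE; ring.
  rewrite vz z0 in d1; rewrite vz z0 in d2; have cn : c != 0 by rewrite gt_eqF.
  split; apply: (mulIf cn); rewrite mul0r //.
  by apply/eqP; rewrite -oppr_eq0 -d1.
apply/eqP => det0.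
(* If the determinant vanishes, each row turned by a right angle lies in the kernel. Both rows are
   then zero, and every direction would be in the kernel. *)
have [_ b1] : dt g1 p = 0 /\ - ds g1 p = 0.
  move: det0 (ker (dt g1 p) (- ds g1 p)); move: (ds g1 p) (dt g1 p) (ds g2 p) (dt g2 p) => x y z w h.
  by apply; [ring|rewrite -oppr0 -h; ring].
have [_ b2] : dt g2 p = 0 /\ - ds g2 p = 0.
  move: det0 (ker (dt g2 p) (- ds g2 p)); move: (ds g1 p) (dt g1 p) (ds g2 p) (dt g2 p) => x y z w h.
  by apply; [rewrite -h; ring|ring].
have /eqP := b1; rewrite oppr_eq0 => /eqP b1'.
have /eqP := b2; rewrite oppr_eq0 => /eqP b2'.
have [h _] : (1 : R) = 0 /\ (0 : R) = 0 by apply: ker; rewrite ?b1' ?b2'; ring.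
by move: h => /eqP; rewrite oner_eq0.
Qed.

Lemma gauss_locally_injective p : S p -> exists2 B, nbhs p B &
  forall q q', B q -> B q' -> gauss q = gauss q' -> q = q'.
Proof.
move=> Sp; have [B nB H] := local_homeo_injective oO (sg1 1) (sg2 1) (SO Sp) (gauss_jacobian Sp).
by exists B => // q q' Bq Bq' [e1 e2]; exact: H.
Qed.

Lemma gauss_locally_open p B : S p -> nbhs p B -> nbhs (gauss p) (gauss @` B).
Proof.
by move=> Sp nB; exact: (local_homeo_open oO (sg1 1) (sg2 1) (SO Sp) (gauss_jacobian Sp) nB).
Qed.

Lemma gauss_continuous p : O p -> {for p, continuous gauss}.
Proof.
move=> Op; exact: cvg_pair (sm_continuous (sg1 1) Op) (sm_continuous (sg2 1) Op).
Qed.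

Lemma strip_gauss_annulus (h : R * R -> R * R) : P = pi *+ 2 ->
  (forall p, O p -> h (polar p) = gauss p) ->
  injective_on (annulus (expR L)) h /\
  region_bounded_by (h @` annulus (expR L)) (h @` circle 1) (h @` circle (expR L)).
Proof.
move=> PE hG; have XP' := XP; have conv := boundary_convex; have conv' := boundary_convex_mod.
rewrite PE in XP' conv conv'.
have Obd s y : s = 0 \/ s = L -> O (s, y) by move=> sbd; apply: SO; exact: (@bdS (s, y)).
apply: (@annulus_gauss R L O X N h) => //.
- by move=> s i sbd y; have := sm_is_dt (smX 1 i) (Obd s y sbd); exact: is_derive1_continuous.
- by move=> s i sbd y; have := sm_is_dt (sN 1 i) (Obd s y sbd); exact: is_derive1_continuous.
- by move=> s y sbd; exact: on_sphere.
- exact: normal_unit.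
- by move=> s y sbd; exact: X_N.
- by move=> s y sbd; exact: cone_normal.
- by move=> s y v sbd; exact: cone_touch.
- by move=> v; exact: cones_disjoint.
- exact: boundary_side.
- exact: gauss_locally_injective.
- by move=> p B; exact: gauss_locally_open.
- exact: gauss_continuous.
Qed.

End FreeBoundaryStrip.

(** * Free boundary minimal annuli *)

Section NegatedField.
Variables (R : realType) (O : set (R * R)) (A : R * R -> 'rV[R]_3).
Hypotheses (oO : open O) (sA : forall n, smv O n A).

Lemma crsNN (u v : 'rV[R]_3) : crs (- u) (- v) = crs u v.
Proof.
have [a0 a1 a2] := cross3E (- u) (- v); have [b0 b1 b2] := cross3E u v.
by apply: rV3P; rewrite ?a0 ?a1 ?a2 ?b0 ?b1 ?b2 !mxE; ring.
Qed.

Lemma dotNN (u v : 'rV[R]_3) : dot (- u) (- v) = dot u v.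
Proof. by rewrite dot3Nl dot3C dot3Nl opprK dot3C. Qed.

Lemma smvN n : smv O n (fun q => - A q).
Proof.
move=> i; rewrite (_ : (fun _ => _) = fun q => - A q 0 i); first exact/sm_opp/sA.
by apply/funext => q; rewrite mxE.
Qed.

Lemma vtN p : O p -> vt (fun q => - A q) p = - vt A p.
Proof.
move=> Op; apply/rowP => i; rewrite [RHS]mxE !vtE.
have D := is_derive1N (sm_is_dt (sA 1 i) Op).
apply: is_derive1_unique (sm_is_dt (smvN 1 i) Op) _.
by apply: is_derive1_ext D => y; rewrite mxE.
Qed.

(** Negating the surface keeps its normal, hence its Gauss map, while its second derivatives change
    sign. This is how the sign of [c] is normalised. *)
Lemma crs_vN p : O p -> crs (vs (fun q => - A q) p) (vt (fun q => - A q) p) = crs (vs A p) (vt A p).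
Proof. by move=> Op; rewrite (vsN (sA 1) Op) vtN // crsNN. Qed.

Lemma vsvsN p : O p -> vs (vs (fun q => - A q)) p = - vs (vs A) p.
Proof.
move=> Op; rewrite (vs_ext oO (fun q Oq => vsN (sA 1) Oq) Op).
exact: (vsN (smv_vs oO (sA 2)) Op).
Qed.

End NegatedField.

Lemma vtvsN (R : realType) (O : set (R * R)) A p : open O -> (forall n, smv O n A) -> O p ->
  vt (vs (fun q => - A q)) p = - vt (vs A) p.
Proof.
move=> oO sA Op; rewrite (vt_ext oO (fun q Oq => vsN (sA 1) Oq) Op).
exact: (vtN (fun n => smv_vs oO (sA n.+1)) Op).
Qed.

Lemma vtvtN (R : realType) (O : set (R * R)) A p : open O -> (forall n, smv O n A) -> O p ->
  vt (vt (fun q => - A q)) p = - vt (vt A) p.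
Proof.
move=> oO sA Op; rewrite (vt_ext oO (fun q Oq => vtN sA Oq) Op).
exact: (vtN (fun n => smv_vt oO (sA n.+1)) Op).
Qed.

Lemma sm_subset (R : realType) (O O' : set (R * R)) n f : O' `<=` O -> sm O n f -> sm O' n f.
Proof.
move=> sub; elim: n f => [|n IH] f [cf H]; split.
- by move=> p /sub; exact: cf.
- by [].
- by move=> p /sub; exact: cf.
have [fs [ft [Hs Ht s1 s2]]] := H; exists fs, ft; split; [| |exact: IH|exact: IH].
- by move=> p /sub; exact: Hs.
- by move=> p /sub; exact: Ht.
Qed.

Lemma open_setI_neq (R : realType) (O : set (R * R)) (f : R * R -> R) (k : R) :
  open O -> (forall p, O p -> {for p, continuous f}) -> open [set p | O p /\ f p != k].
Proof.
move=> oO cf; rewrite openE => p [Op fp].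
have n1 : nbhs p O by exact: open_nbhs_nbhs.
have n2 : nbhs p (f @^-1` [set x | x != k]).
  by apply: (cf _ Op); apply: open_nbhs_nbhs; split=> //; exact: open_neq.
by apply: (filterS _ (filterI n1 n2)) => q [].
Qed.

Section RotatedFrame.
Variables (R : realType) (x y : R) (a b : 'rV[R]_3).
Local Notation u := (x *: a + y *: b).
Local Notation v := (- y *: a + x *: b).

Lemma crs_rotate : crs u v = (x ^+ 2 + y ^+ 2) *: crs a b.
Proof.
have [a0 a1 a2] := cross3E u v; have [b0 b1 b2] := cross3E a b.
apply: rV3P; rewrite ?a0 ?a1 ?a2 [RHS]mxE ?b0 ?b1 ?b2 !row_lincomb; ring.
Qed.

Lemma dot_rotate : dot a a = dot b b -> dot a b = 0 -> dot u u = dot v v /\ dot u v = 0.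
Proof.
move=> h1 h2.
have e (k l k' l' : R) : dot (k *: a + l *: b) (k' *: a + l' *: b) =
    k * k' * dot a a + (k * l' + l * k') * dot a b + l * l' * dot b b.
  by rewrite !dot3E !row_lincomb; ring.
by rewrite !e h1 h2; split; ring.
Qed.

End RotatedFrame.

Section Translation.
Variable R : realType.

Lemma dotU : @dot3 R = @dot R. Proof. by rewrite unlock. Qed.
Lemma crsU : @cross3 R = @crs R. Proof. by rewrite unlock. Qed.
Lemma pxU (F : R * R -> 'rV[R]_3) : dx F = px F. Proof. by rewrite pxE. Qed.
Lemma pyU (F : R * R -> 'rV[R]_3) : dy F = py F. Proof. by rewrite pyE. Qed.

Lemma unit_normalE (F : R * R -> 'rV[R]_3) q :
  unit_normal F q = (vnorm (crs (px F q) (py F q)))^-1 *: crs (px F q) (py F q).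
Proof. by rewrite /unit_normal /enorm3 /vnorm dotU crsU pxU pyU. Qed.

(** In conformal coordinates the mean curvature is [(e + g) / (2 E)], so its vanishing is that of
    the normal part of the Laplacian. *)
Lemma minimal_trace (F : R * R -> 'rV[R]_3) q : mean_curvature F q = 0 ->
  crs (px F q) (py F q) <> 0 -> dot (px F q) (px F q) = dot (py F q) (py F q) ->
  dot (px F q) (py F q) = 0 ->
  dot (px (px F) q + py (py F) q) (crs (px F q) (py F q)) = 0.
Proof.
move=> H m0 h1 h2; move: H; rewrite /mean_curvature dotU unit_normalE !pxU !pyU h2 -h1 !dot3Zr dot3Dl.
have nn : 0 < dot (crs (px F q) (py F q)) (crs (px F q) (py F q)).
  by rewrite lt_neqAle dot3_ge0 andbT eq_sym; apply/eqP => /dot3_eq0.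
have E : dot (px F q) (px F q) != 0.
  by apply/eqP => h; move: nn; rewrite cross_norm -h1 h2 h expr0n subr0 mul0r ltxx.
have k0 : vnorm (crs (px F q) (py F q)) != 0 by rewrite /vnorm gt_eqF // sqrtr_gt0.
move: (dot (px (px F) q) _) (dot (py (py F) q) _) (dot (py (px F) q) _) (vnorm _) (dot (px F q) _) E k0.
move=> e g f k w w0 k0.
have -> : (k^-1 * e * w - 2 * (k^-1 * f) * 0 + k^-1 * g * w) / (2 * (w * w - 0 ^+ 2))
   = (e + g) / (2 * k * w) by field; rewrite w0.
by move/eqP; rewrite mulf_eq0 invr_eq0 !mulf_eq0 pnatr_eq0 (negbTE k0) (negbTE w0) !orbF => /eqP.
Qed.

End Translation.

Theorem theorem4p1 (R : realType) (Rr : R) (F : R * R -> 'rV[R]_3) :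
  1 < Rr ->
  smooth_upto (closed_annulus Rr) F ->
  immersion_on (closed_annulus Rr) F ->
  conformal_on (closed_annulus Rr) F ->
  minimal_on (annulus Rr) F ->
  free_boundary_annulus Rr F ->
  injective_on (circle 1) F ->
  injective_on (circle Rr) F ->
  (* normalization (after a rotation): g omits the value infinity *)
  (forall p, closed_annulus Rr p -> unit_normal F p 0 2%:R != 1) ->
  injective_on (annulus Rr) (gauss_map F) /\
  region_bounded_by (gauss_map F @` annulus Rr)
    (gauss_map F @` circle 1) (gauss_map F @` circle Rr).
Proof.
move=> Rr1 [U [oU [cAU smF]]] immF confF minF [insF [sphF orthF]] inj1 injR omitF.
pose L := ln Rr; have RrE : expR L = Rr by rewrite lnK // posrE (lt_trans _ Rr1).
have L0 : 0 < L by rewrite ln_gt0.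
have P0 : 0 < pi *+ 2 :> R by rewrite mulrn_wgt0 // pi_gt0.
pose X := F \o @polar R; pose V := @polar R @^-1` U.
have oV : open V by exact: polar_preimage_open.
have CF n : Ck U n F by exact: smF.
have sX n : smv V n X by exact: pullback_smooth.
have lt2 (a b : R) : (expR a ^+ 2 < expR b ^+ 2) = (a < b).
  by rewrite ltr_sqr ?nnegrE ?expR_ge0 // ltr_expR.
have le2 (a b : R) : (expR a ^+ 2 <= expR b ^+ 2) = (a <= b).
  by rewrite ler_sqr ?nnegrE ?expR_ge0 // ler_expR.
have one2 : 1 = expR 0 ^+ 2 :> R by rewrite expR0 expr1n.
have SA p : 0 <= p.1 <= L -> closed_annulus Rr (polar p).
  by rewrite /closed_annulus /= polar_norm -RrE le2 one2 le2.
have IA p : 0 < p.1 < L -> annulus Rr (polar p).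
  by rewrite /annulus /= polar_norm -RrE lt2 one2 lt2.
have cir (s t : R) : circle (expR s) (polar (s, t)) by rewrite /circle /= (polar_norm (s, t)).
have bdA p : p.1 = 0 \/ p.1 = L -> (circle 1 `|` circle Rr) (polar p).
  by case: p => s t /= [->|->]; [left; rewrite -(@expR0 R)|right; rewrite -RrE]; exact: cir.
pose m q := crs (px F q) (py F q); pose n p := crs (vs X p) (vt X p).
pose r (p : R * R) : R := expR p.1 ^+ 2.
have r0 p : 0 < r p by rewrite exprn_gt0 // expR_gt0.
have nE p : V p -> n p = r p *: m (polar p).
  move=> Vp; rewrite /n (pullback_vs (CF 1) Vp) (pullback_vt (CF 1) Vp) crs_rotate.
  by rewrite /r -polar_norm.
have NE p : V p -> normal X p = unit_normal F (polar p).
  move=> Vp; rewrite normalE -/(n p) unit_normalE -/(m (polar p)) -/(vnorm (n p)) nE //.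
  rewrite vnormZ // invfM scalerA -mulrA (mulrC _ (r p)) mulrA mulVf ?mul1r //.
  by rewrite gt_eqF.
(* Immersion and omission of the pole are given on the closed annulus only. Two open conditions in
   turn extend them to a neighbourhood of the strip; the second is open because the normal is
   continuous where the first holds. *)
pose O1 := [set p | V p /\ dot (n p) (n p) != 0].
pose O := [set p | O1 p /\ normal X p 0 2%:R != 1].
have sn k : smv V k n.
  by apply: smv_cross; [apply: smv_vs|apply: smv_vt].
have oO1 : open O1.
  by apply: open_setI_neq => // p; exact: (sm_continuous (sm_dot (sn 0) (sn 0))).
have O1V : O1 `<=` V by move=> p [].
have sX1 k : smv O1 k X by move=> i; exact: sm_subset O1V (sX k i).
have imm1 p : O1 p -> n p <> 0.
  by move=> [_ /eqP h] n0; apply: h; rewrite n0 dot3E !mxE; ring.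
have oO : open O.
  apply: open_setI_neq => // p O1p.
  exact: (sm_continuous (normal_smooth oO1 sX1 imm1 0 2%:R) O1p).
have OV : O `<=` V by move=> p [[]].
have sXO k : smv O k X by move=> i; exact: sm_subset OV (sX k i).
have SV p : 0 <= p.1 <= L -> V p by move=> /SA; exact: cAU.
have m0 p : 0 <= p.1 <= L -> m (polar p) <> 0.
  by move=> /SA /immF; rewrite pxU pyU crsU => /eqP.
have SO p : 0 <= p.1 <= L -> O p.
  move=> pS; have Vp := SV _ pS; split; last by rewrite NE //; exact/omitF/SA.
  split=> //; apply/eqP => /dot3_eq0; rewrite nE // => /eqP.
  by rewrite scaler_eq0 (gt_eqF (r0 p)) /=; apply/negP/eqP; exact: m0.
have immO p : O p -> n p <> 0 by move=> [/imm1].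
have XP s t : X (s, t + pi *+ 2) = X (s, t) by rewrite /X /= polar_periodic.
have confm p : 0 <= p.1 <= L -> dot (px F (polar p)) (px F (polar p)) =
    dot (py F (polar p)) (py F (polar p)) /\ dot (px F (polar p)) (py F (polar p)) = 0.
  by move=> /SA /confF; rewrite dotU pxU pyU.
have conf p : 0 <= p.1 <= L -> dot (vs X p) (vs X p) = dot (vt X p) (vt X p) /\
    dot (vs X p) (vt X p) = 0.
  move=> pS; have Vp := SV _ pS; have [h1 h2] := confm _ pS.
  by rewrite (pullback_vs (CF 1) Vp) (pullback_vt (CF 1) Vp); exact: dot_rotate.
have mini p : 0 < p.1 < L -> dot (vs (vs X) p + vt (vt X) p) (n p) = 0.
  move=> pI; have pS : 0 <= p.1 <= L by case/andP: pI => ? ?; rewrite !ltW.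
  have Vp := SV _ pS; have [h1 h2] := confm _ pS.
  rewrite (pullback_laplacian oU (CF 2) Vp) nE // dot3Zl dot3Zr.
  by rewrite (minimal_trace (minF _ (IA _ pI)) (m0 _ pS) h1 h2) !mulr0.
have ins p : 0 < p.1 < L -> dot (X p) (X p) < 1 by move=> /IA /insF; rewrite dotU.
have sph p : p.1 = 0 \/ p.1 = L -> dot (X p) (X p) = 1 by move=> /bdA /sphF; rewrite dotU.
have orth p : p.1 = 0 \/ p.1 = L -> dot (n p) (X p) = 0.
  move=> pbd; have pS : 0 <= p.1 <= L by case: pbd => ->; rewrite lexx ltW.
  have := orthF _ (bdA _ pbd); rewrite dotU unit_normalE dot3Zl nE; last exact: SV.
  have k0 : (vnorm (m (polar p)))^-1 != 0.
    rewrite invr_eq0 /vnorm gt_eqF // sqrtr_gt0 lt_neqAle dot3_ge0 andbT eq_sym.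
    by apply/eqP => /dot3_eq0; exact: m0.
  by move=> /eqP; rewrite mulf_eq0 (negbTE k0) /= dot3Zl => /eqP ->; rewrite mulr0.
have simple s t t' : s = 0 \/ s = L -> t < t' < t + pi *+ 2 -> X (s, t) <> X (s, t').
  move=> sbd tt E; apply: (polar_angle_inj (s := s) tt).
  have h1 := cir s t; have h2 := cir s t'; move: sbd h1 h2 E => [->|->]; rewrite ?expR0 ?RrE.
    exact: inj1.
  exact: injR.
have omitO p : O p -> normal X p 0 2%:R != 1 by move=> [].
have hG p : O p -> gauss_map F (polar p) = gauss X p.
  by move=> Op; rewrite /gauss_map /gauss NE //; exact: OV.
rewrite -RrE.
have [c c0 sf] := second_form_constant L0 P0 oO SO sXO XP immO conf mini ins sph orth.
have [c_gt0|c_le0] := ltP 0 c.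
  exact: (strip_gauss_annulus L0 P0 oO SO sXO XP immO conf mini ins sph orth c_gt0 sf
    simple omitO erefl hG).
have c_lt0 : 0 < - c by rewrite oppr_gt0 lt_neqAle c0.
(* For negative [c] the antipodal surface satisfies the same hypotheses with the constant [- c] and
   the same Gauss map. *)
pose Y p := - X p.
have sY := smvN sXO; rewrite -/Y in sY.
have nY p : O p -> crs (vs Y p) (vt Y p) = n p by exact: crs_vN.
have NY p : O p -> normal Y p = normal X p by move=> Op; rewrite !normalE nY.
have IS (p : R * R) : 0 < p.1 < L -> 0 <= p.1 <= L by case/andP=> ? ?; rewrite !ltW.
have bS (p : R * R) : p.1 = 0 \/ p.1 = L -> 0 <= p.1 <= L by case=> ->; rewrite lexx ltW.
have YP s t : Y (s, t + pi *+ 2) = Y (s, t) by rewrite /Y XP.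
have immY p : O p -> crs (vs Y p) (vt Y p) <> 0 by move=> Op; rewrite nY //; exact: immO.
have confY p : 0 <= p.1 <= L -> dot (vs Y p) (vs Y p) = dot (vt Y p) (vt Y p) /\
    dot (vs Y p) (vt Y p) = 0.
  by move=> pS; have Op := SO _ pS; rewrite /Y (vsN (sXO 1) Op) (vtN sXO Op) !dotNN; exact: conf.
have miniY p : 0 < p.1 < L -> dot (vs (vs Y) p + vt (vt Y) p) (crs (vs Y p) (vt Y p)) = 0.
  move=> pI; have Op := SO _ (IS _ pI); rewrite nY // /Y (vsvsN oO sXO Op) (vtvtN oO sXO Op).
  by rewrite -opprD dot3Nl mini // oppr0.
have insY p : 0 < p.1 < L -> dot (Y p) (Y p) < 1 by rewrite dotNN; exact: ins.
have sphY p : p.1 = 0 \/ p.1 = L -> dot (Y p) (Y p) = 1 by rewrite dotNN; exact: sph.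
have orthY p : p.1 = 0 \/ p.1 = L -> dot (crs (vs Y p) (vt Y p)) (Y p) = 0.
  move=> pbd; rewrite nY; last exact/SO/bS.
  by rewrite dot3C dot3Nl dot3C orth // oppr0.
have sfY p : 0 <= p.1 <= L -> dot (vs (vs Y) p) (crs (vs Y p) (vt Y p)) = - c * dot (vs Y p) (vs Y p) /\
    dot (vt (vs Y) p) (crs (vs Y p) (vt Y p)) = 0.
  move=> pS; have Op := SO _ pS; have [h1 h2] := sf _ pS.
  rewrite nY // /Y (vsvsN oO sXO Op) (vtvsN oO sXO Op) (vsN (sXO 1) Op) dotNN !dot3Nl h1 h2 oppr0.
  by rewrite mulNr.
have simpleY s t t' : s = 0 \/ s = L -> t < t' < t + pi *+ 2 -> Y (s, t) <> Y (s, t').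
  by move=> sbd tt /oppr_inj; exact: simple.
have omitY p : O p -> normal Y p 0 2%:R != 1 by move=> Op; rewrite NY //; exact: omitO.
have hGY p : O p -> gauss_map F (polar p) = gauss Y p.
  by move=> Op; rewrite hG // /gauss NY.
exact: (strip_gauss_annulus L0 P0 oO SO sY YP immY confY miniY insY sphY orthY c_lt0 sfY
  simpleY omitY erefl hGY).
Qed.
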